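(* The $\alpha$-Poincaré exponent $\delta_\alpha$ has the following three characterisations. (i) For $\alpha\in[\underline{\psi},\overline{\psi}]$, $\delta_\alpha$ is uniquely determined by $\mathcal{P}(\delta_\alpha\varphi,\psi_\alpha)=0$. (ii) For $\alpha\in(\underline{\psi},\overline{\psi})$, $\delta_\alpha$ is determined by the unique solution $(\delta_\alpha,q_\alpha)\in\mathbb{R}^2$ of the equations $$\mathfrak{P}(\delta_\alpha\varphi+q_\alpha\psi_\alpha)=0\qquad\text{and}\qquad \frac{\partial}{\partial q}\mathfrak{P}(\delta_\alpha\varphi+q\psi_\alpha)\Big|_{q=q_\alpha}=0 .$$ In particular, $\int\psi\,d\mu_{\delta_\alpha\varphi+q_\alpha\psi_\alpha}=\alpha$. (iii) Let $s:\mathbb{R}\times\mathbb{R}\to\mathbb{R}$ be the function implicitly defined by $\mathfrak{P}(s(q,a)\varphi+q\psi+a\mathbf{1})=0$, where $\mathbf 1$ is the constant function $1$. Then $s$ is convex, and for its Legendre transform $$\widehat{s}(\alpha_1,\alpha_2)=\sup_{(q,a)\in\mathbb{R}^2}\big(q\alpha_1+a\alpha_2-s(q,a)\big)$$ we have for $\alpha\in(\underline{\psi},\overline{\psi})$ $$\delta_\alpha=-\inf_{r\in\mathbb{R}}\widehat{s}(\alpha r,r)=\inf_{r\in\mathbb{R}}s(r,-\alpha r).$$ In particular, on the line $g$ through the origin with slope $-\alpha$ in the $(q,a)$-plane there exists exactly one point $(r,-\alpha r)$ such that the gradient of $s$ at this point is perpendicular to $g$. The height of $s$ at $(r,-\alpha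 r)$ is $\delta_\alpha$, and the plane tangential to the graph of $s$ at $(r,-\alpha r,s(r,-\alpha r))$ intersects the $s$-axis in $\delta_\alpha$.
   Context: Setting. Let $I=\{1,\dots,m\}$, $m\ge 2$, and let $I_i\subset[0,1]$, $i\in I$, be pairwise disjoint intervals with non-empty interior. $F$ is an expanding interval map with $C^{1+\epsilon}$ full branches $F|_{I_i}:I_i\to[0,1]$: the continuous continuation $H_i$ of $F|_{I_i}$ to $\overline{I_i}$ is a $C^{1+\epsilon}$ diffeomorphism of $\overline{I_i}$ onto $[0,1]$ with $|H_i'|>1$. Put $h_i=H_i^{-1}$. Let $\Sigma=I^{\mathbb{N}}$ with left shift $\sigma$ and metric $d(\omega,\tau)=\exp(-\max\{k\ge0:\omega_1=\tau_1,\dots,\omega_k=\tau_k\})$, and $\pi:\Sigma\to[0,1]$ the coding map, $\{\pi(\omega)\}=\bigcap_{n}h_{\omega_1}\circ\cdots\circ h_{\omega_n}([0,1])$. $I^\star$ is the set of finite words over $I$ (including the empty word), $|\omega|$ the length of $\omega$, $[\omega]=\{x\in\Sigma:x|_{|\omega|}=\omega\}$. Let $\Psi:[0,1]\to\mathbb{Z}$ be constant on each $I_i$. For $f:\Sigma\to\mathbb{R}$, $S_nf=\sum_{k=0}^{n-1}f\circ\sigma^k$ and $S_\omega f=\sup_{x\in[\omega]}S_{|\omega|}f(x)$ for $\omega\in I^\star$. The geometric potential $\varphi:\Sigma\to(-\infty,0)$ is the Hölder continuous function with $\varphi(\omega)=-\log|F'(\pi(\omega))|$ except possibly on a finite set (i.e.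 $\varphi(\omega)=-\log|H_{\omega_1}'(\pi(\omega))|$). The symbolic step length function $\psi:\Sigma\to\mathbb{Z}$ is constant on one-cylinder sets and equals $\Psi\circ\pi$ except possibly on a finite set (i.e. $\psi(\omega)$ is the value of $\Psi$ on $I_{\omega_1}$). Put $\psi_\alpha=\psi-\alpha$, $\underline{\psi}=\inf_{\omega\in\Sigma}\liminf_{n}S_n\psi(\omega)/n$, $\overline{\psi}=\sup_{\omega\in\Sigma}\limsup_{n}S_n\psi(\omega)/n$. $\alpha$-Poincaré exponent: $\delta_\alpha=\inf\{s\ge0:\sum_{\omega\in I^\star,\,|S_\omega(\psi-\alpha)|\le K}e^{s\,S_\omega\varphi}<\infty\}$, where $K>0$ is sufficiently large. Classical pressure: $\mathfrak{P}(f)=\lim_{n}\frac1n\log\sum_{\omega\in I^n}\exp(S_\omega f)$. For Hölder continuous $f$, $\mu_f$ is the Gibbs measure: the unique $\sigma$-invariant Borel probability measure on $\Sigma$ for which there is $c\ge1$ with $c^{-1}\le\mu_f([\omega])/\exp(S_nf(x)-n\mathfrak{P}(f))\le c$ for all $n\in\mathbb{N}$, $\omega\in I^n$, $x\in[\omega]$. Fibre-induced pressure: for Hölder continuous $f,\chi:\Sigma\to\mathbb{R}$, $\mathcal{P}(f,\chi)=\lim_{K\to\infty}\limsup_{n\to\infty}\frac1n\log\sum_{\omega\in I^n,\,|S_\omega\chi|\le K}e^{S_\omega f}$. *)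

(* Defs.v *)
From HB Require Import structures.
From mathcomp Require Import all_boot all_order all_algebra.
From mathcomp Require Import all_classical all_reals all_analysis.
Import Order.TTheory GRing.Theory Num.Theory.
Import numFieldNormedType.Exports.

Set Implicit Arguments.
Unset Strict Implicit.
Unset Printing Implicit Defensive.

Local Open Scope classical_set_scope.
Local Open Scope ring_scope.

(* The alphabet I has m >= 2 letters; it is rendered as 'I_m'.+2, m = m' + 2.
   Sequences and words are indexed from 0: omega_1 is x 0. *)
Notation letter m' := 'I_m'.+2.
Notation Sigma m' := (nat -> 'I_m'.+2).

HB.instance Definition _ (m' : nat) := isPointed.Build (letter m') ord0.

Section ExpandingMaps.
Context {R : realType}.
Implicit Types (D E : set R) (f g : R -> R).

(* Derivative relative to D: two-sided at interior points of an interval D,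
   one-sided at those of its endpoints that belong to D. *)
Definition diff_quot f (x y : R) : R := (f y - f x) / (y - x).

Definition derivable_within D f (x : R) : Prop :=
  cvg (diff_quot f x y @[y --> within D x^']).

Definition derive_within D f (x : R) : R :=
  lim (diff_quot f x y @[y --> within D x^']).

Definition C1_hoelder (eps : R) D f : Prop :=
  (forall x, D x -> derivable_within D f x) /\
  exists C : R, forall x y, D x -> D y ->
    `|derive_within D f x - derive_within D f y| <= C * `|x - y| `^ eps.

Definition C1_hoelder_diffeo (eps : R) D E f g : Prop :=
  [/\ set_fun D E f /\ set_fun E D g,
      (forall x, D x -> g (f x) = x), (forall y, E y -> f (g y) = y),
      C1_hoelder eps D f & C1_hoelder eps E g].

Record expanding_full_branches (m' : nat) (eps : R) (J : letter m' -> set R)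
    (F : R -> R) (H h : letter m' -> R -> R) : Prop := {
  branch_interval : forall i, is_interval (J i);
  branch_sub : forall i, J i `<=` `[0, 1];
  branch_interior : forall i, (J i)° !=set0;
  branch_disjoint : trivIset [set: letter m'] J;
  branch_continuation : forall i x, J i x -> F x = H i x;
  branch_diffeo : forall i,
    C1_hoelder_diffeo eps (closure (J i)) `[0, 1] (H i) (h i);
  branch_expanding : forall i x, closure (J i) x ->
    1 < `|derive_within (closure (J i)) (H i) x| }.

(* h_{x_1} o ... o h_{x_n} *)
Definition branch_comp m' (h : letter m' -> R -> R) (x : Sigma m') (n : nat)
    : R -> R :=
  foldr (fun i g => h i \o g) id (mkseq x n).

(* The intersection is a singleton for expanding full branches. *)
Definition coding m' (h : letter m' -> R -> R) (x : Sigma m') : R :=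
  get (\bigcap_n (branch_comp h x n @` `[0, 1])).

Definition geometric_potential m' (J : letter m' -> set R)
    (H h : letter m' -> R -> R) (x : Sigma m') : R :=
  - ln `|derive_within (closure (J (x 0))) (H (x 0)) (coding h x)|.

(* Psi is assumed constant on each J i, so any point of J (x 0) will do. *)
Definition step_length m' (J : letter m' -> set R) (Psi : R -> int)
    (x : Sigma m') : R :=
  (Psi (get (J (x 0))))%:~R.

End ExpandingMaps.

Section SymbolicDynamics.
Context {R : realType} {m' : nat}.
Implicit Types (f chi phi psi : Sigma m' -> R) (x y : Sigma m').

Definition left_shift x : Sigma m' := fun n => x n.+1.

Definition cylinder (w : seq (letter m')) : set (Sigma m') :=
  [set x | mkseq x (size w) = w].

(* exp (- max {k | x and y agree on their first k letters}); the infimum is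
   attained when x <> y and is 0 = exp (- oo) when x = y. *)
Definition seq_dist x y : R :=
  inf [set expR (- k%:R) | k in [set k : nat | mkseq x k = mkseq y k]].

Definition seq_open (A : set (Sigma m')) : Prop :=
  forall x, A x -> exists2 e : R, 0 < e & forall y, seq_dist x y < e -> A y.

Definition birkhoff f (n : nat) x : R := \sum_(k < n) f (iter k left_shift x).

Definition word_sup f (w : seq (letter m')) : R :=
  sup [set birkhoff f (size w) x | x in cylinder w].

Definition psi_low psi : \bar R :=
  ereal_inf [set limn_einf (fun n => (birkhoff psi n x / n%:R)%:E)
            | x in [set: Sigma m']].

Definition psi_high psi : \bar R :=
  ereal_sup [set limn_esup (fun n => (birkhoff psi n x / n%:R)%:E)
            | x in [set: Sigma m']].

Definition poincare_series phi psi (alpha K s : R) : \bar R :=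
  \esum_(w in [set w : seq (letter m') |
                 `|word_sup (fun x => psi x - alpha) w| <= K])
     (expR (s * word_sup phi w))%:E.

Definition critical_exponent phi psi (alpha K : R) : \bar R :=
  ereal_inf [set s%:E | s in
    [set s : R | 0 <= s /\ (poincare_series phi psi alpha K s < +oo)%E]].

(* delta is the alpha-Poincare exponent: the critical exponent is the same
   number delta for all sufficiently large K. *)
Definition is_poincare_exponent phi psi (alpha delta : R) : Prop :=
  \forall K \near +oo, critical_exponent phi psi alpha K = delta%:E.

Definition pressure f : R :=
  limn (fun n => n%:R^-1 *
          ln (\sum_(w : n.-tuple (letter m')) expR (word_sup f w))).

(* lne 0 = -oo, so that an empty sum contributes -oo to the limsup. *)
Definition fibre_pressure f chi : \bar R :=
  lim (limn_esup (fun n => (n%:R^-1)%:E *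
         lne (\sum_(w : n.-tuple (letter m') | `|word_sup chi w| <= K)
                expR (word_sup f w))%:E)%E @[K --> +oo]).

End SymbolicDynamics.

(* Sigma with the Borel sigma-algebra of the metric seq_dist. *)
Notation SigmaBorel R m' := (g_sigma_algebraType (@seq_open R m')).

Definition is_gibbs_measure (R : realType) (m' : nat) (f : Sigma m' -> R)
    (mu : probability (SigmaBorel R m') R) : Prop :=
  (forall A : set (SigmaBorel R m'), measurable A ->
     mu (left_shift @^-1` A) = mu A) /\
  exists2 c : R, 1 <= c &
    forall (n : nat) (w : n.-tuple (letter m')) (x : Sigma m'), cylinder w x ->
      c^-1 <= fine (mu (cylinder w)) /
                expR (birkhoff f n x - n%:R * pressure f) <= c.

Section ConvexGeometry.
Context {R : realType}.
Implicit Types (s : R * R -> R) (p v : R * R).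

Definition dot p v : R := p.1 * v.1 + p.2 * v.2.

Definition legendre s v : \bar R :=
  ereal_sup [set (dot p v - s p)%:E | p in [set: R * R]].

Definition gradient s p : R * R := ('d s p (1, 0), 'd s p (0, 1)).

Definition line (slope : R) : set (R * R) := [set p | p.2 = slope * p.1].

Definition gradient_perp s p (g : set (R * R)) : Prop :=
  differentiable s p /\ forall v, g v -> dot (gradient s p) v = 0.

Definition tangent_plane s p : set (R * R * R) :=
  [set z | z.2 = s p + dot (gradient s p) (z.1 - p)].

Definition height_axis : set (R * R * R) := [set z | z.1 = (0, 0)].

End ConvexGeometry.

(* Main.v *)
Require Import Defs.
From HB Require Import structures.
From mathcomp Require Import all_boot all_order all_algebra.
From mathcomp Require Import all_classical all_reals all_analysis.
From mathcomp Require Import measurable_realfun ring lra.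
Import Order.TTheory GRing.Theory Num.Theory.
Import numFieldNormedType.Exports.

Set Implicit Arguments.
Unset Strict Implicit.
Unset Printing Implicit Defensive.

Local Open Scope classical_set_scope.
Local Open Scope ring_scope.

(* Put P t q = pressure (t phi + q psi), where -L <= phi <= -c < 0. The theorem
   follows from three facts on P: it decreases in t with slopes between -L and
   -c; near each point it lies between an affine function and the same affine
   function plus a quadratic one; and it is strictly above that function in the
   direction q unless psi is constant.

   These facts are proved without spectral theory. If L^n W <= c W for some
   bounded positive W, L being the transfer operator of f, then
   exp(n pressure f) <= c, and similarly from below. An eigenfunction exp u of L
   is obtained as a Banach limit; it makes L a Markov operator Q whose iterates
   contract every Hoelder function G to a constant a(G). Trial functions
   W = exp(u + sum_(j <= N) Q^j G) then give the first-order expansion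
   pressure (f + G) = pressure f + a(G) with a quadratic error.

   The Poincare exponent is the zero of T(t) = inf_q (P t q - q alpha). The sum
   of exp(t S_n phi) over the words of length n with |S_n(psi - alpha)| <= K is
   at most const exp(n T(t)), by Chernoff's bound. Conversely, at the minimiser
   q, most of the mass of exp(S_n(t phi + q(psi - alpha))) sits on words with
   |S_n(psi - alpha)| <= e n, and O(e n) further letters steer the sum back into
   a bounded window; if alpha is an end point of the range, only words in the
   extremal letters occur and q -> oo at fixed n suffices. Part (ii) is the
   critical point equation of the infimum, and in (iii) the supporting planes of
   P become those of s. *)

(** * Words, transfer operators and pressure *)

(** Neither an eigenfunction for [f + G] nor an exact solution of the Poisson equation is ever
    formed. The trial functions depend on a truncation N, the estimates carry an error c r^N, and
    since N is free [le0_geometric] removes that error at the end. Bounded factors between pressures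
    disappear likewise through [linear_drift_le0]. A Banach limit takes the place of a compactness
    argument: it is linear, positive and shift invariant, hence compatible with the finite sum over
    letters that defines L. The same device yields the mean a and a point of the nested intersection
    that defines [coding]. Quadratic two-sided bounds are carried along instead of derivatives. They
    survive the passage to the implicit function s, and derivatives in the sense of the library are
    extracted only at the end. For Gibbs measures, the mean a of the cylinder indicators provides
    weights, realised as an image of Lebesgue measure on [0, 1[. The value of the integral of psi
    follows from the Gibbs inequality and invariance alone: by Jensen it is the slope of a
    supporting line of a differentiable function. *)

Section Words.
Context {R : realType} {m' : nat}.
Implicit Types (f g G : Sigma m' -> R) (x y : Sigma m') (w : seq (letter m')).

Definition agree k x y := forall j, (j < k)%N -> x j = y j.

Definition pre (i : letter m') x : Sigma m' :=
  fun n => if n is n'.+1 then x n' else i.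

Definition prep w x := foldr pre x w.

Lemma agree_prep k w x y : agree k x y -> agree (size w + k) (prep w x) (prep w y).
Proof. by elim: w => // i w IH a [|j] //= jk; apply: IH. Qed.

Lemma agreeW k l x y : (l <= k)%N -> agree k x y -> agree l x y.
Proof. by move=> lk a j jl; apply/a/(leq_trans jl). Qed.

Lemma agreeC k x y : agree k x y -> agree k y x.
Proof. by move=> a j /a. Qed.

Lemma agree_shift k x y : agree k x y -> agree k.-1 (left_shift x) (left_shift y).
Proof. by move=> a j jk; apply: a; case: k jk. Qed.

Lemma prep_cat w1 w2 x : prep (w1 ++ w2) x = prep w1 (prep w2 x).
Proof. by rewrite /prep foldr_cat. Qed.

Lemma shift_prep w x : iter (size w) left_shift (prep w x) = x.
Proof. by elim: w => // i w IH; rewrite [size _]/= iterSr. Qed.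

Lemma iter_shiftE n x j : iter n left_shift x j = x (n + j)%N.
Proof. by elim: n x j => // n IH x j; rewrite iterSr IH addSn. Qed.

Lemma nth_prep w x j :
  prep w x j = if (j < size w)%N then nth ord0 w j else x (j - size w)%N.
Proof.
by elim: w j => [|i w IH] [|j] //=; rewrite ?subn0// IH ltnS subSS.
Qed.

Lemma prep_mkseq x n : prep (mkseq x n) (iter n left_shift x) = x.
Proof.
apply/funext => j; rewrite nth_prep size_mkseq iter_shiftE; case: ltnP => jn.
  by rewrite nth_mkseq.
by rewrite subnKC.
Qed.

Lemma cylinder_prep w x : cylinder w (prep w x).
Proof.
rewrite /cylinder /=; apply: (@eq_from_nth _ ord0); rewrite size_mkseq// => j jw.
by rewrite nth_mkseq// nth_prep jw.
Qed.

Lemma cylinderE w x : cylinder w x <-> x = prep w (iter (size w) left_shift x).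
Proof.
split=> [c|->]; last exact: cylinder_prep.
by rewrite -{1}(prep_mkseq x (size w)) c.
Qed.

Lemma birkhoff0 f x : birkhoff f 0 x = 0.
Proof. by rewrite /birkhoff big_ord0. Qed.

Lemma birkhoffS f n x : birkhoff f n.+1 x = f x + birkhoff f n (left_shift x).
Proof.
rewrite /birkhoff big_ord_recl; congr (_ + _); apply: eq_bigr => i _.
by rewrite -iterSr.
Qed.

Lemma birkhoff_add f n k x :
  birkhoff f (n + k) x = birkhoff f n x + birkhoff f k (iter n left_shift x).
Proof.
elim: n x => [|n IH] x; first by rewrite birkhoff0 add0r.
by rewrite addSn !birkhoffS IH addrA iterSr.
Qed.

Lemma birkhoffD f g n x :
  birkhoff (fun z => f z + g z) n x = birkhoff f n x + birkhoff g n x.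
Proof. by rewrite /birkhoff big_split. Qed.

Lemma birkhoffZ (c : R) f n x : birkhoff (fun z => c * f z) n x = c * birkhoff f n x.
Proof. by rewrite /birkhoff mulr_sumr. Qed.

Lemma birkhoff_cst (c : R) n x : birkhoff (fun=> c) n x = n%:R * c.
Proof. by rewrite /birkhoff sumr_const card_ord mulr_natl. Qed.

Lemma sum_tuple_cat k n (E : seq (letter m') -> R) :
  \sum_(w : (k + n).-tuple (letter m')) E w =
  \sum_(u : k.-tuple (letter m')) \sum_(v : n.-tuple (letter m')) E (u ++ v).
Proof.
rewrite pair_bigA /=.
pose cc (p : k.-tuple (letter m') * n.-tuple (letter m')) := cat_tuple p.1 p.2.
rewrite (reindex cc) //; apply: onW_bij; apply: inj_card_bij.
  move=> [u v] [u' v'] /(congr1 val) /= /eqP.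
  by rewrite eqseq_cat ?size_tuple// => /andP[/eqP/val_inj -> /eqP/val_inj ->].
by rewrite card_prod !card_tuple expnD.
Qed.

Lemma sum_tuple1 (E : seq (letter m') -> R) :
  \sum_(w : 1.-tuple (letter m')) E w = \sum_i E [:: i].
Proof.
rewrite (reindex (fun i : letter m' => [tuple i])) //.
apply: onW_bij; apply: inj_card_bij; last by rewrite card_tuple expn1.
by move=> i j /(congr1 val) [].
Qed.

Lemma sum_tuple0 (E : seq (letter m') -> R) :
  \sum_(w : 0.-tuple (letter m')) E w = E [::].
Proof.
rewrite (eq_bigr (fun=> E [::])); last by move=> w _; rewrite tuple0.
by rewrite sumr_const card_tuple expn0.
Qed.

(* The n-th power of the transfer operator of f. *)
Definition transfer f n G x : R :=
  \sum_(w : n.-tuple (letter m')) expR (birkhoff f n (prep w x)) * G (prep w x).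

Lemma transfer0 f G x : transfer f 0 G x = G x.
Proof.
rewrite /transfer
  (sum_tuple0 (fun w => expR (birkhoff f 0 (prep w x)) * G (prep w x))).
by rewrite birkhoff0 expR0 mul1r.
Qed.

Lemma transfer_add f k n G x :
  transfer f (k + n) G x = transfer f n (transfer f k G) x.
Proof.
rewrite /transfer (sum_tuple_cat k n (fun w => expR (birkhoff f (k + n) (prep w x)) * G (prep w x))).
rewrite exchange_big /=; apply: eq_bigr => v _; rewrite mulr_sumr.
apply: eq_bigr => u _; rewrite prep_cat birkhoff_add.
have -> : iter k left_shift (prep u (prep v x)) = prep v x.
  by have := shift_prep u (prep v x); rewrite size_tuple.
by rewrite expRD mulrA (mulrC (expR _)).
Qed.

Lemma transfer1E f G x :
  transfer f 1 G x = \sum_i expR (f (pre i x)) * G (pre i x).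
Proof.
rewrite /transfer
  (sum_tuple1 (fun w => expR (birkhoff f 1 (prep w x)) * G (prep w x))).
by apply: eq_bigr => i _; rewrite birkhoffS birkhoff0 addr0.
Qed.

Lemma transfer_le f n G G' x : (forall y, G y <= G' y) ->
  transfer f n G x <= transfer f n G' x.
Proof. by move=> le; apply: ler_sum => w _; rewrite ler_wpM2l ?expR_ge0. Qed.

Lemma transferZ f n c G x : transfer f n (fun y => c * G y) x = c * transfer f n G x.
Proof. by rewrite /transfer mulr_sumr; apply: eq_bigr => w _; rewrite mulrCA. Qed.

Lemma transferD f n G G' x :
  transfer f n (fun y => G y + G' y) x = transfer f n G x + transfer f n G' x.
Proof. by rewrite /transfer -big_split /=; apply: eq_bigr => w _; rewrite mulrDr. Qed.

Lemma transfer_gt0 f n x : 0 < transfer f n (fun=> 1) x.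
Proof.
rewrite /transfer (bigD1 [tuple of nseq n ord0]) //= mulr1.
by rewrite ltr_pwDl ?expR_gt0// sumr_ge0// => w _; rewrite mulr1 expR_ge0.
Qed.

End Words.

Section AlmostAdditive.
Context {R : realType}.

Lemma almost_additive_mul (a : nat -> R) D k n : 0 <= D ->
  (forall i j, `|a (i + j)%N - a i - a j| <= D) ->
  `|a (n.+1 * k)%N - n.+1%:R * a k| <= n.+1%:R * D.
Proof.
move=> D0 H; elim: n => [|n IH].
  by rewrite !mul1n !mul1r subrr normr0.
rewrite mulSn.
have -> : a (k + n.+1 * k)%N - n.+2%:R * a k =
  (a (k + n.+1 * k)%N - a k - a (n.+1 * k)%N) + (a (n.+1 * k)%N - n.+1%:R * a k).
  by rewrite -[n.+2]addn1 natrD; ring.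
rewrite -[X in X%:R * D]addn1 natrD mulrDl mul1r addrC (le_trans (ler_normD _ _))//.
exact: lerD.
Qed.

(** Both (a n - D) / n and (a k + D) / k compare with a (n k) / (n k), so every quotient of the
    first kind lies below every one of the second. The supremum of the first kind separates the two
    families. *)
Lemma almost_additive (a : nat -> R) D : 0 <= D ->
  (forall i j, `|a (i + j)%N - a i - a j| <= D) ->
  exists P, forall n, `|a n - n%:R * P| <= D.
Proof.
move=> D0 H.
have cross n k : (a n.+1 - D) / n.+1%:R <= (a k.+1 + D) / k.+1%:R.
  have := almost_additive_mul k.+1 n D0 H; have := almost_additive_mul n.+1 k D0 H.
  rewrite mulnC !ler_norml => /andP[h1 _] /andP[_ h2].
  rewrite ler_pdivrMr// mulrAC ler_pdivlMr// ; lra.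
pose S := [set (a n.+1 - D) / n.+1%:R | n in [set: nat]].
have S0 : S !=set0 by exists ((a 1%N - D) / 1); exists 0%N.
have ub : has_ubound S by exists ((a 1%N + D) / 1) => _ [n _ <-]; exact: (cross n 0%N).
exists (sup S) => -[|n].
  have := H 0%N 0%N; rewrite addn0 subrr sub0r normrN mul0r subr0 => h.
  exact: h.
have h1 : (a n.+1 - D) / n.+1%:R <= sup S by apply: ub_le_sup => //; exists n.
have h2 : sup S <= (a n.+1 + D) / n.+1%:R.
  by apply: ge_sup => // _ [k _ <-]; exact: cross.
move: h1 h2; rewrite ler_pdivrMr// ler_pdivlMr// ler_norml => h1 h2; lra.
Qed.

(** Archimedean property. It discards multiplicative constants when two exponential growth rates are
    compared. *)
Lemma linear_drift_le0 (B c : R) : (forall n : nat, n%:R * c <= B) -> c <= 0.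
Proof.
move=> H; rewrite leNgt; apply/negP => c0.
have := archi_boundP (normr_ge0 (B / c)); have := H (Num.bound `|B / c|).
move=> h1 /(le_lt_trans (ler_norm _)); rewrite ltr_pdivrMr// ltNge.
by rewrite h1.
Qed.

Lemma cvg_average (u : nat -> R) P B :
  (forall n, `|u n - n%:R * P| <= B) -> n%:R^-1 * u n @[n --> \oo] --> P.
Proof.
move=> H; apply/cvgrPdist_le => e e0.
near=> n.
have n0 : 0 < n%:R :> R by rewrite ltr0n; near: n; exact: nbhs_infty_gt.
have -> : P - n%:R^-1 * u n = - (n%:R^-1 * (u n - n%:R * P)).
  by rewrite mulrBr mulKf ?gt_eqF// opprB.
rewrite normrN normrM ger0_norm ?invr_ge0 ?ler0n// mulrC ler_pdivrMr//.
apply: (le_trans (H n)); rewrite mulrC -ler_pdivrMr//.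
by near: n; exact: nbhs_infty_ger.
Unshelve. all: by end_near. Qed.

End AlmostAdditive.

Section Hoelder.
Context {R : realType} {m' : nat} (th : R).
Implicit Types (f g G : Sigma m' -> R) (x y : Sigma m') (w : seq (letter m')).

(** Hölder continuity of exponent - ln th for the metric [seq_dist], since th^k is exp(- k) to that
    power. The case k = 0 makes [C] a bound on the oscillation too, so one constant controls
    both. *)
Definition holder C f := forall k x y, agree k x y -> `|f x - f y| <= C * th ^+ k.

Lemma holder_osc C f x y : holder C f -> `|f x - f y| <= C.
Proof. by move=> /(_ 0%N x y); rewrite expr0 mulr1; apply. Qed.

Lemma holder_ge0 C f : holder C f -> 0 <= C.
Proof. by move=> /(holder_osc (fun=> ord0) (fun=> ord0)); apply: le_trans. Qed.

Hypotheses (th_gt0 : 0 < th) (th_lt1 : th < 1).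

Lemma holder_lin a b C D f g : holder C f -> holder D g ->
  holder (`|a| * C + `|b| * D) (fun x => a * f x + b * g x).
Proof.
move=> hf hg k x y axy.
have -> : a * f x + b * g x - (a * f y + b * g y) =
          a * (f x - f y) + b * (g x - g y) by ring.
rewrite (le_trans (ler_normD _ _))// !normrM mulrDl lerD// -mulrA ler_wpM2l//.
- exact: hf.
- exact: hg.
Qed.

Lemma holder_cst c : holder 0 (fun=> c).
Proof. by move=> k x y _; rewrite subrr normr0 mul0r. Qed.

Lemma holderW C C' f : C <= C' -> holder C f -> holder C' f.
Proof.
by move=> CC hf k x y a; apply: (le_trans (hf k x y a)); rewrite ler_wpM2r ?exprn_ge0// ltW.
Qed.

Lemma holder_addc C f c : holder C f -> holder C (fun x => f x + c).
Proof. by move=> hf k x y a; rewrite [f y + c]addrC addrKA; exact: hf. Qed.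

Lemma holder_bounded C f : holder C f -> exists B, forall x, `|f x| <= B.
Proof.
move=> hf; exists (`|f (fun=> ord0)| + C) => x.
have := holder_osc x (fun=> ord0) hf; rewrite -{2}(subrK (f (fun=> ord0)) (f x)).
by move=> h; rewrite (le_trans (ler_normD _ _))// addrC lerD.
Qed.

Lemma holder_shift C f : holder C f -> holder (C / th) (fun x => f (left_shift x)).
Proof.
move=> hf [|k] x y a.
  rewrite expr0 mulr1 (le_trans (holder_osc _ _ hf))// ler_pdivlMr//.
  by rewrite ler_piMr ?(holder_ge0 hf)// ltW.
apply: (le_trans (hf _ _ _ (agree_shift a))).
by rewrite /= exprS mulrA divfK ?gt_eqF.
Qed.

(** Sum of the series C + C th + C th^2 + ..., which bounds the variation of every Birkhoff sum on a
    cylinder of its length. *)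
Definition distortion C := C / (1 - th).

Lemma distortion_ge0 C : 0 <= C -> 0 <= distortion C.
Proof. by move=> C0; rewrite divr_ge0// subr_ge0 ltW. Qed.

Lemma holder_birkhoff C f w k x y : holder C f -> agree k x y ->
  `|birkhoff f (size w) (prep w x) - birkhoff f (size w) (prep w y)| <=
    distortion C * th ^+ k.
Proof.
move=> hf axy; have C0 := holder_ge0 hf.
(* The factor 1 - th^|w| keeps the finite geometric sum; the induction on [w] closes only with
   it. *)
suff : `|birkhoff f (size w) (prep w x) - birkhoff f (size w) (prep w y)| <=
    distortion C * th ^+ k * (1 - th ^+ size w).
  move=> /le_trans; apply; rewrite ler_piMr//; last first.
    by rewrite gerBl exprn_ge0// ltW.
  by rewrite mulr_ge0 ?distortion_ge0// exprn_ge0// ltW.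
elim: w => [|i w IH]; first by rewrite /= !birkhoff0 !subrr normr0 mulr0.
rewrite [size _]/= !birkhoffS.
have -> : left_shift (prep (i :: w) x) = prep w x by [].
have -> : left_shift (prep (i :: w) y) = prep w y by [].
rewrite opprD addrACA (le_trans (ler_normD _ _))//.
apply: (le_trans (lerD (hf _ _ _ (@agree_prep _ _ (i :: w) _ _ axy)) IH)).
rewrite /distortion [size _]/= addSn !exprS exprD.
have h1 : 1 - th != 0 by rewrite subr_eq0 gt_eqF.
rewrite -subr_ge0.
have -> : C / (1 - th) * th ^+ k * (1 - th * th ^+ size w) -
  (C * (th * (th ^+ size w * th ^+ k)) + C / (1 - th) * th ^+ k * (1 - th ^+ size w))
  = C * th ^+ size w * th ^+ k * (1 - th) by field.
by rewrite !mulr_ge0 ?exprn_ge0// ?subr_ge0// ltW.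
Qed.

Lemma birkhoff_cylinder C f w x y : holder C f -> cylinder w x -> cylinder w y ->
  birkhoff f (size w) x <= birkhoff f (size w) y + distortion C.
Proof.
move=> hf /cylinderE -> /cylinderE ->.
have := @holder_birkhoff C f w 0 (iter (size w) left_shift x)
   (iter (size w) left_shift y) hf (fun j => ltac:(by [])).
by rewrite expr0 mulr1 ler_norml => /andP[_]; rewrite lerBlDl.
Qed.

Lemma word_sup_ge C f w x : holder C f -> cylinder w x ->
  birkhoff f (size w) x <= word_sup f w.
Proof.
move=> hf wx; apply: ub_le_sup; last by exists x.
exists (birkhoff f (size w) x + distortion C) => _ [y wy <-].
exact: (birkhoff_cylinder hf).
Qed.

Lemma word_sup_le C f w x : holder C f -> cylinder w x ->
  word_sup f w <= birkhoff f (size w) x + distortion C.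
Proof.
move=> hf wx; apply: ge_sup; first by exists (birkhoff f (size w) x), x.
by move=> _ [y wy <-]; exact: (birkhoff_cylinder hf).
Qed.

Lemma transfer_distort C f n k x y : holder C f -> agree k x y ->
  transfer f n (fun=> 1) x <=
  expR (distortion C * th ^+ k) * transfer f n (fun=> 1) y.
Proof.
move=> hf a; rewrite /transfer mulr_sumr; apply: ler_sum => w _.
rewrite !mulr1 -expRD ler_expR -lerBlDr.
have := holder_birkhoff w hf a; rewrite size_tuple ler_norml => /andP[_]; apply.
Qed.

(** Bounded distortion makes ln (L^n 1)(x0) almost additive in n, which produces a rate [P] with
    bounded error. Replacing x0 by [x], or the values by suprema over cylinders, costs one more
    distortion, so the sequence defining [pressure] converges to the same [P]. *)
Lemma pressure_dev C f : holder C f -> exists P, forall n x,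
  expR (- (3 * distortion C) + n%:R * P) <= transfer f n (fun=> 1) x <=
  expR (3 * distortion C + n%:R * P) /\ pressure f = P.
Proof.
move=> hf; set D := distortion C; have D0 : 0 <= D.
  by rewrite distortion_ge0 ?(holder_ge0 hf).
have dis n x y : transfer f n (fun=> 1) x <= expR D * transfer f n (fun=> 1) y.
  have := @transfer_distort C f n 0 x y hf (fun j => ltac:(by [])).
  by rewrite expr0 mulr1.
pose x0 : Sigma m' := fun=> ord0.
pose z n := transfer f n (fun=> 1) x0.
have z0 n : 0 < z n by exact: transfer_gt0.
have zle n x : transfer f n (fun=> 1) x <= expR D * z n by exact: dis.
have zge n x : expR (- D) * z n <= transfer f n (fun=> 1) x.
  by rewrite expRN mulrC ler_pdivrMr ?expR_gt0// mulrC; exact: dis.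
have aa i j : `|ln (z (i + j)%N) - ln (z i) - ln (z j)| <= D.
  have h1 : z (i + j)%N <= expR D * z i * z j.
    rewrite [z (i + j)%N]transfer_add -[leRHS]transferZ.
    by apply: transfer_le => y; rewrite mulr1; exact: zle.
  have h2 : expR (- D) * z i * z j <= z (i + j)%N.
    rewrite [z (i + j)%N]transfer_add -[leLHS]transferZ.
    by apply: transfer_le => y; rewrite mulr1; exact: zge.
  move: h1 h2; rewrite -[z i]lnK ?posrE// -[z j]lnK ?posrE// -[z (i + j)%N]lnK ?posrE//.
  rewrite -!expRD !ler_expR !expRK => h1 h2; rewrite ler_norml; lra.
have [P HP] := almost_additive D0 aa.
have Pz n : expR (- D + n%:R * P) <= z n <= expR (D + n%:R * P).
  have := HP n; rewrite -[z n]lnK ?posrE// !ler_expR expRK ler_norml; lra.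
exists P => n x; split.
  have /andP[h1 h2] := Pz n; apply/andP; split.
    apply: le_trans (zge n x); rewrite -ler_pdivrMl ?expR_gt0// -expRN opprK -expRD.
    by apply: le_trans h1; rewrite ler_expR; lra.
  apply: (le_trans (zle n x)); rewrite -ler_pdivlMl ?expR_gt0// -expRN -expRD.
  by apply: (le_trans h2); rewrite ler_expR; lra.
apply: cvg_lim => //; apply: (@cvg_average _ _ _ (2 * D)) => k.
set Z := \sum_(_ : _.-tuple _) _.
have zZ : z k <= Z.
  apply: ler_sum => w _; rewrite mulr1 ler_expR.
  by have := word_sup_ge hf (cylinder_prep w x0); rewrite size_tuple.
have Zz : Z <= expR D * z k.
  rewrite /z /transfer mulr_sumr; apply: ler_sum => w _.
  rewrite mulr1 -expRD ler_expR addrC.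
  by have := word_sup_le hf (cylinder_prep w x0); rewrite size_tuple.
have Zp : 0 < Z by exact: lt_le_trans zZ.
move: zZ Zz (Pz k); rewrite -[z k]lnK ?posrE// -[Z]lnK ?posrE// -!expRD !ler_expR expRK.
by rewrite ler_norml; lra.
Qed.

Lemma pressure_bound C f : holder C f -> forall n x,
  expR (- (3 * distortion C) + n%:R * pressure f) <= transfer f n (fun=> 1) x <=
  expR (3 * distortion C + n%:R * pressure f).
Proof. by move=> /pressure_dev[P H] n x; have [h ->] := H n x. Qed.

(** Collatz-Wielandt bound. Iterating the hypothesis gives L^(jn) W <= c^j W; as [W] lies between
    two positive constants it may be exchanged with 1 at a bounded cost, and j tends to infinity. *)
Lemma pressure_trial_le C f n (W : Sigma m' -> R) (c l B : R) : holder C f -> 0 < l ->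
  (forall x, l <= W x <= B) -> 0 < c ->
  (forall x, transfer f n W x <= c * W x) -> expR (n%:R * pressure f) <= c.
Proof.
move=> hf l0 HW c0 H.
have it j x : transfer f (j * n) W x <= c ^+ j * W x.
  elim: j x => [|j IH] x; first by rewrite transfer0 expr0 mul1r.
  rewrite mulSn transfer_add (le_trans (transfer_le _ _ _ H))//.
  by rewrite transferZ exprS -mulrA ler_wpM2l// ltW.
rewrite -[c]lnK ?posrE// ler_expR -subr_le0.
pose x0 : Sigma m' := fun=> ord0.
have B0 : 0 < B by case/andP: (HW x0) => h1 h2; exact: (lt_le_trans l0 (le_trans h1 h2)).
apply: (@linear_drift_le0 _ (ln B - ln l + 3 * distortion C)) => j.
have /andP[h1 _] := pressure_bound hf (j * n) x0.
have h2 : l * transfer f (j * n) (fun=> 1) x0 <= transfer f (j * n) W x0.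
  by rewrite -transferZ; apply: transfer_le => y; rewrite mulr1; have /andP[] := HW y.
have h3 : l * expR (- (3 * distortion C) + (j * n)%:R * pressure f) <= c ^+ j * B.
  apply: le_trans (_ : c ^+ j * W x0 <= _); last first.
    by rewrite ler_wpM2l ?exprn_ge0 ?(ltW c0)//; have /andP[] := HW x0.
  apply: le_trans (it j x0); apply: le_trans h2; rewrite ler_wpM2l//; exact: ltW.
move: h3; rewrite -[l]lnK ?posrE// -{1}[c]lnK ?posrE// -{1}[B]lnK ?posrE//.
rewrite -expRM_natl -!expRD ler_expR natrM !expRK => h3; lra.
Qed.

Lemma pressure_trial_ge C f n (W : Sigma m' -> R) (c l B : R) : holder C f -> 0 < l ->
  (forall x, l <= W x <= B) -> 0 < c ->
  (forall x, c * W x <= transfer f n W x) -> c <= expR (n%:R * pressure f).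
Proof.
move=> hf l0 HW c0 H.
have it j x : c ^+ j * W x <= transfer f (j * n) W x.
  elim: j x => [|j IH] x; first by rewrite transfer0 expr0 mul1r.
  rewrite mulSn transfer_add (le_trans _ (transfer_le _ _ _ H))//.
  by rewrite transferZ exprS -mulrA ler_wpM2l// ltW.
rewrite -[c]lnK ?posrE// ler_expR -subr_le0.
pose x0 : Sigma m' := fun=> ord0.
have B0 : 0 < B by case/andP: (HW x0) => h1 h2; exact: (lt_le_trans l0 (le_trans h1 h2)).
apply: (@linear_drift_le0 _ (ln B - ln l + 3 * distortion C)) => j.
have /andP[_ h1] := pressure_bound hf (j * n) x0.
have h2 : transfer f (j * n) W x0 <= B * transfer f (j * n) (fun=> 1) x0.
  by rewrite -transferZ; apply: transfer_le => y; rewrite mulr1; have /andP[] := HW y.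
have h3 : c ^+ j * l <= B * expR (3 * distortion C + (j * n)%:R * pressure f).
  apply: (@le_trans _ _ (c ^+ j * W x0)).
    by rewrite ler_wpM2l ?exprn_ge0 ?(ltW c0)//; have /andP[] := HW x0.
  apply: (le_trans (it j x0)); apply: (le_trans h2); rewrite ler_wpM2l//; exact: ltW.
move: h3; rewrite -[l]lnK ?posrE// -{1}[c]lnK ?posrE// -{1}[B]lnK ?posrE//.
rewrite -expRM_natl -!expRD ler_expR natrM !expRK => h3; lra.
Qed.

Lemma pressure_addc C f c : holder C f -> pressure (fun x => f x + c) = pressure f + c.
Proof.
move=> hf; have hfc := holder_addc c hf.
have [P HP] := pressure_dev hf; have [P' HP'] := pressure_dev hfc.
pose x0 : Sigma m' := fun=> ord0.
have eqt n : transfer (fun x => f x + c) n (fun=> 1) x0 =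
             expR (n%:R * c) * transfer f n (fun=> 1) x0.
  rewrite /transfer mulr_sumr; apply: eq_bigr => w _.
  by rewrite birkhoffD birkhoff_cst expRD !mulr1 mulrC.
have [_ ->] := HP 0%N x0; have [_ ->] := HP' 0%N x0.
apply/eqP; rewrite eq_le -subr_le0 -[X in _ && X]subr_le0; apply/andP; split;
  apply: (@linear_drift_le0 _ (6 * distortion C)) => n;
  have [/andP[h1 h2] _] := HP n x0; have [/andP[h3 h4] _] := HP' n x0;
  move: h1 h2 h3 h4; rewrite eqt -[transfer f _ _ _]lnK ?posrE ?transfer_gt0//;
  rewrite -expRD !ler_expR => h1 h2 h3 h4; lra.
Qed.

End Hoelder.

(** * Normalisation and contraction of the transfer operator *)

Section BanachLimit.
Context {R : realType}.
Implicit Types u v : nat -> R.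

(** A proper refinement of the image filter would contain some A whose preimage is not in [F]. The
    preimage of the complement is then in [F], so the refinement contains both A and its
    complement. *)
Lemma ultra_fmap (T U : Type) (f : T -> U) (F : set_system T) :
  UltraFilter F -> UltraFilter (f @ F).
Proof.
move=> FU; split; first exact: fmap_proper_filter.
move=> G GP FG; apply/seteqP; split; last exact: FG.
move=> A GA; have [//|FA] := in_ultra_setVsetC (f @^-1` A) FU.
have GAC : G (~` A) by apply: FG.
by have := @filterI _ G (@filter_filter _ _ GP) _ _ GA GAC; rewrite setICr => /(@filter_not_empty _ _ GP).
Qed.

Definition bounded_seq u := exists B, forall n, `|u n| <= B.

Lemma bounded_seqZ (c : R) u : bounded_seq u -> bounded_seq (fun n => c * u n).
Proof.
by move=> [B Bu]; exists (`|c| * B) => n; rewrite normrM ler_wpM2l.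
Qed.

Lemma bounded_seq_sum (I : Type) (r : seq I) (u : I -> nat -> R) :
  (forall i, bounded_seq (u i)) -> bounded_seq (fun n => \sum_(i <- r) u i n).
Proof.
move=> bu; elim: r => [|i r [B HB]].
  by exists 0 => n; rewrite big_nil normr0.
have [D HD] := bu i; exists (D + B) => n.
by rewrite big_cons (le_trans (ler_normD _ _))// lerD.
Qed.

(** Only finite additivity is recorded: the transfer operator is a finite sum over letters, so no
    exchange with infinite sums occurs. *)
Record banach_limit (L : (nat -> R) -> R) : Prop := {
  blimD : forall u v, bounded_seq u -> bounded_seq v ->
    L (fun n => u n + v n) = L u + L v ;
  blimZ : forall c u, bounded_seq u -> L (fun n => c * u n) = c * L u ;
  blim_le : forall u v, bounded_seq u -> bounded_seq v ->
    (forall n, u n <= v n) -> L u <= L v ;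
  blim_cst : forall c, L (fun=> c) = c ;
  blim_shift : forall u, bounded_seq u -> L (fun n => u n.+1) = L u }.

(** Limit of Cesàro means along an ultrafilter finer than [\oo]. The ultrafilter makes bounded
    sequences converge; the averaging gives shift invariance, as the means of u and of its shift
    differ by (u_(n+1) - u_0) / (n+1). *)
Lemma banach_limit_exists : exists L, banach_limit L.
Proof.
have [G [GU Goo]] := ultraFilterLemma (T := nat) eventually_filter.
have GP : ProperFilter G by exact: ultra_proper.
have ucvg u : bounded_seq u -> cvg (u @ G).
  move=> [B Bu]; have uU := ultra_fmap u GU; have := @segment_compact R (- B) B; rewrite compact_ultra.
  move=> /(_ (u @ G) uU) [|l [_ ul]]; last by apply/cvg_ex; exists l.
  apply: (@filterS _ G (@filter_filter _ _ GP) setT); last exact: filterT.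
  by move=> n _ /=; rewrite in_itv/= -ler_norml.
pose ces u n := n.+1%:R^-1 * \sum_(k < n.+1) u k.
have bces u : bounded_seq u -> bounded_seq (ces u).
  move=> [B Bu]; exists B => n; rewrite /ces normrM ger0_norm ?invr_ge0// ler_pdivrMl//.
  rewrite (le_trans (ler_norm_sum _ _ _))// (le_trans (ler_sum _ (fun (i : 'I_n.+1) _ => Bu i)))//.
  by rewrite sumr_const card_ord mulr_natl.
exists (fun u => lim (ces u @ G)); split.
- move=> u v /bces/ucvg cu /bces/ucvg cv.
  apply: cvg_lim => //; have -> : ces (fun n => u n + v n) = ces u \+ ces v.
    by apply/funext => n; rewrite /ces big_split mulrDr.
  exact: cvgD.
- move=> c u /bces/ucvg cu; apply: cvg_lim => //.
  have -> : ces (fun n => c * u n) = fun n => c * ces u n.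
    by apply/funext => n; rewrite /ces -mulr_sumr mulrCA.
  exact: cvgMl_tmp.
- move=> u v /bces/ucvg cu /bces/ucvg cv uv; apply: ler_lim => //.
  by apply: nearW => n; rewrite /ces ler_wpM2l// ler_sum.
- move=> c; have -> : ces (fun=> c) = fun=> c.
    by apply/funext => n; rewrite /ces sumr_const card_ord -[c *+ _]mulr_natl mulKf.
  exact: lim_cst.
- move=> u bu; have /ucvg cu := bces _ bu; apply: cvg_lim => //.
  have -> : ces (fun n => u n.+1) =
     fun n => ces u n + n.+1%:R^-1 * (u n.+1 - u 0%N).
    apply/funext => n; rewrite /ces -mulrDr; congr (_ * _).
    have e : u 0%N + \sum_(k < n.+1) u k.+1 = \sum_(k < n.+1) u k + u n.+1.
      transitivity (\sum_(k < n.+2) u k); last by rewrite big_ord_recr.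
      by rewrite [RHS]big_ord_recl; congr (_ + _); apply: eq_bigr => i _; rewrite lift0.
    by rewrite addrA -e addrAC subrr add0r.
  rewrite -[X in _ --> X]addr0; apply: cvgD => //.
  have [B Bu] := bu.
  apply: (@cvg_trans _ ((fun n : nat => n.+1%:R^-1 * (u n.+1 - u 0%N)) @ \oo)).
    by move=> A /= /Goo.
  apply/cvgrPdist_le => e e0; near=> n.
  rewrite sub0r normrN normrM ger0_norm ?invr_ge0// ler_pdivrMl//.
  apply: (@le_trans _ _ (B + B)).
    by rewrite (le_trans (ler_normB _ _))// lerD.
  rewrite mulrC -ler_pdivrMl//; apply: (@le_trans _ _ n%:R); last by rewrite ler_nat.
  by near: n; exact: nbhs_infty_ger.
Unshelve. all: by end_near. Qed.

Lemma blim_sum L (I : Type) (r : seq I) (u : I -> nat -> R) : banach_limit L ->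
  (forall i, bounded_seq (u i)) ->
  L (fun n => \sum_(i <- r) u i n) = \sum_(i <- r) L (u i).
Proof.
move=> HL bu; elim: r => [|i r IH].
  rewrite big_nil -[RHS](blim_cst HL); congr L; apply/funext => n.
  by rewrite big_nil.
rewrite big_cons -IH -(blimD HL)//; last exact: bounded_seq_sum.
by congr L; apply/funext => n; rewrite big_cons.
Qed.

End BanachLimit.

Section Normalisation.
Context {R : realType} {m' : nat} (th : R).
Hypotheses (th_gt0 : 0 < th) (th_lt1 : th < 1).
Implicit Types (f g G : Sigma m' -> R) (x y : Sigma m') (w : seq (letter m')).

Definition normalised f := forall x, transfer f 1 (fun=> 1) x = 1.

Lemma log_bound_abs (a b t : R) : 0 < a -> 0 < b ->
  a <= expR t * b -> b <= expR t * a -> `|ln a - ln b| <= t.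
Proof.
move=> a0 b0; rewrite -{1 2}[a]lnK ?posrE// -{1 2}[b]lnK ?posrE//.
rewrite -!expRD !ler_expR ler_norml => h1 h2; lra.
Qed.

(** The eigenfunction h is the Banach limit of exp(- n P) L^n 1. The distortion bound is uniform in
    n and passes to h, so u = ln h is Hölder; adding the coboundary of u turns the eigenvalue
    equation into the statement that the weights over the preimages of a point sum to 1. *)
Lemma normalisation C f : holder th C f -> exists u C',
  [/\ holder th C' u, holder th C' (fun x => f x - pressure f + u x - u (left_shift x))
    & normalised (fun x => f x - pressure f + u x - u (left_shift x))].
Proof.
move=> hf; have [L HL] := @banach_limit_exists R.
set P := pressure f; set D := distortion th C.
have D0 : 0 <= D by rewrite distortion_ge0// (holder_ge0 hf).
pose v x n := expR (- (n%:R * P)) * transfer f n (fun=> 1) x.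
have vb x n : expR (- (3 * D)) <= v x n <= expR (3 * D).
  have /andP[h1 h2] := pressure_bound th_gt0 th_lt1 hf n x.
  have E t : expR (t + n%:R * P) * expR (- (n%:R * P)) = expR t.
    by rewrite -expRD addrK.
  by rewrite /v [_ * transfer _ _ _ _]mulrC -(E (- (3 * D))) -(E (3 * D)) !ler_pM2r ?expR_gt0// h1.
have bv x : bounded_seq (v x).
  exists (expR (3 * D)) => n; have /andP[h1 h2] := vb x n.
  by rewrite ger0_norm// (le_trans (expR_ge0 _) h1).
have bcst c : bounded_seq (fun=> c : R) by exists `|c|.
pose h x := L (v x).
have hb x : expR (- (3 * D)) <= h x <= expR (3 * D).
  rewrite -[expR (- (3 * D))](blim_cst HL) -[expR (3 * D)](blim_cst HL).
  apply/andP; split.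
    by apply: (blim_le HL (bcst _) (bv x)) => n; have /andP[h1 h2] := vb x n; exact: h1.
  by apply: (blim_le HL (bv x) (bcst _)) => n; have /andP[h1 h2] := vb x n; exact: h2.
have h0 x : 0 < h x by have /andP[h1 _] := hb x; exact: (lt_le_trans (expR_gt0 _) h1).
have hdist k x y : agree k x y -> h x <= expR (D * th ^+ k) * h y.
  move=> a; rewrite -(blimZ HL)//; apply: (blim_le HL) => //.
    exact: bounded_seqZ.
  move=> n; rewrite /v mulrCA ler_wpM2l ?expR_ge0//.
  exact: (transfer_distort th_gt0 th_lt1).
pose u x := ln (h x).
have hu : holder th D u.
  by move=> k x y a; apply: log_bound_abs => //; apply: hdist => //; exact: agreeC.
(* Shift invariance of the Banach limit replaces index n by n + 1, which is one more application of
   the operator. *)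
have eigen x : \sum_i expR (f (pre i x)) * h (pre i x) = expR P * h x.
  rewrite [h x]/h -(blim_shift HL (bv x)) -(blimZ HL); last first.
    by have [B HB] := bv x; exists B => n; exact: HB.
  under eq_bigr do rewrite /h -(blimZ HL)//.
  rewrite -(blim_sum _ HL); last by move=> i; exact: bounded_seqZ.
  congr L; apply/funext => n; rewrite /v -[n.+1]addn1 transfer_add transfer1E.
  rewrite mulrA -expRD mulr_sumr; apply: eq_bigr => i _.
  by rewrite mulrCA natrD; congr (expR _ * _); ring.
exists u, (C + D + D / th); split.
- apply: (holderW th_gt0 _ hu); rewrite addrAC lerDr addr_ge0 ?(holder_ge0 hf)//.
  by rewrite divr_ge0// ltW.
- move=> k x y a; have := holder_shift th_gt0 th_lt1 hu a; have := hu _ _ _ a.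
  have := hf _ _ _ a; rewrite !ler_norml !mulrDl => a1 a2 a3; lra.
- move=> x; rewrite transfer1E.
  have hE i : expR (f (pre i x) - P + u (pre i x) - u x) * 1 =
      (expR P * h x)^-1 * (expR (f (pre i x)) * h (pre i x)).
    rewrite mulr1 expRB expRD expRB !lnK ?posrE//; field.
    by rewrite !gt_eqF ?expR_gt0.
  under eq_bigr do rewrite hE.
  by rewrite -mulr_sumr eigen mulVf// gt_eqF// mulr_gt0 ?expR_gt0.
Qed.

End Normalisation.

Section GeometricSmallness.
Context {R : realType}.

Lemma geometric_small (r c e : R) : 0 <= r -> r < 1 -> 0 < e -> exists n, c * r ^+ n <= e.
Proof.
move=> r0 r1 e0; have r1' : `|r| < 1 by rewrite ger0_norm.
have : c * r ^+ n @[n --> \oo] --> c * 0 by apply: cvgMl_tmp; exact: cvg_expr.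
rewrite mulr0 => /cvgrPdist_le /(_ _ e0) [n _ /(_ n (leqnn n)) /=].
by rewrite sub0r normrN ler_norml => /andP[_ h]; exists n.
Qed.

(** Replaces passing to the limit in inequalities with an exponentially small error. *)
Lemma le0_geometric (t c r : R) : 0 <= r -> r < 1 -> (forall n, t <= c * r ^+ n) -> t <= 0.
Proof.
move=> r0 r1 H; rewrite leNgt; apply/negP => t0.
have [|n hn] := @geometric_small r c (t / 2) r0 r1; first by rewrite divr_gt0.
by have := H n; lra.
Qed.

End GeometricSmallness.

Section Contraction.
Context {R : realType} {m' : nat} (th : R).
Hypotheses (th_gt0 : 0 < th) (th_lt1 : th < 1).
Implicit Types (f g F G : Sigma m' -> R) (x y : Sigma m') (w : seq (letter m')).

Lemma transfer_cst F n c x : normalised F -> transfer F n (fun=> c) x = c.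
Proof.
move=> nF; elim: n x => [|n IH] x; first by rewrite transfer0.
rewrite -add1n transfer_add -[RHS](IH x); congr transfer; apply/funext => y.
by rewrite -[c in LHS]mulr1 transferZ nF mulr1.
Qed.

Lemma transfer_avg_le F n G x b : normalised F -> (forall y, G y <= b) ->
  transfer F n G x <= b.
Proof. by move=> nF H; rewrite -[leRHS](transfer_cst n b x nF) transfer_le. Qed.

Lemma transfer_avg_ge F n G x b : normalised F -> (forall y, b <= G y) ->
  b <= transfer F n G x.
Proof. by move=> nF H; rewrite -[leLHS](transfer_cst n b x nF) transfer_le. Qed.

Lemma transfer_osc F n G A x y : normalised F -> (forall y z, G y - G z <= A) ->
  transfer F n G x - transfer F n G y <= A.
Proof.
move=> nF H; rewrite lerBlDr; apply: transfer_avg_le => // z.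
rewrite -lerBlDl; apply: transfer_avg_ge => // t; rewrite lerBlDl -lerBlDr; exact: H.
Qed.

(* Lipschitz with constant A for the metric min(1, b th^k); for b large the
   iterates of the transfer operator contract this seminorm. *)
Definition lip A b G :=
  (forall x y, G x - G y <= A) /\
  (forall k x y, agree k x y -> G x - G y <= A * (b * th ^+ k)).

(** Coupling of the distributions of [prep w x] and [prep w y]. By distortion the weight of [w] at
    [x] is at least [ka] times its weight at [y]. On this common part the two points share n + k
    letters, giving the first term; on the remaining mass 1 - ka only the oscillation [A] is
    available. *)
Lemma transfer_coupling C F A b G n k x y (ka := expR (- (distortion th C * th ^+ k))) :
  holder th C F -> normalised F ->
  lip A b G -> agree k x y ->
  transfer F n G x - transfer F n G y <=
    ka * (A * (b * th ^+ (n + k))) + (1 - ka) * A.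
Proof.
move=> hF nF [GA Gb] a; set c := transfer F n G y; set E := A * _.
suff : transfer F n G x <= transfer F n (fun=> c + A) x +
    ka * transfer F n (fun z => G z + (E - c - A)) y.
  by rewrite (transferD F n G) !transfer_cst// -/c => h; lra.
rewrite -transferZ /transfer -big_split; apply: ler_sum => w _.
set px := expR _; set py := expR (birkhoff F n (prep w y)).
have pp : ka * py <= px.
  rewrite /ka /py /px -expRD ler_expR.
  have := holder_birkhoff th_gt0 th_lt1 w hF a; rewrite size_tuple ler_norml; lra.
have py0 : 0 <= ka * py by rewrite mulr_ge0 ?expR_ge0.
have h1 : G (prep w x) - c <= A.
  rewrite lerBlDr -lerBlDl; apply: transfer_avg_ge => // z.
  by rewrite lerBlDl -lerBlDr.
have h2 : G (prep w x) - G (prep w y) <= E.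
  by apply: Gb; have := @agree_prep _ k w _ _ a; rewrite size_tuple.
have := ler_wpM2l py0 h2; have pp' : 0 <= px - ka * py by rewrite subr_ge0.
by have := ler_wpM2l pp' h1; rewrite /=; lra.
Qed.

Lemma transfer_contract C F : holder th C F -> normalised F ->
  exists N b r, [/\ 1 <= b, (0 < N)%N, 0 < r < 1 &
    forall A G, 0 <= A -> lip A b G -> lip (r * A) b (transfer F N G)].
Proof.
move=> hF nF; set D := distortion th C.
have D0 : 0 <= D by rewrite distortion_ge0// (holder_ge0 hF).
(* With b >= 4 D the loss (1 - ka) A <= D th^k A is at most a quarter of A b th^k. The choice of N
   makes the coupled part at most A th^k / 4, so the second bound contracts by 1/2 <= r, and the
   first by 1 - 3/4 exp(- D) <= r. *)
pose b := 4 * D + 1.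
have b1 : 1 <= b by rewrite lerDr mulr_ge0.
have [|N hN] := @geometric_small R th b (1 / 4) (ltW th_gt0) th_lt1.
  by rewrite divr_gt0.
have N0 : (0 < N)%N.
  by rewrite lt0n; apply/eqP => N0; move: hN; rewrite N0 expr0 mulr1; lra.
pose r := 1 - expR (- D) / 2.
have eD1 : expR (- D) <= 1 by rewrite -[leRHS]expR0 ler_expR oppr_le0.
have eD0 : 0 < expR (- D) by exact: expR_gt0.
exists N, b, r; split => //; first by rewrite /r; lra.
move=> A G A0 lG.
have key k x y : agree k x y ->
    transfer F N G x - transfer F N G y <= r * A /\
    transfer F N G x - transfer F N G y <= r * A * (b * th ^+ k).
  move=> a; have := transfer_coupling N hF nF lG a.
  set ka := expR _ => /= h.
  have tk0 : 0 < th ^+ k by exact: exprn_gt0.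
  have tk1 : th ^+ k <= 1 by rewrite exprn_ile1// ltW.
  have Dk : D * th ^+ k <= D by rewrite ler_piMr.
  have ka1 : expR (- D) <= ka by rewrite ler_expR lerN2.
  have ka2 : ka <= 1.
    by rewrite -[leRHS]expR0 ler_expR oppr_le0 mulr_ge0// ltW.
  have ka3 : 1 - D * th ^+ k <= ka by exact: expR_ge1Dx.
  have ka0 : 0 <= ka by exact: expR_ge0.
  have e1 : A * (b * th ^+ (N + k)) <= A * (1 / 4 * th ^+ k).
    by rewrite ler_wpM2l// exprD mulrA ler_wpM2r// ltW.
  have h' : transfer F N G x - transfer F N G y <=
      ka * (A * (1 / 4 * th ^+ k)) + (1 - ka) * A.
    by apply: (le_trans h); rewrite lerD2r ler_wpM2l.
  have q1 : A * (1 / 4 * th ^+ k) <= A * (1 / 4).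
    by rewrite ler_wpM2l// ler_piMr.
  split.
    apply: (le_trans h'); have := ler_wpM2l ka0 q1.
    have := ler_wpM2r A0 ka1; have := ler_wpM2r A0 eD1.
    have : 0 <= ka * A by exact: mulr_ge0.
    rewrite /r; lra.
  apply: (le_trans h').
  have q2 : 0 <= A * th ^+ k by rewrite mulr_ge0// ltW.
  have q3 : ka * (A * th ^+ k) <= A * th ^+ k by rewrite ler_piMl.
  have q4 : (1 - ka) * A <= D * th ^+ k * A by rewrite ler_wpM2r//; lra.
  have q5 : 1 / 2 * (A * th ^+ k * b) <= r * (A * th ^+ k * b).
    by rewrite ler_wpM2r ?mulr_ge0//; rewrite /r; lra.
  have q6 : 0 <= A * th ^+ k * D by rewrite mulr_ge0.
  move: q5; rewrite {1}/b => q5.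
  have -> : r * A * (b * th ^+ k) = r * (A * th ^+ k * b) by ring.
  apply: le_trans q5; lra.
split=> [x y|k x y a]; first by have [] := key 0%N x y (fun j => ltac:(by [])).
by have [] := key k x y a.
Qed.

Lemma transfer_decay C F : holder th C F -> normalised F ->
  exists K r, [/\ 0 <= K, 0 < r < 1 & forall A G, holder th A G -> forall n x y,
    `|transfer F n G x - transfer F n G y| <= A * (K * r ^+ n)].
Proof.
move=> hF nF; have [N [b [r [b1 N0 /andP[r0 r1] H]]]] := transfer_contract hF nF.
pose s := r `^ (N%:R^-1).
have sN : s ^+ N = r.
  rewrite /s -powR_mulrn ?powR_ge0// -powRrM mulVf ?powRr1 ?ltW//.
  by rewrite pnatr_eq0 -lt0n.
have s0 : 0 < s by exact: powR_gt0.
have s1 : s < 1.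
  rewrite ltNge; apply/negP => s1; have : 1 <= s ^+ N by exact: exprn_ege1.
  by rewrite sN leNgt r1.
(* [s] is the N-th root of [r]; the factor r^-1 pays for the incomplete last block of length below
   N. *)
exists r^-1, s; split; rewrite ?invr_ge0 ?(ltW r0)// ?s0// => A G hG n x y.
have A0 := holder_ge0 hG.
have lG : lip A b G.
  split=> [z t|k z t a].
    by have := holder_osc z t hG; rewrite ler_norml => /andP[].
  have := hG k z t a; rewrite ler_norml => /andP[_ /le_trans]; apply.
  by rewrite ler_wpM2l// ler_peMl// exprn_ge0// ltW.
have lj j : lip (r ^+ j * A) b (transfer F (j * N) G).
  elim: j => [|j IH].
    rewrite expr0 mul1r mul0n; have -> : transfer F 0 G = G => //.
    by apply/funext => z; rewrite transfer0.
  rewrite mulSn addnC exprS -mulrA.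
  have -> : transfer F (j * N + N) G = transfer F N (transfer F (j * N) G).
    by apply/funext => z; rewrite transfer_add.
  by apply: H => //; rewrite mulr_ge0// exprn_ge0// ltW.
have osc z t : transfer F n G z - transfer F n G t <= A * (r^-1 * s ^+ n).
  apply: (@le_trans _ _ (r ^+ (n %/ N) * A)).
    rewrite (divn_eq n N) !transfer_add -divn_eq; apply: transfer_osc => //.
    by have [] := lj (n %/ N)%N.
  rewrite mulrC ler_wpM2l// ler_pdivlMl// -exprS -sN -exprM.
  apply: ler_wiXn2l; rewrite ?(ltW s0) ?(ltW s1)//.
  rewrite mulnC mulSn addnC {1}(divn_eq n N) leq_add2l ltnW// ltn_mod//.
by rewrite ler_norml osc andbT lerNl opprB.
Qed.

(** All iterates after the n-th are averages of the n-th, hence within its oscillation of each of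
    its values. Shift invariance lets the Banach limit start at index n, which transfers this bound
    to the mean. *)
Lemma mean_exists C F : holder th C F -> normalised F ->
  exists (a : (Sigma m' -> R) -> R) K r,
  [/\ 0 <= K, 0 < r < 1 & forall A G, holder th A G -> forall n x,
    `|transfer F n G x - a G| <= A * (K * r ^+ n)].
Proof.
move=> hF nF; have [K [r [K0 r01 H]]] := transfer_decay hF nF.
have [L HL] := @banach_limit_exists R; pose x0 : Sigma m' := fun=> ord0.
exists (fun G => L (fun n => transfer F n G x0)), K, r; split => // A G hG n x.
set e := A * _.
have bc c : bounded_seq (fun=> c : R) by exists `|c|.
have bu : bounded_seq (fun k => transfer F k G x0).
  have [B HB] := holder_bounded hG; exists B => k.
  rewrite ler_norml transfer_avg_le ?transfer_avg_ge// => y;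
  by have := HB y; rewrite ler_norml => /andP[].
have sh k : bounded_seq (fun j => transfer F (k + j) G x0) /\
    L (fun j => transfer F (k + j) G x0) = L (fun j => transfer F j G x0).
  elim: k => [|k [b1 IH]]; first by [].
  have [B HB] := b1; split.
    by exists B => j; rewrite addSnnS.
  rewrite -IH -(blim_shift HL b1); congr L; apply/funext => j.
  by rewrite addSnnS.
have [b1 <-] := sh n.
have bd j : transfer F n G x - e <= transfer F (n + j) G x0 <= transfer F n G x + e.
  rewrite transfer_add transfer_avg_le ?transfer_avg_ge// => y;
  by have := H A G hG n x y; rewrite -/e ler_norml => /andP[h1 h2]; lra.
set l := L _.
have l1 : l <= transfer F n G x + e.
  rewrite -[leRHS](blim_cst HL).
  by apply: (blim_le HL b1 (bc _)) => j; have /andP[h1 h2] := bd j; exact: h2.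
have l2 : transfer F n G x - e <= l.
  rewrite -[leLHS](blim_cst HL).
  by apply: (blim_le HL (bc _) b1) => j; have /andP[h1 h2] := bd j; exact: h1.
by rewrite ler_norml; lra.
Qed.

End Contraction.

(** * First-order expansion of the pressure *)

Section Perturbation.
Context {R : realType} {m' : nat} (th : R).
Hypotheses (th_gt0 : 0 < th) (th_lt1 : th < 1).
Implicit Types (f g F G : Sigma m' -> R) (x y : Sigma m') (w : seq (letter m')).

Lemma holder_scale c A G : holder th A G -> holder th (`|c| * A) (fun x => c * G x).
Proof.
by move=> hG k x y a; rewrite -mulrBr normrM -mulrA ler_wpM2l//; exact: hG.
Qed.

Lemma holder_add A B G G' : holder th A G -> holder th B G' ->
  holder th (A + B) (fun x => G x + G' x).
Proof.
move=> hG hG' k x y a; rewrite opprD addrACA (le_trans (ler_normD _ _))// mulrDl.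
by apply: lerD; [exact: hG|exact: hG'].
Qed.

Definition is_mean F (a : (Sigma m' -> R) -> R) K r :=
  forall A G, holder th A G -> forall n x, `|transfer F n G x - a G| <= A * (K * r ^+ n).

Section MeanTheory.
Variables (F : Sigma m' -> R) (a : (Sigma m' -> R) -> R) (K r : R).
Hypotheses (nF : normalised F) (r01 : 0 < r < 1) (aP : is_mean F a K r).

Let r_ge0 : 0 <= r. Proof. by case/andP: r01 => /ltW. Qed.
Let r_lt1 : r < 1. Proof. by case/andP: r01. Qed.
Let x0 : Sigma m' := fun=> ord0.

(** The algebra of [a] rests on this: no linearity is assumed, and each identity is obtained by
    exhibiting a second exponential limit of the same iterates. *)
Lemma mean_unique A G l c : holder th A G ->
  (forall n, `|transfer F n G x0 - l| <= c * r ^+ n) -> a G = l.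
Proof.
move=> hG H; apply/eqP; rewrite -subr_eq0 -normr_le0.
apply: (@le0_geometric _ _ (A * K + c) r) => // n.
have := H n; have := aP hG n x0; rewrite mulrA mulrDl !ler_norml; lra.
Qed.

Lemma mean_cst c : a (fun=> c) = c.
Proof.
apply: (@mean_unique 0 _ _ 0 (holder_cst th c)) => n.
by rewrite transfer_cst// subrr normr0 mul0r.
Qed.

Lemma mean_lin A B c d G G' : holder th A G -> holder th B G' ->
  a (fun x => c * G x + d * G' x) = c * a G + d * a G'.
Proof.
move=> hG hG'; apply: (@mean_unique _ _ _ (`|c| * (A * K) + `|d| * (B * K))
  (holder_lin c d hG hG')) => n.
rewrite transferD !transferZ opprD addrACA -!mulrBr mulrDl -!mulrA.
rewrite (le_trans (ler_normD _ _))// !normrM lerD// ler_wpM2l//; exact: aP.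
Qed.

Lemma mean_ge A G b n : holder th A G -> (forall x, b <= transfer F n G x) -> b <= a G.
Proof.
move=> hG H; rewrite -subr_le0.
apply: (@le0_geometric _ _ (A * K * r ^+ n) r) => // j.
rewrite -!mulrA -exprD; have := aP hG (n + j) x0.
have : b <= transfer F (n + j) G x0 by rewrite transfer_add; exact: transfer_avg_ge.
rewrite ler_norml; lra.
Qed.

Lemma mean_le A G b n : holder th A G -> (forall x, transfer F n G x <= b) -> a G <= b.
Proof.
move=> hG H; rewrite -subr_le0.
apply: (@le0_geometric _ _ (A * K * r ^+ n) r) => // j.
rewrite -!mulrA -exprD; have := aP hG (n + j) x0.
have : transfer F (n + j) G x0 <= b by rewrite transfer_add; exact: transfer_avg_le.
rewrite ler_norml; lra.
Qed.

Lemma transfer_shift G x : transfer F 1 (fun y => G (left_shift y)) x = G x.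
Proof.
rewrite transfer1E -[RHS]mul1r -[1 in RHS](nF x) transfer1E mulr_suml.
by apply: eq_bigr => i _; rewrite mulr1.
Qed.

(** One application of the normalised operator undoes the shift, so the two sequences of iterates
    agree up to an index. *)
Lemma mean_shift A G : holder th A G -> a (fun y => G (left_shift y)) = a G.
Proof.
move=> hG; have hGs := holder_shift th_gt0 th_lt1 hG.
apply/eqP; rewrite -subr_eq0 -normr_le0.
apply: (@le0_geometric _ _ ((A / th) * K * r + A * K) r) => // n.
have := aP hGs n.+1 x0; have := aP hG n x0; rewrite -add1n transfer_add.
have -> : transfer F 1 (fun y => G (left_shift y)) = G.
  by apply/funext => y; exact: transfer_shift.
by rewrite exprD expr1 mulrDl -!mulrA !ler_norml; lra.
Qed.

Lemma mean_osc A G x : holder th A G -> `|G x - a G| <= A.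
Proof.
move=> hG; rewrite ler_norml.
have h1 : a G <= G x + A.
  apply: (@mean_le A _ _ 0) => // y; rewrite transfer0.
  by have := holder_osc y x hG; rewrite ler_norml; lra.
have h2 : G x - A <= a G.
  apply: (@mean_ge A _ _ 0) => // y; rewrite transfer0.
  by have := holder_osc y x hG; rewrite ler_norml; lra.
lra.
Qed.

Section Corrector.
Variables (A : R) (G : Sigma m' -> R).
Hypotheses (K_ge0 : 0 <= K) (hG : holder th A G).

(* Solves the Poisson equation Q(G + k) = k + const up to an error of order r^N. *)
Definition corrector N x := \sum_(j < N) transfer F j.+1 G x.

(** The exponent that G contributes to the word [w] once the operator of F + G is conjugated by
    exp(corrector). *)
Definition tilt N n w x :=
  birkhoff G n (prep w x) + corrector N (prep w x) - corrector N x.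

Let A0 : 0 <= A. Proof. exact: holder_ge0 hG. Qed.

Lemma corrector_eq N x :
  transfer F 1 (fun y => G y + corrector N y) x = corrector N x + transfer F N.+1 G x.
Proof.
have -> : (fun y => G y + corrector N y) = (fun y => \sum_(j < N.+1) transfer F j G y).
  by apply/funext => y; rewrite big_ord_recl transfer0.
have -> : corrector N x + transfer F N.+1 G x = \sum_(j < N.+1) transfer F j.+1 G x.
  by rewrite big_ord_recr.
elim: N.+1 => [|n IH].
  rewrite big_ord0 /transfer big1// => w _; rewrite big_ord0 mulr0//.
under [X in transfer F 1 X x]eq_fun do rewrite big_ord_recr /=.
by rewrite transferD IH big_ord_recr /= -[n.+1]addn1 transfer_add.
Qed.

Lemma corrector_mean N n x :
  transfer F n (fun y => birkhoff G n y + corrector N y) x =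
  corrector N x + \sum_(j < n) transfer F (N.+1 + j) G x.
Proof.
elim: n x => [|n IH] x.
  by rewrite transfer0 birkhoff0 add0r big_ord0 addr0.
rewrite -add1n transfer_add.
have -> : transfer F 1 (fun y => birkhoff G (1 + n) y + corrector N y) =
   fun y => (birkhoff G n y + corrector N y) + transfer F N.+1 G y.
  apply/funext => y.
  have -> : (fun y => birkhoff G (1 + n) y + corrector N y) =
    fun y => birkhoff G n (left_shift y) + (G y + corrector N y).
    by apply/funext => z; rewrite add1n birkhoffS; ring.
  by rewrite transferD transfer_shift corrector_eq addrA.
by rewrite transferD IH -transfer_add add1n big_ord_recr/= addrA.
Qed.

Lemma tilt_mean N n x :
  `|transfer F n (fun y => birkhoff G n y + corrector N y) x - corrector N x - n%:R * a G|
  <= n%:R * (A * K * r ^+ N).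
Proof.
rewrite corrector_mean [X in `|X - _|]addrC addKr mulr_natl.
rewrite -[n in a G *+ n]card_ord -sumr_const -sumrB (le_trans (ler_norm_sum _ _ _))//.
rewrite mulr_natl -[n in leRHS]card_ord -sumr_const ler_sum// => j _.
apply: (le_trans (aP hG _ _)); rewrite mulrA ler_wpM2l ?mulr_ge0//.
by apply: ler_wiXn2l; rewrite ?(ltW r_lt1)// addSn leqW// leq_addr.
Qed.

(** A geometric series, hence uniform in [N]; this is what allows N to tend to infinity while the
    size of the tilt stays controlled. *)
Lemma corrector_osc N x y : `|corrector N x - corrector N y| <= 2 * A * K / (1 - r).
Proof.
rewrite /corrector -sumrB (le_trans (ler_norm_sum _ _ _))//.
apply: (@le_trans _ _ (\sum_(j < N) (2 * A * K) * r ^+ j)).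
  apply: ler_sum => j _; have := aP hG j.+1 x; have := aP hG j.+1 y.
  have : A * (K * r ^+ j.+1) <= A * K * r ^+ j.
    by rewrite -mulrA !ler_wpM2l// ler_wiXn2l// ltW.
  rewrite !ler_norml; lra.
rewrite -mulr_sumr ler_wpM2l ?mulr_ge0//.
have r1 : 0 < 1 - r by rewrite subr_gt0.
rewrite -[leRHS]mul1r ler_pdivlMr//.
by have := subrX1 r N; have := exprn_ge0 N r_ge0; lra.
Qed.

Lemma tilt_bound N n w x : size w = n ->
  `|tilt N n w x - n%:R * a G| <= n%:R * A + 2 * A * K / (1 - r).
Proof.
move=> sw; rewrite /tilt.
have := corrector_osc N (prep w x) x.
suff : `|birkhoff G n (prep w x) - n%:R * a G| <= n%:R * A.
  rewrite !ler_norml; lra.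
rewrite mulr_natl -[n in a G *+ n]card_ord -sumr_const -sumrB.
rewrite (le_trans (ler_norm_sum _ _ _))//.
rewrite mulr_natl -[n in leRHS]card_ord -sumr_const ler_sum// => j _.
exact: mean_osc.
Qed.

End Corrector.
End MeanTheory.
End Perturbation.

Section PressurePerturbation.
Context {R : realType} {m' : nat} (th : R).
Hypotheses (th_gt0 : 0 < th) (th_lt1 : th < 1).
Implicit Types (f g F G : Sigma m' -> R) (x y : Sigma m') (w : seq (letter m')).

Lemma expR_le_quadratic (y : R) : `|y| <= 1 / 2 -> expR y <= 1 + y + 2 * y ^+ 2.
Proof.
rewrite ler_norml => /andP[y1 y2].
have h : 1 - y <= expR (- y) by exact: expR_ge1Dx.
have yp : 0 < 1 - y by lra.
have -> : expR y = (expR (- y))^-1 by rewrite expRN invrK.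
apply: (@le_trans _ _ (1 - y)^-1).
  by rewrite lef_pV2 ?posrE ?expR_gt0.
rewrite -[leLHS]mul1r ler_pdivrMr//.
have : 0 <= y ^+ 2 * (1 - 2 * y) by rewrite mulr_ge0 ?sqr_ge0//; lra.
by lra.
Qed.

(** Quantitative strict convexity: exp(y) >= (1 + y/2)^2 and y^2 / 4 >= 1/4, while far to the left
    the left-hand side is already nonpositive. *)
Lemma expR_ge_gap (y : R) : 1 <= `|y| -> 1 + y + 1 / 4 <= expR y.
Proof.
move=> y1; have [y2|y2] := leP y (- 5 / 4).
  by apply: le_trans (expR_ge0 _); lra.
have h : 1 + y / 2 <= expR (y / 2) by exact: expR_ge1Dx.
have -> : expR y = expR (y / 2) ^+ 2 by rewrite -expRM_natl; congr expR; lra.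
have : (1 + y / 2) ^+ 2 <= expR (y / 2) ^+ 2.
  by rewrite lerXn2r ?nnegrE ?expR_ge0//; lra.
have : 1 <= y ^+ 2 by rewrite -[y ^+ 2]ger0_norm ?sqr_ge0// normrX exprn_ege1.
by lra.
Qed.

Section Cohomologous.
Variables (C D : R) (f u : Sigma m' -> R) (a : (Sigma m' -> R) -> R) (K r : R).
Let P := pressure f.
Let F x := f x - P + u x - u (left_shift x).
Hypotheses (hf : holder th C f) (hu : holder th D u).
Hypotheses (nF : normalised F) (K_ge0 : 0 <= K) (r01 : 0 < r < 1).
Hypothesis aP : is_mean th F a K r.

Lemma birkhoff_coboundary n x :
  birkhoff F n x = birkhoff f n x - n%:R * P + u x - u (iter n left_shift x).
Proof.
elim: n x => [|n IH] x; first by rewrite !birkhoff0 mul0r subr0 add0r subrr.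
by rewrite !birkhoffS IH iterSr -[n.+1]addn1 natrD /F; ring.
Qed.

Section Direction.
Variables (A : R) (G : Sigma m' -> R).
Hypothesis hG : holder th A G.

Let W N x := expR (u x + corrector F G N x).

Lemma trial_function_bounds N : exists l B, 0 < l /\ forall x, l <= W N x <= B.
Proof.
have [B HB] := holder_bounded hu.
pose x0 : Sigma m' := fun=> ord0.
pose B' := B + `|corrector F G N x0| + 2 * A * K / (1 - r).
exists (expR (- B')), (expR B'); split; first exact: expR_gt0.
move=> x; rewrite !ler_expR -ler_norml (le_trans (ler_normD _ _))//.
rewrite /B' -addrA lerD// -[corrector F G N x](subrK (corrector F G N x0)).
rewrite (le_trans (ler_normD _ _))// addrC lerD//.
exact: (corrector_osc r01 aP K_ge0 hG).
Qed.

(** Conjugation: relative to the trial function, the operator of f + G is exp(n P) times the average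
    of exp(tilt) for the Markov weights of F. *)
Lemma transfer_tilt N n x :
  transfer (fun z => f z + G z) n (W N) x = expR (n%:R * P) * W N x *
    \sum_(w : n.-tuple (letter m'))
      expR (birkhoff F n (prep w x)) * expR (tilt F G N n w x).
Proof.
rewrite /transfer mulr_sumr; apply: eq_bigr => w _.
rewrite -!expRD birkhoffD birkhoff_coboundary; congr expR; rewrite /tilt.
have -> : iter n left_shift (prep w x) = x.
  by have := shift_prep w x; rewrite size_tuple.
ring.
Qed.

Let X N n w x := tilt F G N n w x - n%:R * a G.

Lemma tilt_mean_dev N n x :
  `|\sum_(w : n.-tuple (letter m')) expR (birkhoff F n (prep w x)) * X N n w x| <=
  n%:R * (A * K * r ^+ N).
Proof.
apply: le_trans (tilt_mean nF r01 aP K_ge0 hG N n x).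
rewrite le_eqVlt; apply/orP; left; apply/eqP; congr `| _ |.
set c := corrector F G N x + n%:R * a G.
have := transferD F n (fun y => birkhoff G n y + corrector F G N y) (fun=> - c) x.
rewrite (transfer_cst _ _ _ nF) => e.
have -> : transfer F n (fun y => birkhoff G n y + corrector F G N y) x -
   corrector F G N x - n%:R * a G =
   transfer F n (fun y => birkhoff G n y + corrector F G N y) x - c.
  by rewrite /c opprD addrA.
rewrite -e; apply: eq_bigr => w _; congr (_ * _).
by rewrite /X /tilt /c; ring.
Qed.

(** Write e^X = 1 + X + (e^X - 1 - X) for the centred tilt X. The weights sum to 1 and the mean of X
    is O(r^N), so the mean of e^X is at least 1 + eta up to a vanishing error. Taking eta = 0 gives
    the supporting inequality, eta > 0 its strict form. *)
Lemma pressure_tilt_ge n eta : 0 <= eta ->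
  (forall N x, eta <= \sum_(w : n.-tuple (letter m'))
     expR (birkhoff F n (prep w x)) * (expR (X N n w x) - 1 - X N n w x)) ->
  (1 + eta) * expR (n%:R * (P + a G)) <= expR (n%:R * pressure (fun x => f x + G x)).
Proof.
move=> eta0 H; rewrite -subr_le0; set E := expR (n%:R * (P + a G)).
apply: (@le0_geometric _ _ (E * (n%:R * (A * K))) r).
- by case/andP: r01 => /ltW.
- by case/andP: r01.
move=> N; set e := n%:R * (A * K * r ^+ N).
have -> : E * (n%:R * (A * K)) * r ^+ N = E * e by rewrite /e; ring.
rewrite lerBlDl -lerBlDr.
have -> : (1 + eta) * E - E * e = E * (1 + eta - e) by ring.
(* A trial factor must be positive; otherwise N is too small and the claim is trivial. *)
have [c0|c0] := leP (1 + eta - e) 0.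
  by apply: le_trans (expR_ge0 _); rewrite mulr_ge0_le0 ?expR_ge0.
have [l [B [l0 HB]]] := trial_function_bounds N.
apply: (pressure_trial_ge th_gt0 th_lt1 (holder_add hf hG) l0 HB); first by rewrite mulr_gt0 ?expR_gt0.
move=> x; rewrite transfer_tilt [leRHS]mulrAC ler_wpM2r ?expR_ge0//.
have -> : E = expR (n%:R * P) * expR (n%:R * a G) by rewrite -expRD -mulrDr.
rewrite -mulrA ler_wpM2l ?expR_ge0//.
have -> : \sum_(w : n.-tuple (letter m'))
      expR (birkhoff F n (prep w x)) * expR (tilt F G N n w x) =
  expR (n%:R * a G) * \sum_(w : n.-tuple (letter m'))
      expR (birkhoff F n (prep w x)) * expR (X N n w x).
  rewrite mulr_sumr; apply: eq_bigr => w _; rewrite [RHS]mulrCA; congr (_ * _).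
  by rewrite -expRD; congr expR; rewrite /X; ring.
rewrite ler_wpM2l ?expR_ge0//.
have := H N x; have := tilt_mean_dev N n x.
have := transfer_cst n 1 x nF; rewrite /transfer.
under [X in X = 1]eq_bigr do rewrite mulr1.
have -> : \sum_(w : n.-tuple (letter m'))
     expR (birkhoff F n (prep w x)) * (expR (X N n w x) - 1 - X N n w x) =
  \sum_(w : n.-tuple (letter m')) expR (birkhoff F n (prep w x)) * expR (X N n w x)
  - \sum_(w : n.-tuple (letter m')) expR (birkhoff F n (prep w x))
  - \sum_(w : n.-tuple (letter m')) expR (birkhoff F n (prep w x)) * X N n w x.
  by rewrite -!sumrB; apply: eq_bigr => w _; ring.
rewrite -/e ler_norml; lra.
Qed.

(** One step is enough: X is bounded by [B] independently of N, so e^X <= 1 + X + 2 B^2, and the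
    mean of X is O(r^N). *)
Lemma pressure_tilt_le (B := A + 2 * A * K / (1 - r)) : B <= 1 / 2 ->
  expR (pressure (fun x => f x + G x)) <= (1 + 2 * B ^+ 2) * expR (P + a G).
Proof.
move=> B12; rewrite -subr_le0; set E := expR (P + a G).
have A0 : 0 <= A by exact: holder_ge0 hG.
apply: (@le0_geometric _ _ (E * (A * K)) r).
- by case/andP: r01 => /ltW.
- by case/andP: r01.
move=> N; set e := A * K * r ^+ N.
have e0 : 0 <= e by rewrite !mulr_ge0// exprn_ge0//; case/andP: r01 => /ltW.
rewrite -mulrA -/e lerBlDr.
have -> : E * e + (1 + 2 * B ^+ 2) * E = E * (1 + 2 * B ^+ 2 + e) by ring.
have [l [B' [l0 HB]]] := trial_function_bounds N.
have B20 : 0 <= B ^+ 2 by exact: sqr_ge0.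
have := pressure_trial_le (n := 1) th_gt0 th_lt1 (holder_add hf hG) l0 HB; rewrite mul1r; apply.
  by rewrite mulr_gt0 ?expR_gt0//; lra.
move=> x; rewrite transfer_tilt [leLHS]mulrAC ler_wpM2r ?expR_ge0//.
rewrite mul1r /E expRD -mulrA ler_wpM2l ?expR_ge0//.
have -> : \sum_(w : 1.-tuple (letter m'))
      expR (birkhoff F 1 (prep w x)) * expR (tilt F G N 1 w x) =
  expR (a G) * \sum_(w : 1.-tuple (letter m'))
      expR (birkhoff F 1 (prep w x)) * expR (X N 1 w x).
  rewrite mulr_sumr; apply: eq_bigr => w _; rewrite [RHS]mulrCA; congr (_ * _).
  by rewrite -expRD; congr expR; rewrite /X; ring.
rewrite ler_wpM2l ?expR_ge0//.
have := tilt_mean_dev N 1 x; rewrite mul1r -/e.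
have := transfer_cst 1 1 x nF; rewrite /transfer.
under [X in X = 1]eq_bigr do rewrite mulr1.
suff : \sum_(w : 1.-tuple (letter m')) expR (birkhoff F 1 (prep w x)) * expR (X N 1 w x)
  <= (1 + 2 * B ^+ 2) * \sum_(w : 1.-tuple (letter m')) expR (birkhoff F 1 (prep w x))
  + \sum_(w : 1.-tuple (letter m')) expR (birkhoff F 1 (prep w x)) * X N 1 w x.
  by rewrite ler_norml => h1 h2; rewrite h2 in h1 *; lra.
rewrite mulr_sumr -big_split; apply: ler_sum => w _ /=.
rewrite [(1 + _) * _]mulrC -mulrDr ler_wpM2l ?expR_ge0//.
have XB : `|X N 1 w x| <= B.
  by have := tilt_bound nF r01 aP K_ge0 hG N x (size_tuple w); rewrite [_%:R * A]mul1r.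
apply: (le_trans (expR_le_quadratic (le_trans XB B12))).
have : X N 1 w x ^+ 2 <= B ^+ 2.
  by rewrite -[X N 1 w x ^+ 2]ger0_norm ?sqr_ge0// normrX lerXn2r ?nnegrE ?(le_trans _ XB).
lra.
Qed.

End Direction.
End Cohomologous.
End PressurePerturbation.

Section PressureDerivative.
Context {R : realType} {m' : nat} (th : R).
Hypotheses (th_gt0 : 0 < th) (th_lt1 : th < 1).
Implicit Types (f g F G : Sigma m' -> R) (x y : Sigma m') (w : seq (letter m')).

Lemma birkhoff_bound B f n x : (forall y, `|f y| <= B) -> `|birkhoff f n x| <= n%:R * B.
Proof.
move=> H; rewrite mulr_natl -[n in _ *+ n]card_ord -sumr_const.
by rewrite (le_trans (ler_norm_sum _ _ _))// ler_sum.
Qed.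

Lemma birkhoff_nseq G i c n x : (forall y, G (pre i y) = c) ->
  birkhoff G n (prep (nseq n i) x) = n%:R * c.
Proof.
move=> H; elim: n => [|n IH]; first by rewrite birkhoff0 mul0r.
have -> : prep (nseq n.+1 i) x = pre i (prep (nseq n i) x) by [].
rewrite birkhoffS H; have -> : left_shift (pre i (prep (nseq n i) x)) = prep (nseq n i) x by [].
by rewrite IH -[n.+1]addn1 natrD; ring.
Qed.

(* a is the derivative at f of the pressure: for the Gibbs measure of f it is
   the integral. *)
Lemma pressure_perturbation C f : holder th C f -> exists a : (Sigma m' -> R) -> R,
  [/\ forall A B c d G G', holder th A G -> holder th B G' ->
        a (fun x => c * G x + d * G' x) = c * a G + d * a G',
      forall c, a (fun=> c) = c,
      forall A G, holder th A G -> pressure f + a G <= pressure (fun x => f x + G x),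
      forall A, exists2 C2, 0 < C2 & forall G v, holder th A G -> `|v| * C2 <= 1 ->
        pressure (fun x => f x + v * G x) <= pressure f + v * a G + C2 * v ^+ 2
    & forall A G i c, holder th A G -> (forall x, G (pre i x) = c) -> c <> a G ->
        pressure f + a G < pressure (fun x => f x + G x)].
Proof.
move=> hf; have [u [D [hu hF nF]]] := normalisation th_gt0 th_lt1 hf.
have [a [K [r [K0 r01 aP]]]] := mean_exists th_gt0 th_lt1 hF nF.
have r0 : 0 <= r by case/andP: r01 => /ltW.
have r1 : 0 < 1 - r by rewrite subr_gt0; case/andP: r01.
exists a; split.
- by move=> A B c d G G' hG hG'; exact: (mean_lin r01 aP _ _ hG hG').
- by move=> c; exact: (mean_cst nF r01 aP).
- move=> A G hG.
  have := @pressure_tilt_ge _ _ _ th_gt0 th_lt1 _ _ _ _ _ _ _ hf hu nF K0 r01 aP _ _ hG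
    1 0 (lexx _); rewrite addr0 !mul1r ler_expR; apply => N x.
  apply: sumr_ge0 => w _; rewrite mulr_ge0 ?expR_ge0// -addrA -opprD subr_ge0.
  exact: expR_ge1Dx.
- move=> A; pose B0 := `|A| + 2 * `|A| * K / (1 - r).
  have B00 : 0 <= B0 by rewrite addr_ge0// divr_ge0 ?mulr_ge0// ltW.
  (* The first term is the quadratic error, the second forces |v| B0 <= 1/2 on the admissible range,
     the third ensures positivity. *)
  exists (2 * B0 ^+ 2 + 2 * B0 + 1).
    by have := sqr_ge0 B0; lra.
  move=> G v hG hv; have A0 := holder_ge0 hG.
  have hvG := holder_scale v hG.
  have := pressure_tilt_le th_gt0 th_lt1 hf hu nF K0 r01 aP hvG.
  have -> : `|v| * A + 2 * (`|v| * A) * K / (1 - r) = `|v| * B0.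
    by rewrite /B0 (ger0_norm A0); ring.
  have v0 : 0 <= `|v| by [].
  have hB : `|v| * B0 <= 1 / 2.
    have : 0 <= `|v| * (2 * B0 ^+ 2) by rewrite !mulr_ge0 ?sqr_ge0.
    by move: hv; rewrite !mulrDr; lra.
  move=> /(_ hB).
  have -> : a (fun x => v * G x) = v * a G.
    have := mean_lin r01 aP v 0 hG hG; rewrite mul0r addr0 => <-.
    by congr a; apply/funext => x; rewrite mul0r addr0.
  rewrite exprMn real_normK ?num_real// => h.
  have h1 : expR (pressure (fun x => f x + v * G x)) <=
    expR (2 * (v ^+ 2 * B0 ^+ 2) + (pressure f + v * a G)).
    apply: (le_trans h); rewrite [leRHS]expRD ler_wpM2r ?expR_ge0//; exact: expR_ge1Dx.
  move: h1; rewrite ler_expR => /le_trans; apply.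
  have : 0 <= (2 * B0 + 1) * v ^+ 2 by rewrite mulr_ge0 ?sqr_ge0// addr_ge0// mulr_ge0.
  by lra.
- move=> A G i c hG Gc ca; have A0 := holder_ge0 hG.
  have [BF HBF] := holder_bounded hF.
  pose B := 2 * A * K / (1 - r).
  have B0 : 0 <= B by rewrite divr_ge0 ?mulr_ge0// ltW.
  have g0 : 0 < `|c - a G| by rewrite normr_gt0 subr_eq0; apply/eqP.
  (* Along the constant word in [i] the sum of G deviates from its mean by n |c - a G|. This [n]
     makes the deviation exceed the oscillation of the corrector by 1, so this one word of weight at
     least exp(- n BF) contributes the gap [eta]. *)
  pose n := (Num.bound ((B + 1) / `|c - a G|)).
  have nP : B + 1 <= n%:R * `|c - a G|.
    rewrite -ler_pdivrMr// ltW// archi_boundP// divr_ge0// addr_ge0//.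
  have n0 : 0 < n%:R :> R.
    rewrite lt0r ler0n andbT; apply/negP => /eqP n0; move: nP; rewrite n0 mul0r.
    by apply/negP; rewrite -ltNge ltr_wpDl.
  pose eta := expR (- (n%:R * BF)) / 4.
  have eta0 : 0 < eta by rewrite divr_gt0 ?expR_gt0.
  have := @pressure_tilt_ge _ _ _ th_gt0 th_lt1 _ _ _ _ _ _ _ hf hu nF K0 r01 aP _ _ hG
    n eta (ltW eta0) => tg.
  suff : expR (n%:R * (pressure f + a G)) < expR (n%:R * pressure (fun x => f x + G x)).
    by rewrite ltr_expR ltr_pM2l.
  apply: lt_le_trans (tg _); last first.
    move=> N x; rewrite (bigD1 [tuple of nseq n i])//=.
    rewrite ler_wpDr//.
      apply: sumr_ge0 => w _; rewrite mulr_ge0 ?expR_ge0// -addrA -opprD subr_ge0.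
      exact: expR_ge1Dx.
    rewrite /eta ler_pM ?expR_ge0//.
      rewrite ler_expR; have := birkhoff_bound n (prep (nseq n i) x) HBF.
      by rewrite ler_norml => /andP[].
    set Y := tilt _ _ _ _ _ _ - _.
    suff /expR_ge_gap : 1 <= `|Y| by lra.
    have := corrector_osc r01 aP K0 hG N (prep (nseq n i) x) x; rewrite -/B.
    have : `|n%:R * (c - a G)| = n%:R * `|c - a G| by rewrite normrM ger0_norm// ltW.
    have -> : Y = n%:R * (c - a G) + (corrector (fun x => f x - pressure f + u x - u (left_shift x)) G N (prep (nseq n i) x) - corrector (fun x => f x - pressure f + u x - u (left_shift x)) G N x).
      by rewrite /Y /tilt (birkhoff_nseq _ _ Gc); ring.
    set z := _ * _; set k := corrector _ _ _ _ - _ => e1 e2.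
    have := ler_normD (z + k) (- k); rewrite addrK normrN; lra.
  by rewrite ltr_pMl ?expR_gt0// ltrDl.
Qed.

End PressureDerivative.

(** * Gibbs measures *)

Section GibbsWeights.
Context {R : realType} {m' : nat} (th : R).
Hypotheses (th_gt0 : 0 < th) (th_lt1 : th < 1).
Implicit Types (f g F G : Sigma m' -> R) (x y : Sigma m') (w : seq (letter m')).

(* The weights M w of the cylinders of a shift-invariant probability measure. *)
Record invariant_weights (M : seq (letter m') -> R) : Prop := {
  weight_ge0 : forall w, 0 <= M w ;
  weight_nil : M [::] = 1 ;
  weight_rcons : forall w, \sum_i M (rcons w i) = M w ;
  weight_cons : forall w, \sum_i M (i :: w) = M w }.

Definition gibbs_weights f (M : seq (letter m') -> R) : Prop :=
  exists2 c, 1 <= c & forall w x, cylinder w x ->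
    c^-1 <= M w / expR (birkhoff f (size w) x - (size w)%:R * pressure f) <= c.

Definition cyl_ind w x : R := (mkseq x (size w) == w)%:R.

Lemma holder_ind w : holder th (th ^- size w) (cyl_ind w).
Proof.
move=> k x y a; have tw : 0 < th ^+ size w by exact: exprn_gt0.
have [wk|kw] := leqP (size w) k.
  have -> : cyl_ind w x = cyl_ind w y.
    rewrite /cyl_ind; suff -> : mkseq x (size w) = mkseq y (size w) by [].
    by apply/eq_in_map => j; rewrite mem_iota => /andP[_ jw]; apply: (agreeW wk a).
  by rewrite subrr normr0 mulr_ge0 ?invr_ge0 ?exprn_ge0 ?ltW.
apply: (@le_trans _ _ 1).
  by rewrite /cyl_ind; do 2 case: eqP => _; rewrite ?subrr ?subr0 ?sub0r ?normrN ?normr0 ?normr1.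
by rewrite mulrC ler_pdivlMr// mul1r ler_wiXn2l ?(ltW th_gt0) ?(ltW th_lt1) ?(ltnW kw).
Qed.

Lemma cyl_ind_prep w v x : size v = size w -> cyl_ind w (prep v x) = (v == w)%:R.
Proof. by move=> vw; have := cylinder_prep v x; rewrite /cylinder/= /cyl_ind vw => ->. Qed.

Lemma transfer_ind F w x :
  transfer F (size w) (cyl_ind w) x = expR (birkhoff F (size w) (prep w x)).
Proof.
rewrite /transfer (bigD1 (in_tuple w))//= cyl_ind_prep// eqxx mulr1.
rewrite big1 ?addr0// => v vw; rewrite cyl_ind_prep ?size_tuple//.
have -> : (tval v == w) = false; last by rewrite mulr0.
by apply/negP => /eqP vw'; move/eqP: vw; apply; apply/val_inj.
Qed.

Lemma cyl_ind_rcons w x : cyl_ind w x = \sum_i cyl_ind (rcons w i) x.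
Proof.
rewrite /cyl_ind (bigD1 (x (size w)))//= big1 ?addr0 => [|i ix].
  by rewrite size_rcons mkseqS eqseq_rcons eqxx andbT.
by rewrite size_rcons mkseqS eqseq_rcons (eq_sym _ i) (negbTE ix) andbF.
Qed.

Lemma cyl_ind_cons w x : cyl_ind w (left_shift x) = \sum_i cyl_ind (i :: w) x.
Proof.
have E i : (mkseq x (size w).+1 == i :: w) = (x 0%N == i) && (mkseq (left_shift x) (size w) == w).
  by rewrite /mkseq /= eqseq_cons -[1%N]addn0 iotaDl -map_comp.
rewrite /cyl_ind (bigD1 (x 0%N))//= big1 ?addr0 => [|i ix].
  by rewrite E eqxx.
by rewrite E (eq_sym _ i) (negbTE ix).
Qed.

(** The weight of [w] is the mean of the indicator of its cylinder. Splitting a cylinder by its next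
    letter gives one consistency relation, shift invariance of the mean the other. The Gibbs bounds
    hold because |w| steps of the operator turn the indicator into exp(S F), and F differs from f -
    P by a bounded coboundary. *)
Lemma gibbs_weights_exist C f : holder th C f ->
  exists2 M, invariant_weights M & gibbs_weights f M.
Proof.
move=> hf; have [u [D [hu hF nF]]] := normalisation th_gt0 th_lt1 hf.
set F := (fun x => _) in hF nF.
have [a [K [r [K0 r01 aP]]]] := mean_exists th_gt0 th_lt1 hF nF.
have D0 := holder_ge0 hu.
have asum A (I : Type) (s : seq I) (G : I -> Sigma m' -> R) : (forall i, holder th A (G i)) ->
    (exists B, holder th B (fun x => \sum_(i <- s) G i x)) /\
    a (fun x => \sum_(i <- s) G i x) = \sum_(i <- s) a (G i).
  move=> hG; elim: s => [|i s [[B hB] IH]].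
    rewrite big_nil; have -> : (fun x => \sum_(i <- [::]) G i x) = fun=> 0.
      by apply/funext => x; rewrite big_nil.
    by split; [exists 0; exact: holder_cst|exact: (mean_cst nF r01 aP)].
  have -> : (fun x => \sum_(j <- i :: s) G j x) =
     fun x => 1 * G i x + 1 * \sum_(j <- s) G j x.
    by apply/funext => x; rewrite big_cons !mul1r.
  split; first by eexists; exact: holder_lin (hG i) hB.
  by rewrite (mean_lin r01 aP _ _ (hG i) hB) big_cons !mul1r IH.
exists (fun w => a (cyl_ind w)); first split.
- by move=> w; apply: (mean_ge nF r01 aP (n := 0) (holder_ind w)) => x; rewrite transfer0.
- by rewrite -[RHS](mean_cst nF r01 aP); congr a.
- move=> w; have -> : cyl_ind w = fun x => \sum_i cyl_ind (rcons w i) x.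
    by apply/funext => x; exact: cyl_ind_rcons.
  have [|_ ->//] := asum (th ^- (size w).+1) _ (index_enum (letter m')) (fun i => cyl_ind (rcons w i)).
  by move=> i; rewrite -(size_rcons w i); exact: holder_ind.
- move=> w; rewrite -(mean_shift th_gt0 th_lt1 nF r01 aP (holder_ind w)).
  have -> : (fun x => cyl_ind w (left_shift x)) = fun x => \sum_i cyl_ind (i :: w) x.
    by apply/funext => x; exact: cyl_ind_cons.
  have [|_ ->//] := asum (th ^- (size w).+1) _ (index_enum (letter m')) (fun i => cyl_ind (i :: w)).
  by move=> i; exact: (holder_ind (i :: w)).
pose B := distortion th D + D.
have B0 : 0 <= B by rewrite addr_ge0 ?distortion_ge0.
exists (expR B); first by rewrite -expR0 ler_expR.
move=> w x wx; set e := _ - _.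
have key y : e - B <= birkhoff F (size w) (prep w y) <= e + B.
  have := birkhoff_cylinder th_gt0 th_lt1 hF (cylinder_prep w y) wx.
  have := birkhoff_cylinder th_gt0 th_lt1 hF wx (cylinder_prep w y).
  have := birkhoff_coboundary f u (size w) x; rewrite -/F => ->.
  have := holder_osc x (iter (size w) left_shift x) hu.
  by rewrite /B /e ler_norml; lra.
rewrite -[(expR B)^-1]expRN ler_pdivlMr ?expR_gt0// ler_pdivrMr ?expR_gt0// -!expRD.
apply/andP; split.
  apply: (mean_ge nF r01 aP (n := size w) (holder_ind w)) => y.
  by rewrite transfer_ind ler_expR; have := key y; lra.
apply: (mean_le nF r01 aP (n := size w) (holder_ind w)) => y.
by rewrite transfer_ind ler_expR; have := key y; lra.
Qed.

(* Jensen's inequality over the words of length n, together with invariance. *)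
Lemma gibbs_supporting_line C f M (p : letter m' -> R) A v :
  holder th C f -> invariant_weights M -> gibbs_weights f M -> holder th A (fun x => p (x 0%N)) ->
  pressure f + v * (\sum_i p i * M [:: i]) <=
  pressure (fun x => f x + v * p (x 0%N)).
Proof.
move=> hf HM [c c1 HG] hp; set I0 := \sum_i _.
pose S (w : seq (letter m')) := \sum_(i <- w) p i.
have SE n (w : n.-tuple (letter m')) x : birkhoff (fun x => p (x 0%N)) n (prep w x) = S w.
  case: w => w /= /eqP <-; elim: w => [|i w IH]; first by rewrite birkhoff0 /S big_nil.
  by rewrite birkhoffS /S big_cons -/(S w) -IH.
have M1 n : \sum_(w : n.-tuple (letter m')) M w = 1.
  elim: n => [|n IH]; first by rewrite sum_tuple0 (weight_nil HM).
  rewrite -add1n (sum_tuple_cat 1 n M) exchange_big -[RHS]IH; apply: eq_bigr => w _.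
  by rewrite (sum_tuple1 (fun u => M (u ++ w))) -(weight_cons HM).
have MS n : \sum_(w : n.-tuple (letter m')) M w * S w = n%:R * I0.
  elim: n => [|n IH].
    by rewrite (sum_tuple0 (fun w => M w * S w)) /S big_nil mulr0 mul0r.
  rewrite -add1n (sum_tuple_cat 1 n (fun w => M w * S w)).
  rewrite (sum_tuple1 (fun u => \sum_(v : n.-tuple (letter m')) M (u ++ v) * S (u ++ v))).
  have E i (w : n.-tuple (letter m')) : M ([:: i] ++ w) * S ([:: i] ++ w) =
      p i * M (i :: w) + M (i :: w) * S w.
    by rewrite /S big_cat big_seq1 /=; ring.
  under eq_bigr do under eq_bigr do rewrite E.
  under eq_bigr do rewrite big_split/=.
  rewrite big_split/= natrD mulrDl mul1r -IH; congr (_ + _).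
    apply: eq_bigr => i _; rewrite -mulr_sumr; congr (_ * _).
    elim: n {IH E} => [|n IH]; first by rewrite (sum_tuple0 (fun w => M (i :: w))).
    rewrite -addn1 (sum_tuple_cat n 1 (fun w => M (i :: w))) -[RHS]IH.
    apply: eq_bigr => w _; rewrite (sum_tuple1 (fun v => M (i :: w ++ v))).
    rewrite -(weight_rcons HM (i :: w)); apply: eq_bigr => j _.
    by rewrite cats1.
  rewrite exchange_big; apply: eq_bigr => w _.
  by rewrite -mulr_suml (weight_cons HM).
pose x0 : Sigma m' := fun=> ord0.
have hfv := holder_add hf (holder_scale v hp).
rewrite -subr_le0.
apply: (@linear_drift_le0 _ (3 * distortion th (C + `|v| * A) + ln c)) => n.
set P := pressure f; set P' := pressure _.
have c0 : 0 < c by exact: lt_le_trans c1.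
suff : expR (n%:R * (P + v * I0)) <= c * expR (3 * distortion th (C + `|v| * A) + n%:R * P').
  rewrite -{1}[c]lnK ?posrE// -expRD ler_expR; lra.
have /andP[_ h] := pressure_bound th_gt0 th_lt1 hfv n x0.
apply: (@le_trans _ _ (c * transfer (fun x => f x + v * p (x 0%N)) n (fun=> 1) x0)); last first.
  by rewrite ler_wpM2l// ltW.
(* Inserts a factor equal to 1 on average, the tangent line of exp at the mean n v I0: [M] has total
   mass 1 and [S] has mean n I0. Each word then needs only 1 + y <= exp(y). *)
have -> : expR (n%:R * (P + v * I0)) = \sum_(w : n.-tuple (letter m'))
    expR (n%:R * (P + v * I0)) * (M w + v * (M w * S w) - (n%:R * v * I0) * M w).
  rewrite -mulr_sumr sumrB big_split/= -!mulr_sumr M1 MS.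
  by rewrite -[LHS]mulr1; congr (_ * _); ring.
rewrite /transfer [leRHS]mulr_sumr; apply: ler_sum => w _.
rewrite mulr1 birkhoffD birkhoffZ SE expRD.
have /andP[_] := HG w (prep w x0) (cylinder_prep w x0).
rewrite size_tuple ler_pdivrMr ?expR_gt0// -/P => hM.
set s := birkhoff f n _ in hM *.
have -> : c * (expR s * expR (v * S w)) =
   c * expR (s - n%:R * P) * (expR (n%:R * P + v * S w)).
  by rewrite -!mulrA -!expRD; congr (_ * expR _); ring.
apply: (@le_trans _ _ (M w * expR (n%:R * P + v * S w))); last first.
  by rewrite ler_wpM2r ?expR_ge0.
have -> : M w * expR (n%:R * P + v * S w) =
  expR (n%:R * (P + v * I0)) * (M w * expR (v * S w - n%:R * v * I0)).
  by rewrite mulrCA -expRD; congr (_ * expR _); ring.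
rewrite ler_wpM2l ?expR_ge0//.
have -> : M w + v * (M w * S w) - n%:R * v * I0 * M w =
  M w * (1 + (v * S w - n%:R * v * I0)) by ring.
by rewrite ler_wpM2l ?(weight_ge0 HM)// expR_ge1Dx.
Qed.

End GibbsWeights.

(** * Realisation of invariant weights by a measure *)

Section Coding.
Context {R : realType} {m' : nat} (M : seq (letter m') -> R).
Hypothesis HM : invariant_weights M.
Implicit Types (w : seq (letter m')) (t : R).

(* The intervals [slot_start w, slot_start w + M w[ of the words of a given length
   partition [0, 1[, in lexicographic order. *)
Definition slot_start w : R :=
  \sum_(k < size w) \sum_(j < m'.+2 | (j < nth ord0 w k)%N) M (rcons (take k w) j).

Definition slot w t := (slot_start w <= t < slot_start w + M w).

Lemma start_rcons w (i : letter m') :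
  slot_start (rcons w i) = slot_start w + \sum_(j < m'.+2 | (j < i)%N) M (rcons w j).
Proof.
rewrite /slot_start size_rcons big_ord_recr /=; congr (_ + _).
  apply: eq_bigr => k _; rewrite nth_rcons ltn_ord.
  by rewrite -cats1 takel_cat// ltnW.
by rewrite nth_rcons ltnn eqxx -cats1 take_size_cat.
Qed.

Lemma sum_weights_le w (p q : pred (letter m')) : (forall j, p j -> q j) ->
  \sum_(j | p j) M (rcons w j) <= \sum_(j | q j) M (rcons w j).
Proof.
move=> pq; rewrite big_mkcond [leRHS]big_mkcond ler_sum// => j _.
have := weight_ge0 HM (rcons w j).
by case: (boolP (p j)) => [/pq ->//|_]; case: ifP.
Qed.

Lemma sum_weights_lt w (i : letter m') : \sum_(j < m'.+2 | (j < i)%N) M (rcons w j) + M (rcons w i) =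
  \sum_(j < m'.+2 | (j <= i)%N) M (rcons w j).
Proof.
rewrite [RHS](bigD1 i)//= addrC; congr (_ + _); apply: eq_bigl => j.
by rewrite ltn_neqAle andbC.
Qed.

Lemma slot_rcons w i t : slot (rcons w i) t -> slot w t.
Proof.
rewrite /slot start_rcons => /andP[h1 h2].
have s0 : 0 <= \sum_(j < m'.+2 | (j < i)%N) M (rcons w j).
  by apply: sumr_ge0 => j _; exact: weight_ge0.
have := @sum_weights_le w (fun j : letter m' => (j <= i)%N) xpredT (fun _ _ => isT).
rewrite (weight_rcons HM) -sum_weights_lt; lra.
Qed.

Lemma slot_ex w t : slot w t -> exists i, slot (rcons w i) t.
Proof.
move=> /andP[h1 h2].
pose p (i : letter m') := t < slot_start w + \sum_(j < m'.+2 | (j <= i)%N) M (rcons w j).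
have pm : p ord_max.
  rewrite /p (eq_bigl xpredT) ?(weight_rcons HM)// => j.
  by rewrite -ltnS ltn_ord.
have [i pi mini] := @arg_minnP _ _ p (fun i => nat_of_ord i) pm.
exists i; rewrite /slot start_rcons -addrA sum_weights_lt; apply/andP; split; last exact: pi.
have [i0|i0] := posnP i.
  by rewrite big1 ?addr0// => j; rewrite i0.
have ip : (i.-1 < m'.+2)%N by exact: leq_ltn_trans (leq_pred _) (ltn_ord i).
rewrite leNgt; apply/negP => h.
have /mini : p (Ordinal ip).
  rewrite /p (eq_bigl (fun j : letter m' => (j < i)%N))// => j /=.
  by rewrite -ltnS prednK.
by rewrite /= leqNgt ltn_predL i0.
Qed.

Lemma slot_inj w i j t : slot (rcons w i) t -> slot (rcons w j) t -> i = j.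
Proof.
wlog ij : i j / (i <= j)%N => [H|].
  by case/orP: (leq_total i j) => ij h1 h2; [exact: H|apply/esym/H].
move: ij; rewrite leq_eqVlt => /orP[/eqP/val_inj//|ij].
rewrite /slot !start_rcons -addrA sum_weights_lt => /andP[_ h1] /andP[h2 _].
have := @sum_weights_le w (fun k : letter m' => (k <= i)%N) (fun k : letter m' => (k < j)%N)
  (fun k ki => leq_ltn_trans ki ij).
by move=> /(lerD (lexx (slot_start w))) /(lt_le_trans h1) /lt_le_trans /(_ h2); rewrite ltxx.
Qed.

(** Descends through the nested slots containing [t]; the default letter occurs only for [t] outside
    [0, 1[. *)
Fixpoint address t n : seq (letter m') :=
  if n is n'.+1 then
    rcons (address t n') (odflt ord0 [pick i | slot (rcons (address t n') i) t])
  else [::].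

Lemma slot_address t n : 0 <= t < 1 -> slot (address t n) t.
Proof.
move=> t01; elim: n => [|n IH] /=.
  by rewrite /slot /slot_start big_ord0 (weight_nil HM) add0r.
by case: pickP => [i//|H]; have [i] := slot_ex IH; rewrite H.
Qed.

Lemma addressP t w : 0 <= t < 1 -> (address t (size w) == w) = slot w t.
Proof.
move=> t01; apply/eqP/idP => [<-|]; first exact: slot_address.
elim/last_ind: w => // w i IH wi; rewrite size_rcons /= IH; last exact: slot_rcons wi.
by case: pickP => [j wj|/(_ i)]; [rewrite (slot_inj wj wi)|rewrite wi].
Qed.

Lemma slot01 w t : slot w t -> 0 <= t < 1.
Proof.
elim/last_ind: w => [|w i IH /slot_rcons]//.
by rewrite /slot /slot_start big_ord0 (weight_nil HM) add0r.
Qed.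

(** The constant value outside [0, 1[ makes the map total on the line; the uniform law gives that
    region measure 0. *)
Definition unit_coding t : Sigma m' :=
  if 0 <= t < 1 then (fun n => last ord0 (address t n.+1)) else (fun=> ord0).

Lemma mkseq_unit_coding t n : 0 <= t < 1 -> mkseq (unit_coding t) n = address t n.
Proof.
move=> t01; elim: n => // n IH; rewrite mkseqS IH /unit_coding t01 /=.
by rewrite last_rcons.
Qed.

Lemma unit_coding_cylinder w : unit_coding @^-1` cylinder w =
  [set` `[slot_start w, slot_start w + M w[] `|`
  (if mkseq (fun=> ord0) (size w) == w then ~` `[0, 1[%classic else set0).
Proof.
have Iw t : [set` `[slot_start w, slot_start w + M w[] t = slot w t by rewrite /= in_itv.
have I01 t : `[0, 1[%classic t = (0 <= t < 1) by rewrite /= in_itv.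
apply/seteqP; split => t.
  rewrite /preimage /cylinder /setU /=; have [t01|t01] := boolP (0 <= t < 1).
    rewrite mkseq_unit_coding// => /eqP; rewrite addressP// => wt.
    by left; rewrite in_itv.
  rewrite {1}/unit_coding (negbTE t01) => /eqP ->; right.
  by rewrite /setC /= in_itv /=; apply/negP.
case=> [|].
  rewrite Iw => wt; have t01 := slot01 wt; rewrite /preimage /cylinder /=.
  by rewrite mkseq_unit_coding//; apply/eqP; rewrite addressP.
case: eqP => // e; rewrite /setC /= in_itv /= => /negP t01.
by rewrite /preimage /cylinder /= /unit_coding (negbTE t01).
Qed.

End Coding.

Section CylinderSigmaAlgebra.
Context {R : realType} {m' : nat}.
Implicit Types (x y : Sigma m') (w : seq (letter m')).

Lemma seq_dist_agree x y n : mkseq x n = mkseq y n -> @seq_dist R m' x y <= expR (- n%:R).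
Proof.
move=> a; apply: ge_inf; last by exists n.
by exists 0 => _ [k _ <-]; exact: expR_ge0.
Qed.

Lemma agree_seq_dist x y n : @seq_dist R m' x y < expR (- n%:R) -> mkseq x n = mkseq y n.
Proof.
move=> /inf_lt[|_ [k /= xy <-]].
  by exists 1, 0%N => //=; rewrite oppr0 expR0.
rewrite ltr_expR ltrN2 ltr_nat => nk; have := congr1 (take n) xy.
by rewrite /mkseq -!map_take !take_iota (minn_idPl (ltnW nk)).
Qed.

Lemma seq_open_cylinder w : @seq_open R m' (cylinder w).
Proof.
move=> x <-; exists (expR (- (size w)%:R)); first exact: expR_gt0.
by move=> y /agree_seq_dist; rewrite /cylinder /= size_mkseq => ->.
Qed.

(** Balls contain cylinders and there are countably many words, so cylinders generate the Borel
    sets. *)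
Lemma seq_open_bigcup (A : set (Sigma m')) : @seq_open R m' A ->
  A = \bigcup_(w in [set w | cylinder w `<=` A]) cylinder w.
Proof.
move=> oA; apply/seteqP; split => [x Ax|x [w wA wx]]; last exact: wA.
have [e e0 He] := oA x Ax.
have [n hn] : exists n, expR (- n%:R) < e.
  pose n := Num.bound `|ln e|; exists n.
  rewrite -[e]lnK ?posrE// ltr_expR ltrNl (le_lt_trans (ler_norm _))// normrN.
  exact: archi_boundP.
exists (mkseq x n); last by rewrite /cylinder /= size_mkseq.
move=> y; rewrite /cylinder /= size_mkseq => xy; apply: He.
by apply: le_lt_trans hn; apply: seq_dist_agree.
Qed.

(** The empty set is added to obtain a family stable under intersection, as uniqueness of measures
    requires: two cylinders are nested or disjoint. *)
Definition cylinders : set (set (Sigma m')) :=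
  [set A | A = set0 \/ exists w, A = cylinder w].

Lemma borel_cylinders : <<s @seq_open R m' >> = <<s cylinders >>.
Proof.
apply/seteqP; split; apply: smallest_sub; try exact: smallest_sigma_algebra.
  move=> A /seq_open_bigcup ->; rewrite bigcup_mkcond.
  apply: (@countable_bigcupT_measurable _ (g_sigma_algebraType cylinders)).
    exact: countableP.
  move=> w; case: ifP => _; last exact: measurable0.
  by apply: sub_sigma_algebra; right; exists w.
move=> A [->|[w ->]]; first exact: (@measurable0 _ (g_sigma_algebraType (@seq_open R m'))).
by apply: sub_sigma_algebra; exact: seq_open_cylinder.
Qed.

Lemma measurable_cylinder w : measurable (cylinder w : set (SigmaBorel R m')).
Proof. by apply: sub_sigma_algebra; exact: seq_open_cylinder. Qed.

Lemma setI_closed_cylinders : setI_closed cylinders.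
Proof.
move=> _ _ [->|[v ->]] [->|[w ->]]; rewrite ?setI0 ?set0I; try by left.
wlog vw : v w / (size v <= size w)%N => [H|].
  by case/orP: (leq_total (size v) (size w)) => h; [|rewrite setIC]; exact: H.
have [e|ne] := eqVneq (take (size v) w) v; [right; exists w|left].
  apply/seteqP; split => [x []//|x wx]; split => //; rewrite /cylinder /= -[RHS]e.
  by rewrite -wx /mkseq -map_take take_iota (minn_idPl _)// size_map size_iota.
apply/seteqP; split => // x [vx wx]; move/eqP: ne; apply.
by rewrite -{1}wx /mkseq -map_take take_iota (minn_idPl _)//; exact: vx.
Qed.

End CylinderSigmaAlgebra.

Section WeightsMeasure.
Context {R : realType} {m' : nat}.
Implicit Types (x y : Sigma m') (w : seq (letter m')).
Local Notation Om := (SigmaBorel R m').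

Lemma bigsetU_ordP (T : Type) n (F : 'I_n -> set T) (x : T) :
  (\big[setU/set0]_(i < n) F i) x <-> exists i, F i x.
Proof.
rewrite -bigcup_seq; split => [[i _ Fix]|[i Fix]]; exists i => //.
by rewrite /= mem_index_enum.
Qed.

Lemma shift_preimage_cylinder w : left_shift @^-1` cylinder w =
  \big[setU/set0]_(i < m'.+2) cylinder (i :: w).
Proof.
have E x : mkseq x (size w).+1 = x 0%N :: mkseq (left_shift x) (size w).
  by rewrite /mkseq /= -[1%N]addn0 iotaDl -map_comp.
apply/seteqP; split => x.
  by move=> xw; apply/bigsetU_ordP; exists (x 0%N); rewrite /cylinder /= E xw.
by move=> /bigsetU_ordP[i]; rewrite /cylinder /= E => -[].
Qed.

Lemma cylinder_rcons w : cylinder w = \big[setU/set0]_(i < m'.+2) cylinder (rcons w i).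
Proof.
apply/seteqP; split => x.
  move=> wx; apply/bigsetU_ordP; exists (x (size w)).
  by rewrite /cylinder /= size_rcons mkseqS wx.
move=> /bigsetU_ordP[i]; rewrite /cylinder /= size_rcons mkseqS => /eqP.
by rewrite eqseq_rcons => /andP[/eqP].
Qed.

Lemma trivIset_cylinder (W : letter m' -> seq (letter m')) :
  (forall i j, size (W i) = size (W j)) -> injective W ->
  trivIset setT (fun i => cylinder (W i)).
Proof.
move=> sW injW i j _ _ [x [xi xj]]; apply: injW; rewrite -xi -xj.
by rewrite (sW i j).
Qed.

Lemma measurable_shift : measurable_fun [set: Om] (left_shift : Om -> Om).
Proof.
apply: (@measurability _ _ Om Om setT left_shift (@cylinders m')).
  exact: borel_cylinders.
move=> _ [_ [->|[w ->]] <-].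
  by rewrite preimage_set0 setI0; exact: (@measurable0 _ Om).
rewrite setTI shift_preimage_cylinder.
by apply: (@bigsetU_measurable _ Om) => i _; exact: measurable_cylinder.
Qed.

Lemma measure_shift_cylinder (mu : {measure set Om -> \bar R}) w :
  mu (left_shift @^-1` cylinder w) = (\sum_(i < m'.+2) mu (cylinder (i :: w)))%E.
Proof.
rewrite shift_preimage_cylinder measure_bigsetU_ord//.
  by move=> i; exact: measurable_cylinder.
by apply: trivIset_cylinder => // i j [].
Qed.

Lemma measure_cylinder_rcons (mu : {measure set Om -> \bar R}) w :
  mu (cylinder w) = (\sum_(i < m'.+2) mu (cylinder (rcons w i)))%E.
Proof.
rewrite {1}cylinder_rcons measure_bigsetU_ord//.
  by move=> i; exact: measurable_cylinder.
apply: trivIset_cylinder => [i j|i j]; first by rewrite !size_rcons.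
by move=> /rcons_inj [].
Qed.

Lemma cylinder_nil : cylinder [::] = [set: Sigma m'].
Proof. by apply/seteqP; split. Qed.

Lemma measure_weights (mu : probability Om R) :
  (forall A : set Om, measurable A -> mu (left_shift @^-1` A) = mu A) ->
  invariant_weights (fun w => fine (mu (cylinder w))).
Proof.
move=> inv; have fm w : mu (cylinder w) \is a fin_num.
  by apply: fin_num_measure; exact: measurable_cylinder.
split.
- by move=> w; rewrite fine_ge0// measure_ge0.
- by rewrite cylinder_nil probability_setT.
- by move=> w; rewrite sum_fine// -measure_cylinder_rcons.
- move=> w; rewrite sum_fine// -measure_shift_cylinder; congr fine.
  exact: inv (measurable_cylinder w).
Qed.

(** The image of the uniform law under [unit_coding], so that no extension theorem for set functions
    on cylinders is involved. Invariance is checked on cylinders, where it is [weight_cons]. *)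
Lemma weights_measure (M : seq (letter m') -> R) : invariant_weights M ->
  exists mu : probability Om R,
    (forall w, mu (cylinder w) = (M w)%:E) /\
    forall A : set Om, measurable A -> mu (left_shift @^-1` A) = mu A.
Proof.
move=> HM.
have mT : measurable_fun [set: measurableTypeR R] (unit_coding M : _ -> Om).
  apply: (@measurability _ _ (measurableTypeR R) Om setT (unit_coding M) (@cylinders m')).
    exact: borel_cylinders.
  move=> _ [_ [->|[w ->]] <-]; first by rewrite preimage_set0 setI0.
  rewrite setTI unit_coding_cylinder//; apply: measurableU => //.
  by case: ifP => _ //; apply: measurableC.
pose X : {mfun measurableTypeR R >-> Om} := HB.pack (unit_coding M : _ -> Om)
  (isMeasurableFun.Build _ _ _ _ (unit_coding M : measurableTypeR R -> Om) mT).
pose U : probability (measurableTypeR R) R := uniform_prob (@ltr01 R).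
have UI a b : 0 <= a -> a <= b -> b <= 1 -> U `[a, b[%classic = (b - a)%:E.
  move=> a0 ab b1; rewrite /U /= /uniform_prob.
  rewrite (eq_integral (fun=> 1%E)); last first.
    move=> x; rewrite inE /= in_itv /= => /andP[ax xb]; rewrite /uniform_pdf.
    by rewrite (le_trans a0 ax) (le_trans (ltW xb) b1) subr0 invr1.
  rewrite integral_cst//= mul1e lebesgue_measure_itv/= lte_fin.
  case: ltP => // ba; have -> : b = a by apply/eqP; rewrite eq_le ab ba.
  by rewrite subrr.
have Mle1 w : slot_start M w + M w <= 1 /\ 0 <= slot_start M w.
  elim/last_ind: w => [|w i [h1 h2]].
    by rewrite /slot_start big_ord0 (weight_nil HM) add0r.
  rewrite start_rcons -addrA sum_weights_lt; split.
    apply: le_trans h1; rewrite lerD2l -(weight_rcons HM w).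
    exact: sum_weights_le.
  by rewrite addr_ge0// sumr_ge0// => j _; exact: weight_ge0.
have muw w : distribution U X (cylinder w) = (M w)%:E.
  rewrite /distribution /pushforward /X /= unit_coding_cylinder//.
  have [h1 h2] := Mle1 w; have h3 := weight_ge0 HM w.
  set B := if _ then _ else _.
  have mB : measurable B by rewrite /B; case: ifP => _ //; exact: measurableC.
  have UB : U B = 0.
    apply/eqP; rewrite eq_le measure_ge0 andbT.
    apply: (@le_trans _ _ (U (~` `[0, 1[%classic))).
      apply: le_measure; rewrite ?inE//; first exact: measurableC.
      by rewrite /B; case: ifP => _ //; exact: sub0set.
    by rewrite probability_setC// UI// subr0 subee.
  have -> : U ([set` `[slot_start M w, slot_start M w + M w[] `|` B) = U [set` `[slot_start M w, slot_start M w + M w[].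
    apply/eqP; rewrite eq_le; apply/andP; split.
      by rewrite -[leRHS]adde0 -UB; apply: measureU2.
    by apply: le_measure; rewrite ?inE; [|exact: measurableU|exact: subsetUl].
  by rewrite UI// ?lerDl// addrAC subrr add0r.
exists (distribution U X); split => // A mA.
pose Y : {mfun Om >-> Om} := HB.pack (left_shift : Om -> Om)
  (isMeasurableFun.Build _ _ _ _ (left_shift : Om -> Om) measurable_shift).
rewrite -[LHS]/(distribution (distribution U X) Y A).
apply: (@measure_unique _ R Om (@cylinders m') (fun=> setT)) => //.
- exact: borel_cylinders.
- exact: setI_closed_cylinders.
- by move=> _; right; exists [::]; rewrite cylinder_nil.
- by apply/seteqP; split => // x _; exists 0%N.
- move=> _ [->|[w ->]]; first by rewrite !measure0.
  rewrite -[LHS]/(distribution U X (left_shift @^-1` cylinder w)) [RHS]muw.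
  rewrite measure_shift_cylinder -(weight_cons HM w) -sumEFin.
  by apply: eq_bigr => i _; exact: muw.
- by move=> _; rewrite (@le_lt_trans _ _ 1%E) ?probability_le1 ?ltry.
Qed.

Lemma integral_letter (mu : probability Om R) (p : letter m' -> R) :
  (\int[mu]_x (p (x 0%N))%:E)%E = (\sum_i p i * fine (mu (cylinder [:: i])))%:E.
Proof.
have mp : measurable_fun [set: Om] (fun x : Om => p (x 0%N)).
  move=> _ B mB; rewrite setTI.
  have -> : (fun x : Om => p (x 0%N)) @^-1` B =
      \big[setU/set0]_(i < m'.+2 | p i \in B) (cylinder [:: i] : set Om).
    rewrite big_mkcond; apply/seteqP; split => x.
      move=> pB; apply/bigsetU_ordP; exists (x 0%N).
      by rewrite (_ : p (x 0%N) \in B) ?inE// /cylinder.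
    by move=> /bigsetU_ordP[i]; case: ifP => //; rewrite inE => pB [xi]; rewrite /preimage /= xi.
  by apply: (@bigsetU_measurable _ Om) => i _; exact: measurable_cylinder.
have -> : [set: Om] = \big[setU/set0]_(i <- index_enum (letter m')) (cylinder [:: i] : set Om).
  by rewrite -cylinder_nil cylinder_rcons.
rewrite integral_bigsetU_EFin//=.
- rewrite -sumEFin; apply: eq_bigr => i _.
  rewrite (eq_integral (fun=> (p i)%:E)); last by move=> x; rewrite inE => -[->].
  rewrite integral_cst; last exact: measurable_cylinder.
  rewrite EFinM fineK//; apply: fin_num_measure; exact: measurable_cylinder.
- by move=> i; exact: measurable_cylinder.
- exact: index_enum_uniq.
- by apply: (sub_trivIset (@subsetT _ _)); apply: trivIset_cylinder => // i j [].
- by apply/measurable_EFinP; apply: measurable_funTS.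
Qed.

End WeightsMeasure.

(** * The two-parameter pressure and its critical points *)

Section TwoParameterPressure.
Local Opaque pressure.
Context {R : realType} {m' : nat} (th : R).
Hypotheses (th_gt0 : 0 < th) (th_lt1 : th < 1).
Implicit Types (f g F G : Sigma m' -> R) (x y : Sigma m') (w : seq (letter m')).

Lemma holder_letter (p : letter m' -> R) :
  holder th (\sum_i `|p i| + \sum_i `|p i|) (fun x : Sigma m' => p (x 0%N)).
Proof.
have ple i : `|p i| <= \sum_i `|p i| by rewrite (bigD1 i)//= lerDl sumr_ge0.
move=> [|k] x y a; last first.
  by rewrite (a 0%N)// subrr normr0 mulr_ge0 ?exprn_ge0 ?(ltW th_gt0)// addr_ge0// sumr_ge0.
by rewrite expr0 mulr1 (le_trans (ler_normB _ _))// lerD.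
Qed.

Lemma pressure_mono C D f g : holder th C f -> holder th D g -> (forall x, f x <= g x) ->
  pressure f <= pressure g.
Proof.
move=> hf hg fg; rewrite -subr_le0.
apply: (@linear_drift_le0 _ (3 * distortion th C + 3 * distortion th D)) => n.
pose x0 : Sigma m' := fun=> ord0.
have /andP[h1 _] := pressure_bound th_gt0 th_lt1 hf n x0.
have /andP[_ h2] := pressure_bound th_gt0 th_lt1 hg n x0.
have h3 : transfer f n (fun=> 1) x0 <= transfer g n (fun=> 1) x0.
  by apply: ler_sum => w _; rewrite !mulr1 ler_expR; apply: ler_sum => k _.
move: h1 h2 h3; move: (pressure f) (pressure g) (transfer f _ _ _) (transfer g _ _ _).
move=> u v a b h1 h2 h3; have := le_trans h1 (le_trans h3 h2).
rewrite ler_expR; lra.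
Qed.

(* The constant word i ... i alone already contributes this much. *)
Lemma pressure_ge_letter C f i b : holder th C f -> (forall x, b <= f (pre i x)) ->
  b <= pressure f.
Proof.
move=> hf fb; rewrite -subr_le0; apply: (@linear_drift_le0 _ (3 * distortion th C)) => n.
pose x0 : Sigma m' := fun=> ord0.
have /andP[_ h1] := pressure_bound th_gt0 th_lt1 hf n x0.
have h2 : expR (n%:R * b) <= transfer f n (fun=> 1) x0.
  rewrite /transfer (bigD1 [tuple of nseq n i])//= ler_wpDr//.
    by apply: sumr_ge0 => w _; rewrite mulr1 expR_ge0.
  rewrite mulr1 ler_expR.
  elim: n {h1} => [|n IH]; first by rewrite birkhoff0 mul0r.
  rewrite birkhoffS -natr1 mulrDl mul1r addrC lerD//; exact: (fb (prep (nseq n i) x0)).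
move: h1 h2; move: (pressure f) (transfer f _ _ _) => u v h1 h2.
by have := le_trans h2 h1; rewrite ler_expR; lra.
Qed.

Variables (C c L : R) (phi : Sigma m' -> R) (p : letter m' -> R).
Hypotheses (hphi : holder th C phi) (c_gt0 : 0 < c).
Hypothesis phi_bounds : forall x, - L <= phi x <= - c.
Let psi : Sigma m' -> R := fun x => p (x 0%N).
Let A := \sum_i `|p i| + \sum_i `|p i|.
Let hpsi : holder th A psi := holder_letter p.

Definition potential2 (t q : R) x := t * phi x + q * psi x.
Definition pressure2 t q := pressure (potential2 t q).

Lemma holder_potential2 (t q : R) : holder th (`|t| * C + `|q| * A) (potential2 t q).
Proof. exact: holder_lin. Qed.

Lemma pressure_shift (t q al : R) :
  pressure (fun x => t * phi x + q * (psi x - al)) = pressure2 t q - q * al.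
Proof.
rewrite -(pressure_addc th_gt0 th_lt1 _ (holder_potential2 t q)); congr pressure.
by apply/funext => x; rewrite /potential2; ring.
Qed.

Lemma pressure_plus (t q a : R) : pressure (fun x => t * phi x + q * psi x + a) = pressure2 t q + a.
Proof. by rewrite -(pressure_addc th_gt0 th_lt1 _ (holder_potential2 t q)). Qed.

Lemma pressure2_slope (t q x : R) : 0 <= x -> pressure2 t q - L * x <= pressure2 (t + x) q <= pressure2 t q - c * x.
Proof.
move=> x0; have hf := holder_potential2 t q; have hf' := holder_potential2 (t + x) q.
have E b : pressure2 t q - b * x = pressure (fun y => potential2 t q y + - (b * x)).
  by rewrite (pressure_addc th_gt0 th_lt1 _ hf).
rewrite !E; apply/andP; split.
  apply: (pressure_mono (holder_addc _ hf) hf') => y.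
  have /andP[h _] := phi_bounds y; have := ler_wpM2r x0 h.
  by rewrite /potential2 mulrDl; lra.
apply: (pressure_mono hf' (holder_addc _ hf)) => y.
have /andP[_ h] := phi_bounds y; have := ler_wpM2r x0 h.
by rewrite /potential2 mulrDl; lra.
Qed.

Lemma L_gt0 : 0 < L.
Proof.
have /andP[h1 h2] := phi_bounds (fun=> ord0); have h3 := c_gt0.
by have := le_trans h1 h2; lra.
Qed.

(** Keeps only the constant word in [i]. Applied to the two extremal letters, it bounds the pressure
    below by lines of slopes lo and hi in [q]. *)
Lemma pressure2_ge_letter (t q : R) i : - `|t| * L + q * p i <= pressure2 t q.
Proof.
apply: (@pressure_ge_letter _ _ i _ (holder_potential2 t q)) => x.
rewrite /potential2 /psi /= lerD2r; have /andP[h1 h2] := phi_bounds (pre i x).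
have [t0|t0] := leP 0 t.
  by have := ler_wpM2l t0 h1; rewrite ger0_norm//; lra.
have := ler_wnM2l (ltW t0) h2; rewrite ltr0_norm// => h3.
have : t * L <= 0 by rewrite mulr_le0_ge0 ?ltW// L_gt0.
have : t * c <= 0 by rewrite mulr_le0_ge0 ?ltW.
by lra.
Qed.

Lemma pressure2_support t q : exists a1 a2, [/\ a1 <= - c,
  forall x y : R, pressure2 t q + a1 * x + a2 * y <= pressure2 (t + x) (q + y),
  exists2 C2, 0 < C2 & forall x y : R, (`|x| + `|y|) * C2 <= 1 ->
    pressure2 (t + x) (q + y) <= pressure2 t q + a1 * x + a2 * y + C2 * (`|x| + `|y|) ^+ 2
  & forall (y : R) i, y != 0 -> p i != a2 -> pressure2 t q + a2 * y < pressure2 t (q + y)].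
Proof.
have hf := holder_potential2 t q.
have [a [alin acst alow aup astrict]] := pressure_perturbation th_gt0 th_lt1 hf.
have famE (x y : R) : potential2 (t + x) (q + y) = fun z => potential2 t q z + (x * phi z + y * psi z).
  by apply/funext => z; rewrite /potential2; ring.
have low (x y : R) : pressure2 t q + a phi * x + a psi * y <= pressure2 (t + x) (q + y).
  have := alow _ _ (holder_lin x y hphi hpsi); rewrite (alin _ _ x y _ _ hphi hpsi).
  by rewrite /pressure2 famE [a phi * x]mulrC [a psi * y]mulrC addrA.
exists (a phi), (a psi); split => //.
- have := low 1 0; have /andP[_] := pressure2_slope t q ler01.
  rewrite addr0; move: (pressure2 t q) (pressure2 (t + 1) q) (a phi) (a psi) => u v b d.
  by lra.
- have [C2 C20 HC2] := aup (C + A); exists C2 => // x y xy.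
  have [xy0|xy0] := eqVneq (`|x| + `|y|) 0.
    have : `|x| + `|y| <= 0 by rewrite xy0.
    have [x0 y0] : x = 0 /\ y = 0.
      by split; apply/normr0_eq0/eqP; rewrite eq_le normr_ge0 andbT;
         have := normr_ge0 x; have := normr_ge0 y; lra.
    by rewrite x0 y0 !addr0 !normr0 !mulr0 addr0 expr0n mulr0 !addr0.
  set v := `|x| + `|y| in xy xy0 *.
  have v0 : 0 < v by rewrite lt0r xy0 addr_ge0.
  (* Normalised direction: its Hölder constant is at most C + A, so one [C2] serves for all
     directions. *)
  pose G z := (x / v) * phi z + (y / v) * psi z.
  have hG : holder th (C + A) G.
    apply: (holderW th_gt0 _ (holder_lin (x / v) (y / v) hphi hpsi)).
    have C0 := holder_ge0 hphi; have A0 := holder_ge0 hpsi.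
    rewrite !normrM !normfV (gtr0_norm v0) lerD// ler_piMl// ler_pdivrMr// mul1r.
      by rewrite /v lerDl.
    by rewrite /v lerDr.
  have := HC2 G v hG; rewrite (gtr0_norm v0) => /(_ xy).
  have -> : (fun z => potential2 t q z + v * G z) = potential2 (t + x) (q + y).
    by rewrite famE; apply/funext => z; rewrite /G; field.
  rewrite -/(pressure2 t q) -/(pressure2 (t + x) (q + y)) (alin _ _ (x / v) (y / v) _ _ hphi hpsi) => h.
  apply: (le_trans h); move: (pressure2 t q) (a phi) (a psi) => u b d.
  by rewrite le_eqVlt; apply/orP; left; apply/eqP; field.
move=> y i y0 pa.
have hy : holder th (`|y| * A) (fun z => y * psi z) := holder_scale y hpsi.
have ay : a (fun z => y * psi z) = y * a psi.
  have := alin _ _ y 0 _ _ hpsi hpsi; rewrite mul0r addr0 => <-.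
  by congr a; apply/funext => z; rewrite mul0r addr0.
have := astrict _ _ i (y * p i) hy (fun z => erefl); rewrite ay => h.
have -> : pressure2 t (q + y) = pressure (fun x => potential2 t q x + y * psi x).
  by congr pressure; apply/funext => z; rewrite /potential2; ring.
rewrite [a psi * y]mulrC; apply: h => /(mulfI y0) e.
by move: pa; rewrite e eqxx.
Qed.

End TwoParameterPressure.

(** * Zeros, slopes and minimisers of a convex two-parameter family *)

Section RealLemmas.
Context {R : realType}.

Lemma near_dist_le (x e : R) : 0 < e -> \forall s \near x, `|x - s| <= e.
Proof. by move=> e0; move/cvgrPdist_le: (@cvg_id _ (nbhs x)) => /(_ e e0). Qed.

(** The upper slope makes g Lipschitz, hence continuous; the lower one forces a sign change between
    -|g 0| / c and |g 0| / c. *)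
Lemma slope_zero (g : R -> R) (c L : R) : 0 < c ->
  (forall t x, 0 <= x -> g t - L * x <= g (t + x) <= g t - c * x) ->
  exists t0, g t0 = 0.
Proof.
move=> c0 H.
have L0 : 0 <= L by have := H 0 1 ler01; lra.
have cg : continuous g.
  move=> t; apply/cvgrPdist_le => e e0; near=> s.
  have st : `|s - t| * (L + 1) <= e.
    rewrite -ler_pdivlMr; last by lra.
    rewrite distrC; near: s; apply: near_dist_le; rewrite divr_gt0//; lra.
  have key u x : 0 <= x -> x * (L + 1) <= e -> `|g (u + x) - g u| <= e.
    move=> x0 xe; have /andP[h1 h2] := H u x x0; rewrite ler_norml.
    have : 0 <= c * x by rewrite mulr_ge0// ltW.
    lra.
  have [ts|ts] := leP t s.
    rewrite distrC -[s](subrKC t); apply: key; first by rewrite subr_ge0.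
    by rewrite -[s - t]ger0_norm// subr_ge0.
  rewrite -[t](subrKC s); apply: key; first by rewrite subr_ge0 ltW.
  by rewrite -[t - s]ger0_norm ?subr_ge0 1?distrC// ltW.
have cw a b : {within `[a, b], continuous g} by apply: continuous_subspaceT.
pose x := `|g 0| / c.
have x0 : 0 <= x by rewrite divr_ge0// ltW.
have cx : c * x = `|g 0| by rewrite mulrC divfK// gt_eqF.
have h1 : g x <= 0.
  have /andP[_] := H 0 x x0; rewrite add0r cx; have := ler_norm (g 0); lra.
have h2 : 0 <= g (- x).
  have /andP[_] := H (- x) x x0; rewrite addNr cx; have := ler_norm (- g 0).
  rewrite normrN; lra.
have xx : - x <= x by lra.
have mm : Num.min (g (- x)) (g x) <= 0 <= Num.max (g (- x)) (g x).
  by rewrite ge_min le_max h1 h2 orbT.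
by have [t0 _ gt0] := IVT xx (cw (- x) x) mm; exists t0.
Unshelve. all: by end_near. Qed.

Lemma quadratic_is_derive (g : R -> R) (q a C : R) : 0 < C ->
  (forall y, `|y| * C <= 1 -> `|g (q + y) - g q - a * y| <= C * y ^+ 2) ->
  is_derive q 1 g a.
Proof.
move=> C0 H.
have cv : h^-1 *: ((g \o shift q) (h *: 1) - g q) @[h --> 0^'] --> a.
  apply/cvgrPdist_le => e e0; near=> h.
  have h0 : h != 0 by near: h; exact: nbhs_dnbhs_neq.
  have hC : `|h| * C <= Num.min 1 e.
    rewrite -ler_pdivlMr//; near: h; apply: nbhs_dnbhs.
    have e1 : 0 < Num.min 1 e / C by rewrite divr_gt0// lt_min ltr01.
    by have := near_dist_le 0 e1; apply: filterS => z; rewrite sub0r normrN.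
  move: hC; rewrite le_min => /andP[h1 h2].
  rewrite /= /shift /= [h *: 1]mulr1 [h + q]addrC.
  have -> : a - h^-1 *: (g (q + h) - g q) = - (h^-1 * (g (q + h) - g q - a * h)).
    by rewrite mulrBr mulrCA mulVf// mulr1 opprB.
  rewrite normrN normrM normfV ler_pdivrMl ?normr_gt0//.
  apply: (le_trans (H h h1)).
  by rewrite -[h ^+ 2]ger0_norm ?sqr_ge0// normrX expr2 mulrA mulrC ler_wpM2l// mulrC.
apply: DeriveDef; first by apply/cvg_ex; exists a.
exact: cvg_lim cv.
Unshelve. all: by end_near. Qed.

(** First-order condition without derivatives: test a small y with the sign of b. It identifies
    slopes both at a minimum and between a supporting line and a quadratic majorant. *)
Lemma linear_le_quadratic (b C : R) : 0 < C ->
  (forall y, `|y| * C <= 1 -> b * y <= C * y ^+ 2) -> b = 0.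
Proof.
move=> C0 H; apply/eqP; rewrite -normr_le0 leNgt; apply/negP => b0.
pose e := Num.min 1 (`|b| / 2) / C.
have e0 : 0 < e by rewrite divr_gt0// lt_min ltr01 divr_gt0.
have eC : e * C = Num.min 1 (`|b| / 2) by rewrite divfK// gt_eqF.
have bN0 : b != 0 by rewrite -normr_gt0.
clearbody e.
have := H (Num.sg b * e).
rewrite normrM normr_sg bN0 mul1r (gtr0_norm e0) eC ge_min lexx => /(_ isT).
rewrite mulrA [b * _]mulrC -normrEsg exprMn sqr_sg bN0 mul1r.
rewrite expr2 mulrA [C * e]mulrC ler_pM2r// eC le_min => /andP[_].
lra.
Qed.

End RealLemmas.

Section ConvexFamily.
Context {R : realType}.
Variables (P : R -> R -> R) (c L lo hi : R).
Hypotheses (c_gt0 : 0 < c) (lohi : lo <= hi).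
Hypothesis P_slope : forall t q x, 0 <= x -> P t q - L * x <= P (t + x) q <= P t q - c * x.
Hypothesis P_lo : forall t q, - `|t| * L + q * lo <= P t q.
Hypothesis P_hi : forall t q, - `|t| * L + q * hi <= P t q.

(** (a1, a2) acts as the gradient of P at (t, q). Strictness is conditional on lo < hi, because for
    constant psi the pressure is affine in q. *)
Definition quadratic_support t q a1 a2 C :=
  [/\ 0 < C, a1 <= - c, (forall x y, P t q + a1 * x + a2 * y <= P (t + x) (q + y)),
    (forall x y, (`|x| + `|y|) * C <= 1 ->
      P (t + x) (q + y) <= P t q + a1 * x + a2 * y + C * (`|x| + `|y|) ^+ 2)
  & lo < hi -> forall y, y != 0 -> P t q + a2 * y < P t (q + y)].

Hypothesis P_support : forall t q, exists a1 a2 C, quadratic_support t q a1 a2 C.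

Lemma P_strict t u x : 0 < x -> P (t + x) u < P t u.
Proof.
move=> x0; have /andP[_ h] := P_slope t u (ltW x0); apply: (le_lt_trans h).
by rewrite gtrBl mulr_gt0.
Qed.

Lemma P_q_derive t q a1 a2 C : quadratic_support t q a1 a2 C -> is_derive q 1 (P t) a2.
Proof.
move=> [C0 _ low up _]; apply: (quadratic_is_derive C0) => y yC.
have := low 0 y; have := up 0 y; rewrite normr0 add0r addr0 mulr0 addr0 => /(_ yC).
rewrite -[y ^+ 2]ger0_norm ?sqr_ge0// normrX => h1 h2.
have : 0 <= C * `|y| ^+ 2 by rewrite mulr_ge0 ?sqr_ge0// ltW.
by rewrite ler_norml; lra.
Qed.

Lemma P_q_derive_shift t q al a1 a2 C : quadratic_support t q a1 a2 C ->
  is_derive q 1 (fun v => P t v - v * al) (a2 - al).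
Proof.
move=> /P_q_derive h.
have -> : (fun v => P t v - v * al) = P t - (fun v : R => v * al) by [].
apply: is_deriveB.
have -> : (fun v : R => v * al) = al \*: (id : R -> R).
  by apply/funext => v /=; rewrite mulrC.
by apply: is_derive_eq; rewrite scaler1.
Qed.

Lemma support_critical t q a1 al C : quadratic_support t q a1 al C ->
  forall v, `|v| * C <= 1 -> P t (q + v) - (q + v) * al <= P t q - q * al + C * v ^+ 2.
Proof.
move=> [C0 _ _ up _] v vC; have := up 0 v.
rewrite normr0 add0r addr0 mulr0 addr0 => /(_ vC).
have -> : `|v| ^+ 2 = v ^+ 2 by rewrite -normrX ger0_norm ?sqr_ge0.
lra.
Qed.

(* The quantity characterising the Poincare exponent as its zero in t. *)
Definition tilted_inf al t := inf [set P t q - q * al | q in [set: R]].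

Section Level.
Variable al : R.
Hypothesis al_lohi : lo <= al <= hi.

Lemma tilted_ge t q : - `|t| * L <= P t q - q * al.
Proof.
case/andP: al_lohi => h1 h2; have [q0|q0] := leP 0 q.
  by have := P_hi t q; have := ler_wpM2l q0 h2; lra.
by have := P_lo t q; have := ler_wnM2l (ltW q0) h1; lra.
Qed.

Lemma tilted_inf_le t q : tilted_inf al t <= P t q - q * al.
Proof.
apply: ge_inf; last by exists q.
by exists (- `|t| * L) => _ [r _ <-]; exact: tilted_ge.
Qed.

Lemma tilted_inf_ge t b : (forall q, b <= P t q - q * al) -> b <= tilted_inf al t.
Proof.
move=> H; apply: lb_le_inf; first by exists (P t 0 - 0 * al), 0.
by move=> _ [q _ <-].
Qed.

Lemma tilted_inf_slope t x : 0 <= x ->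
  tilted_inf al t - L * x <= tilted_inf al (t + x) <= tilted_inf al t - c * x.
Proof.
move=> x0; apply/andP; split.
  apply: tilted_inf_ge => q; have := tilted_inf_le t q.
  by have /andP[] := P_slope t q x0; lra.
rewrite lerBrDr; apply: tilted_inf_ge => q; have := tilted_inf_le (t + x) q.
by have /andP[] := P_slope t q x0; lra.
Qed.

(** The slope bounds in t are uniform in q and so pass to the infimum, giving existence and
    uniqueness of the zero. It is nonnegative since the infimum is nonnegative at t = 0 by
    [tilted_ge]. *)
Lemma tilted_inf_zero : exists2 d, 0 <= d &
  [/\ forall t, tilted_inf al t = 0 <-> t = d,
      forall t, t < d -> 0 < tilted_inf al t & forall t, d < t -> tilted_inf al t < 0].
Proof.
have [d gd] := slope_zero c_gt0 tilted_inf_slope.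
have lt_d t : t < d -> 0 < tilted_inf al t.
  move=> td; have := tilted_inf_slope t (x := d - t); rewrite subrKC gd subr_ge0.
  move=> /(_ (ltW td)) /andP[_ h]; have : 0 < c * (d - t) by rewrite mulr_gt0// subr_gt0.
  lra.
have gt_d t : d < t -> tilted_inf al t < 0.
  move=> td; have := tilted_inf_slope d (x := t - d); rewrite subrKC gd subr_ge0.
  move=> /(_ (ltW td)) /andP[_ h]; have : 0 < c * (t - d) by rewrite mulr_gt0// subr_gt0.
  lra.
exists d; last split => // t; last split=> [t0|-> //].
  rewrite leNgt; apply/negP => /gt_d; apply/negP; rewrite -leNgt.
  by apply: tilted_inf_ge => q; have := tilted_ge 0 q; rewrite normr0 oppr0 mul0r.
by case: (ltgtP t d) => // [/lt_d|/gt_d]; rewrite t0 ltxx.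
Qed.

End Level.

Section InteriorLevel.
Variable al : R.
Hypothesis al_lohi : lo < al < hi.

Let al_le : lo <= al <= hi. Proof. by case/andP: al_lohi => /ltW-> /ltW->. Qed.
Let lo_lt_hi : lo < hi. Proof. by case/andP: al_lohi; exact: lt_trans. Qed.

(** For al strictly inside, the lower bounds of slopes lo and hi make the function grow at least
    like eta |q|. [B] is chosen so that outside [-B, B] it exceeds its value at 0. *)
Lemma tilted_argmin t : exists q, forall u, P t q - q * al <= P t u - u * al.
Proof.
case/andP: al_lohi => h1 h2.
pose eta := Num.min (al - lo) (hi - al).
have eta0 : 0 < eta by rewrite lt_min !subr_gt0 h1 h2.
have eta1 : eta <= al - lo by rewrite ge_min lexx.
have eta2 : eta <= hi - al by rewrite ge_min lexx orbT.
have coer q : - `|t| * L + `|q| * eta <= P t q - q * al.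
  have [q0|q0] := leP 0 q.
    rewrite (ger0_norm q0).
    by have := P_hi t q; have := ler_wpM2l q0 eta2; lra.
  rewrite (ltr0_norm q0); have q0' : 0 <= - q by rewrite oppr_ge0 ltW.
  by have := P_lo t q; have := ler_wpM2l q0' eta1; lra.
pose B := (`|P t 0| + `|t| * L) / eta.
have hB0 := coer 0; rewrite normr0 mul0r addr0 mul0r subr0 in hB0.
have B0 : 0 <= B.
  rewrite divr_ge0 ?(ltW eta0)//; have := ler_norm (P t 0); lra.
have BB : - B <= B by lra.
have cont : {within `[- B, B], continuous (fun q => P t q - q * al)}.
  apply: continuous_subspaceT => q; have [a1 [a2 [C hC]]] := P_support t q.
  have := P_q_derive_shift al hC => -[d _].
  exact/differentiable_continuous/derivable1_diffP.
have [q qB hq] := EVT_min BB cont; exists q => u.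
have [uB|uB] := leP `|u| B.
  by apply: hq; rewrite in_itv/= -ler_norml.
have h00 : P t q - q * al <= P t 0.
  by have := hq 0; rewrite in_itv/= oppr_le0 B0 mul0r subr0; apply.
apply: (le_trans h00); apply: le_trans (coer u).
have : B * eta <= `|u| * eta by rewrite ler_wpM2r// ltW// ltW.
rewrite divfK ?gt_eqF//; have := ler_norm (P t 0); lra.
Qed.

Lemma tilted_inf_attained t : exists q, tilted_inf al t = P t q - q * al.
Proof.
have [q hq] := tilted_argmin t; exists q; apply/eqP; rewrite eq_le tilted_inf_le//.
exact: tilted_inf_ge.
Qed.

Lemma argmin_slope t q a1 a2 C : quadratic_support t q a1 a2 C ->
  (forall u, P t q - q * al <= P t u - u * al) -> a2 = al.
Proof.
move=> [C0 _ _ up _] hq; apply/eqP; rewrite -subr_eq0; apply/eqP.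
suff : - (a2 - al) = 0 by move/eqP; rewrite oppr_eq0 => /eqP.
apply: (linear_le_quadratic C0) => y yC.
have := up 0 y; rewrite normr0 add0r addr0 mulr0 addr0 => /(_ yC).
rewrite -[y ^+ 2]ger0_norm ?sqr_ge0// normrX.
by have := hq (q + y); lra.
Qed.

(** At a critical pair the supporting line in q is horizontal, so the infimum is attained there and
    equals 0. This forces t = d, and strictness then excludes a second minimiser. *)
Lemma critical_point d : (forall t, tilted_inf al t = 0 <-> t = d) ->
  exists q, forall t u,
    (P t u - u * al = 0 /\ is_derive u 1 (fun v => P t v - v * al) 0) <->
    (t = d /\ u = q).
Proof.
move=> Hd; have [q hq] := tilted_inf_attained d.
have hqd : P d q - q * al = 0 by rewrite -hq; apply/Hd.
have hmin u : P d q - q * al <= P d u - u * al by rewrite -hq; exact: tilted_inf_le.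
exists q => t u; split=> [[Ptu dtu]|[-> ->]].
  have [a1 [a2 [C hC]]] := P_support t u.
  have a2al : a2 = al.
    have hd := P_q_derive_shift al hC.
    have e1 : 'D_1 (fun v => P t v - v * al) u = a2 - al by exact: derive_val.
    have e2 : 'D_1 (fun v => P t v - v * al) u = 0 by exact: derive_val.
    by apply/eqP; rewrite -subr_eq0 -e1 e2.
  have [_ _ low _ str] := hC.
  have td : t = d.
    apply/Hd/eqP; rewrite eq_le; apply/andP; split.
      by have := tilted_inf_le al_le t u; rewrite Ptu.
    apply: tilted_inf_ge => // v; have := low 0 (v - u).
    by rewrite addr0 subrKC mulr0 addr0 a2al; lra.
  split=> //; apply/eqP; apply: contraT => uq.
  have := str lo_lt_hi (q - u); rewrite subr_eq0 eq_sym uq => /(_ isT).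
  by rewrite subrKC a2al; move: hqd Ptu; rewrite td; lra.
split => //; have [a1 [a2 [C hC]]] := P_support d q.
have e := argmin_slope hC hmin.
by have := P_q_derive_shift al hC; rewrite e subrr.
Qed.

End InteriorLevel.
End ConvexFamily.

(** * The implicit surface and its sections by lines through the origin *)

Section QuadraticDifferentiability.
Context {R : realType}.

Lemma quadratic_differentiable (V W : normedModType R) (s : V -> W)
    (df : {linear V -> W}) (p : V) (D : R) : continuous df -> 0 < D ->
  (forall h : V, `|h| * D <= 1 -> `|s (h + p) - (s p + df h)| <= D * `|h| ^+ 2) ->
  differentiable s p /\ 'd s p = df :> (V -> W).
Proof.
move=> dfc D0 H.
have so : s \o shift p = cst (s p) + df +o_ 0 id.
  apply/eqaddoP => _/posnumP[e].
  have e1 : 0 < Num.min 1 e%:num / D by rewrite divr_gt0// lt_min ltr01/=.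
  have : \forall h \near nbhs (nbhs_filter_on (0 : V)), `|h| < Num.min 1 e%:num / D.
    exact: nbhs0_lt.
  apply: filterS => h /ltW; rewrite ler_pdivlMr// => h1.
  move: h1; rewrite le_min => /andP[h1 h2].
  apply: (le_trans (H h h1)).
  by rewrite expr2 mulrA ler_wpM2r// mulrC.
have dE := diff_unique dfc so.
by split; last exact: dE; apply/diff_locallyP; rewrite dE.
Qed.

Lemma quadratic_differentiable2 (s : R * R -> R) (p : R * R) (b1 b2 D : R) : 0 < D ->
  (forall h : R * R, (`|h.1| + `|h.2|) * D <= 1 ->
     `|s (p + h) - s p - (b1 * h.1 + b2 * h.2)| <= D * (`|h.1| + `|h.2|) ^+ 2) ->
  differentiable s p /\ forall h, 'd s p h = b1 * h.1 + b2 * h.2.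
Proof.
move=> D0 H; pose df (h : R * R) : R := b1 * h.1 + b2 * h.2.
have dfl : linear df.
  by move=> k u v; rewrite /df /= /GRing.scale /=; ring.
pose dfL : {linear (R * R)%type -> R} := HB.pack df (GRing.isLinear.Build _ _ _ _ _ dfl).
have dfc : continuous dfL.
  move=> h; apply: cvgD; apply: cvgMl_tmp; [exact: cvg_fst|exact: cvg_snd].
(* The norm of the product is the maximum norm; the sum of the coordinates is at most twice it, and
   squaring gives the factor 4. *)
have [|h hh|dd dE] := quadratic_differentiable (s := s) (p := p) (D := 4 * D) dfc.
- by rewrite mulr_gt0.
- have n1 : `|h.1| <= `|h| by rewrite prod_normE le_max lexx.
  have n2 : `|h.2| <= `|h| by rewrite prod_normE le_max lexx orbT.
  set nh : R := `|h| in n1 n2 hh *.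
  have nh0 : 0 <= nh by exact: normr_ge0.
  have key : (`|h.1| + `|h.2|) * D <= 2 * nh * D.
    by rewrite ler_wpM2r ?(ltW D0)//; lra.
  have nD : 0 <= nh * D by rewrite mulr_ge0// ltW.
  have := H h; rewrite [p + h]addrC => /(_ ltac:(lra)) Hh.
  rewrite opprD addrA; apply: (le_trans Hh).
  have q : (`|h.1| + `|h.2|) ^+ 2 <= (2 * nh) ^+ 2.
    by rewrite lerXn2r ?nnegrE ?addr_ge0 ?mulr_ge0//; lra.
  apply: (le_trans (ler_wpM2l (ltW D0) q)).
  by rewrite exprMn mulrA -natrX [D * _]mulrC.
by split=> // h; rewrite dE.
Qed.

End QuadraticDifferentiability.

Section ImplicitSurface.
Context {R : realType}.
Variables (P : R -> R -> R) (c L lo hi : R).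
Hypotheses (c_gt0 : 0 < c) (lohi : lo <= hi).
Hypothesis P_slope : forall t q x, 0 <= x -> P t q - L * x <= P (t + x) q <= P t q - c * x.
Hypothesis P_lo : forall t q, - `|t| * L + q * lo <= P t q.
Hypothesis P_hi : forall t q, - `|t| * L + q * hi <= P t q.
Hypothesis P_support : forall t q, exists a1 a2 C, quadratic_support P c lo hi t q a1 a2 C.

Lemma implicit_surface : exists s : R * R -> R, forall q a t,
  P t q + a = 0 <-> t = s (q, a).
Proof.
have ex (p : R * R) : exists t, P t p.1 + p.2 = 0.
  by apply: (@slope_zero _ (fun t => P t p.1 + p.2) c L c_gt0) => t x /(P_slope t p.1); lra.
exists (fun p => projT1 (cid (ex p))) => q a t.
case: cid => t0 /= h0; split=> [h|->//].
case: (ltgtP t t0) => // tt.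
  have := P_strict c_gt0 P_slope t q (x := t0 - t); rewrite subr_gt0 subrKC => /(_ tt); lra.
have := P_strict c_gt0 P_slope t0 q (x := t - t0); rewrite subr_gt0 subrKC => /(_ tt); lra.
Qed.

Variable s : R * R -> R.
Hypothesis sP : forall q a t, P t q + a = 0 <-> t = s (q, a).

Lemma surface_eq q a : P (s (q, a)) q + a = 0. Proof. exact/sP. Qed.

(* b1 / b2 is the derivative of P in q at the corresponding point. *)
Lemma surface_support q a a1 a2 C : quadratic_support P c lo hi (s (q, a)) q a1 a2 C ->
  let b2 := (- a1)^-1 in let b1 := a2 * b2 in
  [/\ 0 < b2, forall y z, s (q, a) + b1 * y + b2 * z <= s (q + y, a + z) &
    exists2 D, 0 < D & forall y z, (`|y| + `|z|) * D <= 1 ->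
     s (q + y, a + z) <= s (q, a) + b1 * y + b2 * z + D * (`|y| + `|z|) ^+ 2].
Proof.
move=> [C0 a1c low up _] b2 b1; set t := s (q, a) in low up *.
have Pt : P t q + a = 0 by exact: surface_eq.
have c0 := c_gt0; have a10 : 0 < - a1 by lra.
have b20 : 0 < b2 by rewrite invr_gt0.
have ab2 : - a1 * b2 = 1 by rewrite divff// gt_eqF.
have Pt' y z : P (s (q + y, a + z)) (q + y) + (a + z) = 0 by exact: surface_eq.
(* As -a1 > 0, a first-order inequality for P at an increment x of t becomes a bound on x by
   division. *)
have div x y z : x * - a1 <= a2 * y + z -> x <= b1 * y + b2 * z.
  rewrite -ler_pdivlMr// => /le_trans; apply; rewrite -/b2 /b1.
  by rewrite le_eqVlt; apply/orP; left; apply/eqP; ring.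
split=> //.
  move=> y z; have := low (s (q + y, a + z) - t) y; rewrite subrKC => h.
  have := Pt' y z => h'.
  have hd : (- (s (q + y, a + z) - t)) * - a1 <= a2 * - y + - z by lra.
  by have := div _ _ _ hd; lra.
(* Local Lipschitz constant: t-slopes of size at least c bound |x| by ((|a2| + 1) |y| + |z|) / c,
   and the last 1 accounts for |y|. In [D], the term C K keeps the increments where the quadratic
   bound on P is valid, and C K^2 b2 is that error divided by -a1. *)
pose K := (`|a2| + 1) / c + 1 / c + 1.
have K1 : 1 <= K by rewrite lerDr addr_ge0// divr_ge0 ?addr_ge0// ltW.
have K0 : 0 < K by exact: lt_le_trans K1.
pose D := C * K + C * K ^+ 2 * b2.
have CK : 0 < C * K by rewrite mulr_gt0.
have CKb : 0 < C * K ^+ 2 * b2 by rewrite !mulr_gt0// exprn_gt0.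
exists D; first by rewrite addr_gt0.
move=> y z yz; set N := `|y| + `|z| in yz *.
have N0 : 0 <= N by rewrite addr_ge0.
have yN : `|y| <= N by rewrite lerDl.
have NCK : N * (C * K) <= 1.
  by have : 0 <= N * (C * K ^+ 2 * b2); [rewrite mulr_ge0// ltW|move: yz; rewrite /D mulrDr; lra].
have yC : `|y| * C <= 1.
  have h1 := ler_wpM2r (ltW C0) yN.
  have h2 : 0 <= N * C * (K - 1) by rewrite !mulr_ge0 ?subr_ge0// ltW.
  apply: (le_trans h1); apply: le_trans NCK; rewrite -subr_ge0.
  by have -> : N * (C * K) - N * C = N * C * (K - 1) by ring.
set x := s (q + y, a + z) - t.
have Px : P (t + x) (q + y) = - (a + z) by rewrite /x subrKC; have := Pt' y z; lra.
have Py : `|P t (q + y) - P t q| <= (`|a2| + 1) * `|y|.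
  have := low 0 y; have := up 0 y; rewrite normr0 add0r addr0 mulr0 addr0 => /(_ yC) h1 h2.
  have : `|a2 * y| = `|a2| * `|y| by exact: normrM.
  have : C * `|y| ^+ 2 <= `|y| by rewrite expr2 mulrA mulrC [C * _]mulrC ler_piMr.
  have := ler_norm (a2 * y); have := ler_norm (- (a2 * y)); rewrite normrN ler_norml; lra.
have xK : `|x| <= (`|a2| + 1) / c * `|y| + 1 / c * `|z|.
  have e : `|- (a + z) - P t (q + y)| <= (`|a2| + 1) * `|y| + `|z|.
    have -> : - (a + z) - P t (q + y) = - (P t (q + y) - P t q) - z by lra.
    by rewrite (le_trans (ler_normB _ _))// lerD2r normrN.
  suff : c * `|x| <= `|- (a + z) - P t (q + y)|.
    move=> h; have := le_trans h e; rewrite mulrC -ler_pdivlMr// => /le_trans; apply.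
    by rewrite le_eqVlt; apply/orP; left; apply/eqP; ring.
  rewrite -Px; have [x0|x0] := leP 0 x.
    have /andP[_] := P_slope t (q + y) x0; rewrite (ger0_norm x0) distrC => h.
    apply: le_trans (ler_norm _); lra.
  have x0' : 0 <= - x by rewrite oppr_ge0 ltW.
  have /andP[_] := P_slope (t + x) (q + y) x0'; rewrite addrK (ltr0_norm x0) => h.
  apply: le_trans (ler_norm _); lra.
have xyN : `|x| + `|y| <= K * N.
  have i0 : 0 <= c^-1 by rewrite invr_ge0 ltW.
  have w1 : 0 <= (`|a2| + 1) / c by rewrite mulr_ge0// addr_ge0.
  have w2 : 0 <= (`|a2| + 1) / c * `|z| by rewrite mulr_ge0.
  have w3 : 0 <= 1 / c * `|y| by rewrite mulr_ge0// mul1r.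
  have : 0 <= `|z| by [].
  rewrite /K /N; lra.
have xyC : (`|x| + `|y|) * C <= 1.
  by apply: le_trans NCK; have := ler_wpM2r (ltW C0) xyN; lra.
have := up x y xyC; rewrite Px => h.
have sq : (`|x| + `|y|) ^+ 2 <= (K * N) ^+ 2.
  by rewrite lerXn2r ?nnegrE ?addr_ge0 ?mulr_ge0// ltW.
have := ler_wpM2l (ltW C0) sq; rewrite exprMn => sq'.
have := div x y (z + C * (K ^+ 2 * N ^+ 2)) ltac:(lra).
have : 0 <= C * K * N ^+ 2 by rewrite mulr_ge0 ?sqr_ge0// ltW.
rewrite /D /x; lra.
Qed.

Lemma surface_differentiable q a a1 a2 C : quadratic_support P c lo hi (s (q, a)) q a1 a2 C ->
  differentiable s (q, a) /\ gradient s (q, a) = (a2 / - a1, (- a1)^-1).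
Proof.
move=> /surface_support [b20 low [D D0 up]].
have [|dd dE] := @quadratic_differentiable2 _ s (q, a) (a2 / - a1) (- a1)^-1 D D0.
  move=> [y z] /= yz; have := low y z; have := up y z yz.
  have -> : (q, a) + (y, z) = (q + y, a + z) by [].
  have : 0 <= D * (`|y| + `|z|) ^+ 2 by rewrite mulr_ge0 ?sqr_ge0// ltW.
  by rewrite ler_norml; lra.
by split=> //; rewrite /gradient !dE /= !mulr1 !mulr0 addr0 add0r.
Qed.

(** Average the supporting plane at the intermediate point over the two end points. *)
Lemma surface_convex : @convex_function R (R^o * R^o)%type setT s.
Proof.
move=> k [q1 z1] [q2 z2] _ _; rewrite convRE /unstable.onem.
pose q := k%:num * q1 + (1 - k%:num) * q2; pose z := k%:num * z1 + (1 - k%:num) * z2.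
rewrite [leLHS](_ : _ = s (q, z))//.
have [a1 [a2 [C hC]]] := P_support (s (q, z)) q.
have [_ low _] := surface_support hC.
have := low (q1 - q) (z1 - z); have := low (q2 - q) (z2 - z); rewrite !subrKC.
have k0 : 0 <= k%:num by [].
have k1 : 0 <= (1 - k%:num) by rewrite subr_ge0.
move=> /(ler_wpM2l k1) h2 /(ler_wpM2l k0) h1.
have := lerD h1 h2; apply: le_trans.
rewrite le_eqVlt; apply/orP; left; apply/eqP; rewrite /q /z; ring.
Qed.

End ImplicitSurface.

Section SurfaceLine.
Context {R : realType}.
Variables (P : R -> R -> R) (c L lo hi : R).
Hypotheses (c_gt0 : 0 < c) (lohi : lo <= hi).
Hypothesis P_slope : forall t q x, 0 <= x -> P t q - L * x <= P (t + x) q <= P t q - c * x.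
Hypothesis P_lo : forall t q, - `|t| * L + q * lo <= P t q.
Hypothesis P_hi : forall t q, - `|t| * L + q * hi <= P t q.
Hypothesis P_support : forall t q, exists a1 a2 C, quadratic_support P c lo hi t q a1 a2 C.
Variable s : R * R -> R.
Hypothesis sP : forall q a t, P t q + a = 0 <-> t = s (q, a).

(** On the line, s(r, - al r) is the zero in t of P t r - r al, hence at least d, with equality at
    the minimiser q. The gradient there is (a2, 1) / (- a1); orthogonality to (1, - al) means a2 =
    al, the critical point equation. The tangent plane is then constant along the line and meets the
    axis at the same height d. *)
Lemma surface_line al d : lo < al < hi ->
  (forall t, tilted_inf P al t = 0 <-> t = d) -> (forall t, t < d -> 0 < tilted_inf P al t) ->
  [/\ d%:E = (- ereal_inf [set legendre s (al * r, r)%R | r in [set: R]])%E,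
      d%:E = ereal_inf [set (s (r, - al * r))%:E | r in [set: R]]
    & exists r : R,
      [/\ forall r' : R, gradient_perp s (r', - al * r') (line (- al)) <-> r' = r,
          s (r, - al * r) = d
        & tangent_plane s (r, - al * r) `&` height_axis = [set ((0, 0), d)]]].
Proof.
move=> alI Hd Hlt; have al_le : lo <= al <= hi by case/andP: alI => /ltW-> /ltW->.
have [q Hq] := critical_point P_lo P_hi P_support alI Hd.
have [Pdq ddq] : P d q - q * al = 0 /\ is_derive q 1 (fun v => P d v - v * al) 0 by apply/Hq.
have sq : s (q, - al * q) = d by apply/esym/sP; rewrite mulNr mulrC.
have sge r : d <= s (r, - al * r).
  rewrite leNgt; apply/negP => /Hlt; have := tilted_inf_le P_lo P_hi al_le (s (r, - al * r)) r.
  have := surface_eq sP r (- al * r); lra.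
have slope_al r a1 a2 C : quadratic_support P c lo hi (s (r, - al * r)) r a1 a2 C ->
    a2 = al <-> r = q.
  move=> hC; have hd := P_q_derive_shift al hC.
  have Pr : P (s (r, - al * r)) r - r * al = 0.
    by have := surface_eq sP r (- al * r); rewrite mulNr mulrC.
  split=> [e|rq].
    by have [] : s (r, - al * r) = d /\ r = q; [apply/Hq; rewrite e subrr in hd|].
  rewrite rq sq in hd.
  have e1 : 'D_1 (fun v => P d v - v * al) q = a2 - al by exact: derive_val.
  have e2 : 'D_1 (fun v => P d v - v * al) q = 0 by exact: derive_val.
  by apply/eqP; rewrite -subr_eq0 -e1 e2.
have [a1 [a2 [C hC]]] := P_support (s (q, - al * q)) q.
have a2al : a2 = al by apply/(slope_al _ _ _ _ hC).
have [b20 low _] := surface_support c_gt0 P_slope sP hC.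
have [dif gr] := surface_differentiable c_gt0 P_slope sP hC.
set b2 := (- a1)^-1 in b20 low gr.
have infd : d%:E = ereal_inf [set (s (r, - al * r))%:E | r in [set: R]].
  apply/eqP; rewrite eq_le; apply/andP; split.
    by apply: le_ereal_inf_tmp => _ [r _ <-]; rewrite lee_fin.
  by apply: ereal_inf_lbound; exists q => //; rewrite sq.
split=> //.
  suff -> : ereal_inf [set legendre s (al * r, r) | r in [set: R]] = (- d)%:E.
    by rewrite -EFinN opprK.
  apply/eqP; rewrite eq_le; apply/andP; split.
    (* The gradient at the critical point is (al b2, b2), and the supporting plane there has height
       d at the origin. *)
    apply: (@le_trans _ _ (legendre s (al * b2, b2))).
      by apply: ereal_inf_lbound; exists b2.
    apply: ge_ereal_sup => _ [[x y] _ <-]; rewrite lee_fin /dot /=.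
    have := low (x - q) (y - - al * q); rewrite !subrKC sq a2al; lra.
  (* Every (al r, r) is orthogonal to (q, - al q), a point of height d. *)
  apply: le_ereal_inf_tmp => _ [r _ <-]; apply: ereal_sup_ubound.
  exists (q, - al * q) => //; rewrite sq /dot /=; congr EFin; ring.
exists q; split=> //.
  move=> r; split=> [[_ perp]|->].
    have [a1' [a2' [C' hC']]] := P_support (s (r, - al * r)) r.
    apply/(slope_al _ _ _ _ hC').
    have [_ gr'] := surface_differentiable c_gt0 P_slope sP hC'.
    have [_ a1c _ _ _] := hC'.
    have a10 : - a1' != 0 by rewrite gt_eqF//; have := c_gt0; lra.
    have /perp : line (- al) (1, - al) by rewrite /line /= mulr1.
    rewrite gr' /dot /= => e; apply/eqP; rewrite -subr_eq0; apply/eqP/(mulIf (invr_neq0 a10)).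
    rewrite mul0r -[RHS]e; ring.
  split=> // -[x y] /= e; rewrite gr a2al /dot /=; move: e; rewrite /line /= => ->.
  rewrite -/b2; ring.
apply/seteqP; split=> [[z1 z2] [/= hz z10]|_ ->].
  move: hz; rewrite /tangent_plane /height_axis /= in z10 *; rewrite z10.
  rewrite sq gr a2al /dot /= => ->; congr pair; ring.
split=> //; rewrite /tangent_plane /= sq gr a2al /dot /=; ring.
Qed.

End SurfaceLine.

(** * Sums over words with bounded displacement *)

Section FibreSums.
Context {R : realType} {m' : nat} (th : R).
Hypotheses (th_gt0 : 0 < th) (th_lt1 : th < 1).
Implicit Types (f g F G : Sigma m' -> R) (x y : Sigma m') (w u : seq (letter m')).
Local Opaque pressure.

Variables (C c L : R) (phi : Sigma m' -> R) (p : letter m' -> R).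
Hypotheses (hphi : holder th C phi) (c_gt0 : 0 < c).
Hypothesis phi_bounds : forall x, - L <= phi x <= - c.
Let psi : Sigma m' -> R := fun x => p (x 0%N).
Local Notation P := (pressure2 phi p).

Definition deviation (al : R) w := \sum_(i <- w) (p i - al).

Definition fibre_sum (al K t : R) n : R :=
  \sum_(w : n.-tuple (letter m') | `|word_sup (fun x => psi x - al) w| <= K)
     expR (word_sup (fun x => t * phi x) w).

Lemma deviation_cat al w u : deviation al (w ++ u) = deviation al w + deviation al u.
Proof. by rewrite /deviation big_cat. Qed.

Lemma birkhoff_deviation al w x :
  birkhoff (fun x => psi x - al) (size w) (prep w x) = deviation al w.
Proof.
elim: w => [|i w IH]; first by rewrite birkhoff0 /deviation big_nil.
by rewrite birkhoffS /deviation big_cons -/(deviation al w) -IH.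
Qed.

Lemma word_sup_deviation al w : word_sup (fun x => psi x - al) w = deviation al w.
Proof.
rewrite /word_sup; have -> : [set birkhoff (fun x => psi x - al) (size w) x | x in cylinder w] =
    [set deviation al w]; last by rewrite sup1.
apply/seteqP; split=> [_ [x /cylinderE -> <-]|_ ->] /=; first exact: birkhoff_deviation.
by exists (prep w (fun=> ord0)); [exact: cylinder_prep|exact: birkhoff_deviation].
Qed.

Lemma fibre_sumE al K t n : fibre_sum al K t n =
  \sum_(w : n.-tuple (letter m') | `|deviation al w| <= K)
     expR (word_sup (fun x => t * phi x) w).
Proof. by rewrite /fibre_sum; under eq_bigl do rewrite word_sup_deviation. Qed.

Lemma le_fibre_sum al K K' t n : K <= K' -> fibre_sum al K t n <= fibre_sum al K' t n.
Proof.
move=> KK; rewrite !fibre_sumE big_mkcond [leRHS]big_mkcond ler_sum// => w _.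
case: ifP => [wK|_]; first by rewrite (le_trans wK KK).
by case: ifP => // _; exact: expR_ge0.
Qed.

Let x0 : Sigma m' := fun=> ord0.
Let A := \sum_i `|p i| + \sum_i `|p i|.
Let hpsi : holder th A psi := holder_letter th_gt0 p.
Let ht (t : R) : holder th (`|t| * C) (fun x => t * phi x) := holder_scale t hphi.

Let Dt (t : R) := distortion th (`|t| * C).
Let tilt_pot (t r al : R) x := t * phi x + r * (psi x - al).

Lemma holder_tilt (t r al : R) : holder th (`|t| * C + `|r| * A) (tilt_pot t r al).
Proof. by apply: holder_add; [exact: ht|exact/holder_scale/holder_addc]. Qed.

Lemma pressure_tilt t r al : pressure (tilt_pot t r al) = P t r - r * al.
Proof. exact: (pressure_shift th_gt0 th_lt1 _ hphi). Qed.

Lemma word_sup_scale_le (t : R) w x :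
  birkhoff (fun x => t * phi x) (size w) (prep w x) <= word_sup (fun x => t * phi x) w <=
  birkhoff (fun x => t * phi x) (size w) (prep w x) + Dt t.
Proof.
rewrite (word_sup_ge th_gt0 th_lt1 (ht t) (cylinder_prep w x)).
exact: (word_sup_le th_gt0 th_lt1 (ht t) (cylinder_prep w x)).
Qed.

Lemma birkhoff_tilt t r al w x : birkhoff (tilt_pot t r al) (size w) (prep w x) =
  birkhoff (fun x => t * phi x) (size w) (prep w x) + r * deviation al w.
Proof. by rewrite birkhoffD; congr (_ + _); rewrite birkhoffZ birkhoff_deviation. Qed.

Lemma fibre_sum_upper al K t r : exists B, forall n,
  fibre_sum al K t n <= expR (B + n%:R * (P t r - r * al)).
Proof.
exists (Dt t + `|r| * K + 3 * distortion th (`|t| * C + `|r| * A)) => n.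
have /andP[_ h] := pressure_bound th_gt0 th_lt1 (holder_tilt t r al) n x0.
rewrite pressure_tilt in h; rewrite -addrA expRD; apply: le_trans (ler_wpM2l (expR_ge0 _) h).
rewrite fibre_sumE big_mkcond /transfer mulr_sumr; apply: ler_sum => w _.
case: ifP => [wK|_]; last by rewrite mulr1 mulr_ge0 ?expR_ge0.
rewrite mulr1 -expRD ler_expR.
have := birkhoff_tilt t r al w x0; rewrite size_tuple => ->.
have /andP[_] := word_sup_scale_le t w x0; rewrite size_tuple.
have : `|r * deviation al w| <= `|r| * K by rewrite normrM ler_wpM2l.
by rewrite ler_norml; lra.
Qed.

(* As sg * r -> +oo at fixed n, only words with zero deviation contribute to the
   partition function of t phi + r (psi - al). *)
Lemma fibre_sum_lower_boundary al sg t b n : `|sg| = 1 ->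
  (forall i, sg * (p i - al) <= 0) -> (forall r, b <= P t r - r * al) ->
  expR (n%:R * b) <= fibre_sum al 0 t n.
Proof.
move=> sg1 Hsg Hb.
have sg_dev w : sg * deviation al w <= 0.
  by rewrite /deviation mulr_sumr; apply: sumr_le0 => i _.
(* Lower bound for the nonzero |p i - al|: the inverse of one of them is at most the sum of all.
   Letters with p i = al contribute 0^-1 = 0, and the summand 1 keeps [g] positive. *)
pose g := (1 + \sum_i `|(sg * (p i - al))^-1|)^-1.
have S0 : 0 <= \sum_i `|(sg * (p i - al))^-1| by apply: sumr_ge0.
have g0 : 0 < g by rewrite invr_gt0; lra.
have gap w : deviation al w != 0 -> sg * deviation al w <= - g.
  elim: w => [|i w IH]; first by rewrite /deviation big_nil eqxx.
  rewrite /deviation big_cons -/(deviation al w) => dn.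
  have [di|di] := eqVneq (p i - al) 0; first by rewrite di add0r in dn *; exact: IH.
  rewrite mulrDr; suff : sg * (p i - al) <= - g by have := sg_dev w; lra.
  have neg : sg * (p i - al) < 0.
    by rewrite lt_neqAle Hsg andbT mulf_neq0// -normr_eq0 sg1 oner_eq0.
  rewrite lerNr -[leRHS]invrK lef_pV2 ?posrE ?invr_gt0 ?oppr_gt0//; last by lra.
  rewrite invrN -ltr0_norm ?invr_lt0// (bigD1 i)//= addrCA lerDl addr_ge0//.
  by apply: sumr_ge0.
pose Z := \sum_(w : n.-tuple (letter m')) expR (word_sup (fun x => t * phi x) w).
have Z0 : 0 <= Z by apply: sumr_ge0 => w _; exact: expR_ge0.
rewrite -subr_le0; apply: (@le0_geometric _ _ Z (expR (- g))); first exact: expR_ge0.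
  by rewrite -expR0 ltr_expR oppr_lt0.
move=> k; rewrite lerBlDl -expRM_natl.
(* Words of zero deviation keep their weight; all others are damped by at least exp(- g k). *)
pose r := sg * k%:R.
pose Zr := \sum_(w : n.-tuple (letter m'))
  expR (word_sup (fun x => t * phi x) w) * expR (r * deviation al w).
have h1 : expR (n%:R * b) <= Zr.
  apply: (@le_trans _ _ (expR (n%:R * pressure (tilt_pot t r al)))).
    by rewrite pressure_tilt ler_expR ler_wpM2l.
  apply: (pressure_trial_le (W := fun=> 1) (l := 1) (B := 1) th_gt0 th_lt1 (holder_tilt t r al)) => //.
  - by move=> _; rewrite lexx.
  - rewrite /Zr (bigD1 [tuple of nseq n ord0])//= ltr_pwDl ?mulr_gt0 ?expR_gt0//.
    by apply: sumr_ge0 => w _; rewrite mulr_ge0 ?expR_ge0.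
  - move=> x; rewrite mulr1; apply: ler_sum => w _; rewrite mulr1 -expRD ler_expR.
    have := birkhoff_tilt t r al w x; rewrite size_tuple => ->.
    by have /andP[h _] := word_sup_scale_le t w x; rewrite lerD2r; rewrite size_tuple in h.
apply: (le_trans h1); rewrite fibre_sumE big_mkcond /Z mulr_suml -big_split.
apply: ler_sum => w _ /=; rewrite normr_le0.
have [->|dn] := eqVneq (deviation al w) 0.
  by rewrite mulr0 expR0 mulr1 lerDl mulr_ge0 ?expR_ge0.
rewrite add0r ler_wpM2l ?expR_ge0// ler_expR /r mulrAC mulrC.
by rewrite ler_wpM2l// gap.
Qed.

Section Steering.
Variables (al : R) (i1 i2 : letter m') (K0 : R).
Hypotheses (i1_lt : p i1 < al) (i2_gt : al < p i2).
Hypothesis K0P : forall i, `|p i - al| <= K0.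

(* Letters appended greedily so as to bring the partial sum z back to the
   window [-K0, K0] and keep it there. *)
Fixpoint steer l (z : R) : seq (letter m') :=
  if l is l'.+1 then
    let i := if 0 < z then i1 else i2 in i :: steer l' (z + (p i - al))
  else [::].

Lemma size_steer l z : size (steer l z) = l.
Proof. by elim: l z => //= l IH z; rewrite IH. Qed.

(** A letter either brings |z| down by at least eta or crosses zero, and then the overshoot is at
    most one step, hence at most [K0]. *)
Lemma steer_deviation l z :
  `|z + deviation al (steer l z)| <=
  Num.max K0 (`|z| - l%:R * Num.min (al - p i1) (p i2 - al)).
Proof.
set eta := Num.min _ _.
have eta0 : 0 < eta by rewrite lt_min !subr_gt0 i1_lt i2_gt.
have eta1 : eta <= al - p i1 by rewrite ge_min lexx.
have eta2 : eta <= p i2 - al by rewrite ge_min lexx orbT.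
elim: l z => [|l IH] z; first by rewrite /deviation big_nil addr0 mul0r subr0 le_max lexx orbT.
rewrite /= /deviation big_cons -/(deviation al _) addrA; set i := if _ then _ else _.
apply: (le_trans (IH _)).
have step : `|z + (p i - al)| <= Num.max K0 (`|z| - eta).
  rewrite le_max; have := K0P i; rewrite /i; case: (ltP 0 z) => z0.
    rewrite (gtr0_norm z0) ler_norml => /andP[h1 _].
    have [z1|z1] := leP 0 (z + (p i1 - al)).
      by apply/orP; right; rewrite ger0_norm//; lra.
    by apply/orP; left; rewrite ltr0_norm//; lra.
  rewrite (ler0_norm z0) ler_norml => /andP[_ h1].
  have [z1|z1] := leP 0 (z + (p i2 - al)).
    by apply/orP; left; rewrite ger0_norm//; lra.
  by apply/orP; right; rewrite ltr0_norm//; lra.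
have le0 : 0 <= l%:R * eta by rewrite mulr_ge0// ltW.
rewrite ge_max le_max lexx /=; move: step; rewrite !le_max -natr1 => /orP[h|h].
  by apply/orP; left; lra.
by apply/orP; right; lra.
Qed.

Variables (t q C2 : R).
Hypothesis C2_gt0 : 0 < C2.
Hypothesis q_critical : forall v, `|v| * C2 <= 1 ->
  P t (q + v) - (q + v) * al <= P t q - q * al + C2 * v ^+ 2.
Let Pq := P t q - q * al.

(* Exponential Markov inequality on both sides. *)
Lemma concentration e : 0 < e -> exists N, forall n, (N <= n)%N ->
  expR (n%:R * (Pq - e)) <=
  \sum_(w : n.-tuple (letter m') | `|deviation al w| <= n%:R * e)
     expR (birkhoff (tilt_pot t q al) n (prep w x0)).
Proof.
move=> e0; pose v := Num.min (e / 2) 1 / C2.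
have v0 : 0 < v by rewrite divr_gt0// lt_min ltr01 divr_gt0.
have vC : v * C2 = Num.min (e / 2) 1 by rewrite divfK// gt_eqF.
have vC1 : v * C2 <= 1 by rewrite vC ge_min lexx orbT.
have vCe : v * C2 <= e / 2 by rewrite vC ge_min lexx.
clearbody v.
pose ka := v * e / 2.
have ka0 : 0 < ka by rewrite divr_gt0// mulr_gt0.
have kaE : C2 * v ^+ 2 - v * e <= - ka.
  by have := ler_wpM2l (ltW v0) vCe; rewrite /ka expr2; lra.
pose B0 := 3 * distortion th (`|t| * C + `|q| * A).
have side sg : `|sg| = 1 -> exists B, forall n,
    \sum_(w : n.-tuple (letter m')) expR (birkhoff (tilt_pot t q al) n (prep w x0) +
       sg * v * deviation al w) <= expR (B + n%:R * (Pq + C2 * v ^+ 2)).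
  move=> sg1; exists (3 * distortion th (`|t| * C + `|q + sg * v| * A)) => n.
  have /andP[_ h] := pressure_bound th_gt0 th_lt1 (holder_tilt t (q + sg * v) al) n x0.
  apply: (@le_trans _ _ (transfer (tilt_pot t (q + sg * v) al) n (fun=> 1) x0)).
    rewrite le_eqVlt; apply/orP; left; apply/eqP; apply: eq_bigr => w _; rewrite mulr1.
    have := birkhoff_tilt t (q + sg * v) al w x0; have := birkhoff_tilt t q al w x0.
    by rewrite size_tuple => -> ->; congr expR; ring.
  apply: (le_trans h); rewrite pressure_tilt ler_expR lerD2l ler_wpM2l//.
  have := q_critical (v := sg * v); rewrite normrM sg1 mul1r (gtr0_norm v0) => /(_ vC1).
  suff -> : (sg * v) ^+ 2 = v ^+ 2 by [].
  by rewrite exprMn -[sg ^+ 2]ger0_norm ?sqr_ge0// normrX sg1 expr1n mul1r.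
have [B1 HB1] := side 1 (normr1 _).
have [B2 HB2] : exists B, forall n, \sum_(w : n.-tuple (letter m'))
   expR (birkhoff (tilt_pot t q al) n (prep w x0) + -1 * v * deviation al w) <=
   expR (B + n%:R * (Pq + C2 * v ^+ 2)) by apply: side; rewrite normrN normr1.
(* Half the constant in the lower bound for the full sum: the tails use at most one half, and the
   other half dominates exp(- e n). *)
pose E := expR (- B0) / 2; have E0 : 0 < E by rewrite divr_gt0 ?expR_gt0.
have r1 : expR (- ka) < 1 by rewrite -expR0 ltr_expR oppr_lt0.
have r2 : expR (- e) < 1 by rewrite -expR0 ltr_expR oppr_lt0.
have [N1 HN1] := @geometric_small R (expR (- ka)) (expR B1 + expR B2) E (expR_ge0 _) r1 E0.
have [N2 HN2] := @geometric_small R (expR (- e)) 1 E (expR_ge0 _) r2 E0.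
exists (maxn N1 N2) => n; rewrite geq_max => /andP[n1 n2].
have {}HN1 : (expR B1 + expR B2) * expR (- ka) ^+ n <= E.
  apply: le_trans HN1; rewrite ler_wpM2l ?addr_ge0 ?expR_ge0//.
  by rewrite ler_wiXn2l ?expR_ge0// ltW.
have {}HN2 : expR (- e) ^+ n <= E.
  by rewrite mul1r in HN2; apply: le_trans HN2; rewrite ler_wiXn2l ?expR_ge0// ltW.
set S := \sum_(w : n.-tuple (letter m') | _) _.
have total : expR (- B0 + n%:R * Pq) <= S + expR (- (n%:R * (v * e))) *
    (expR (B1 + n%:R * (Pq + C2 * v ^+ 2)) + expR (B2 + n%:R * (Pq + C2 * v ^+ 2))).
  have /andP[h _] := pressure_bound th_gt0 th_lt1 (holder_tilt t q al) n x0.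
  rewrite pressure_tilt -/B0 -/Pq in h; apply: (le_trans h).
  apply: le_trans (lerD (lexx S) (ler_wpM2l (expR_ge0 _) (lerD (HB1 n) (HB2 n)))).
  rewrite /S big_mkcond -big_split /= mulr_sumr -big_split /=.
  apply: ler_sum => w _; rewrite mulr1; set b := birkhoff _ _ _.
  set d := deviation al w.
  case: (leP `|d| (n%:R * e)) => dn.
    by rewrite lerDl mulr_ge0 ?addr_ge0 ?expR_ge0.
  rewrite add0r mulrDr -!expRD.
  have [d0|d0] := leP 0 d.
    rewrite (ger0_norm d0) in dn; apply: ler_wpDr; first exact: expR_ge0.
    by rewrite ler_expR; have := ler_wpM2l (ltW v0) (ltW dn); lra.
  rewrite (ltr0_norm d0) in dn; apply: ler_wpDl; first exact: expR_ge0.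
  by rewrite ler_expR; have := ler_wpM2l (ltW v0) (ltW dn); lra.
have small : expR (- (n%:R * (v * e))) *
    (expR (B1 + n%:R * (Pq + C2 * v ^+ 2)) + expR (B2 + n%:R * (Pq + C2 * v ^+ 2))) <=
    expR (n%:R * Pq) * E.
  apply: (@le_trans _ _ (expR (n%:R * Pq) * ((expR B1 + expR B2) * expR (- ka) ^+ n))).
    rewrite mulrDr mulrDl mulrDr -expRM_natl -!expRD.
    by have hk := ler_wpM2l (ler0n R n) kaE; rewrite lerD// ler_expR; lra.
  by rewrite ler_wpM2l ?expR_ge0.
have goal : expR (n%:R * (Pq - e)) <= expR (n%:R * Pq) * E.
  have -> : expR (n%:R * (Pq - e)) = expR (n%:R * Pq) * expR (- e) ^+ n.
    by rewrite -expRM_natl -expRD mulrBr mulrN.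
  by rewrite ler_wpM2l ?expR_ge0.
apply: (le_trans goal).
move: total; rewrite expRD mulrC => total.
have : expR (n%:R * Pq) * expR (- B0) = expR (n%:R * Pq) * E + expR (n%:R * Pq) * E.
  by rewrite /E; field.
move: total small; set u1 := _ * expR (- B0); set u2 := _ * (_ + _); set u3 := _ * E.
by move=> ? ? ?; lra.
Qed.

Lemma fibre_sum_lower_interior e n0 : 0 < e -> exists2 n, (n0 <= n)%N &
  expR (n%:R * (Pq - e)) <= fibre_sum al K0 t n.
Proof.
move=> e0; set eta := Num.min (al - p i1) (p i2 - al).
have eta0 : 0 < eta by rewrite lt_min !subr_gt0 i1_lt i2_gt.
have K00 : 0 <= K0 by apply: le_trans (K0P i1).
have L0 : 0 < L := L_gt0 c_gt0 phi_bounds.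
pose Q := `|Pq| + `|t| * L; have Q0 : 0 <= Q by rewrite addr_ge0// mulr_ge0// ltW.
(* Losses per unit of n d: Q / eta for about n d / eta steering letters costing at most Q each, |q|
   for removing the tilt, 1 for concentration. With d M = e / 2, the other half of e n absorbs [T],
   the cost of distortion and of rounding the number of letters. *)
pose M := Q / eta + `|q| + 1.
have M0 : 0 < M by rewrite ltr_wpDl// addr_ge0// divr_ge0// ltW.
pose d := e / (2 * M); have d0 : 0 < d by rewrite divr_gt0// mulr_gt0.
have dM : d * M = e / 2 by rewrite /d; field; rewrite gt_eqF.
have [N HN] := concentration d0.
pose T := Dt t + Q; have T0 : 0 <= T.
  by rewrite addr_ge0// distortion_ge0// (holder_ge0 (ht t)).
pose n1 := Num.bound (T / (e / 2)).
have n1P : T <= n1%:R * (e / 2).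
  by rewrite -ler_pdivrMr ?divr_gt0// ltW// archi_boundP// divr_ge0// divr_ge0// ltW.
pose n := maxn n0 (maxn N n1).
have nT : T <= n%:R * (e / 2).
  apply: (le_trans n1P); rewrite ler_wpM2r ?divr_ge0 ?(ltW e0)// ler_nat.
  by rewrite /n !leq_max leqnn !orbT.
pose z := n%:R * d / eta; have z0 : 0 <= z.
  apply: divr_ge0; last exact: ltW.
  by apply: mulr_ge0 => //; exact: ltW.
pose l := (Num.truncn z).+1.
have lz : z <= l%:R by rewrite ltW// truncnS_gt.
have lz1 : l%:R <= z + 1 by rewrite -natr1 lerD2r truncn_le// .
clearbody l; exists (n + l)%N; first by rewrite (leq_trans (leq_maxl n0 (maxn N n1)))// leq_addr.
have {}HN := HN n; rewrite /n !leq_max leqnn orbT /= -/n in HN.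
pose Q' := `|q| * (n%:R * d) + Dt t + l%:R * (`|t| * L).
have step : expR (n%:R * (Pq - d)) * expR (- Q') <= fibre_sum al K0 t (n + l).
  apply: (le_trans (ler_wpM2r (expR_ge0 _) (HN isT))).
  rewrite fibre_sumE big_mkcond [leRHS]big_mkcond.
  rewrite (sum_tuple_cat n l (fun w => if `|deviation al w| <= K0 then
    expR (word_sup (fun x => t * phi x) w) else 0)).
  rewrite mulr_suml; apply: ler_sum => w _.
  have E0 u : 0 <= (if `|deviation al (w ++ u)| <= K0 then
    expR (word_sup (fun x => t * phi x) (w ++ u)) else 0).
    by case: ifP => // _; exact: expR_ge0.
  case: (leP `|deviation al w| (n%:R * d)) => dw; last by rewrite mul0r sumr_ge0.
  have us : size (steer l (deviation al w)) == l by rewrite size_steer.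
  rewrite (bigD1 (Tuple us))//= ler_wpDr ?sumr_ge0//.
  set u := steer l _.
  have -> : `|deviation al (w ++ u)| <= K0.
    rewrite deviation_cat; apply: (le_trans (steer_deviation l _)).
    rewrite ge_max lexx /= -/eta lerBlDr; apply: (le_trans dw).
    apply: (@le_trans _ _ (l%:R * eta)); last by rewrite lerDr.
    by rewrite -ler_pdivrMr.
  have /andP[h1 _] := word_sup_scale_le t (w ++ u) x0.
  apply: le_trans (_ : _ <= expR _) _; last by rewrite ler_expR; exact: h1.
  rewrite -expRD ler_expR size_cat birkhoff_add size_tuple prep_cat.
  have -> : iter n left_shift (prep w (prep u x0)) = prep u x0.
    by have := shift_prep w (prep u x0); rewrite size_tuple.
  have b1 := birkhoff_tilt t q al w x0; rewrite size_tuple in b1; rewrite b1.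
  have a0 : agree 0 x0 (prep u x0) by [].
  have b2 := holder_birkhoff th_gt0 th_lt1 w (ht t) a0.
  rewrite expr0 mulr1 size_tuple -/(Dt t) in b2.
  have b3 : `|birkhoff (fun x => t * phi x) (size u) (prep u x0)| <= l%:R * (`|t| * L).
    rewrite size_steer; apply: birkhoff_bound => y; rewrite normrM ler_wpM2l//.
    by have /andP[h3 h4] := phi_bounds y; have := c_gt0; rewrite ler_norml; lra.
  have b4 : `|q * deviation al w| <= `|q| * (n%:R * d) by rewrite normrM ler_wpM2l.
  by move: b2 b3 b4; rewrite !ler_norml /Q'; lra.
apply: le_trans step; rewrite -expRD ler_expR natrD.
have lQ : l%:R * Q <= z * Q + Q.
  by rewrite -[X in _ + X]mul1r -mulrDl ler_wpM2r.
have zQ : z * Q = n%:R * d * (Q / eta) by rewrite /z; ring.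
have dn : n%:R * (e / 2) = n%:R * d * (Q / eta) + `|q| * (n%:R * d) + n%:R * d.
  by rewrite -dM /M; ring.
have lP : l%:R * Pq <= l%:R * `|Pq| by rewrite ler_wpM2l// ler_norm.
have lQE : l%:R * Q = l%:R * `|Pq| + l%:R * (`|t| * L) by rewrite /Q; ring.
have le0 : 0 <= l%:R * e by rewrite mulr_ge0// ltW.
rewrite /T in nT; rewrite /Q'; lra.
Qed.

End Steering.

End FibreSums.

(** * From sums over words to the fibre pressure and the Poincaré exponent *)

Section WordSeries.
Context {R : realType} {I : finType}.

(** Nonnegative terms may be regrouped by word length; this links the Poincaré series to sums over
    words of fixed length. *)
Lemma esum_words (P : pred (seq I)) (a : seq I -> R) : (forall w, 0 <= a w) ->
  (\esum_(w in [set w | P w]) (a w)%:E =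
   \sum_(0 <= n <oo) (\sum_(w : n.-tuple I | P w) a w)%:E)%E.
Proof.
move=> a0; have -> : [set w | P w] = \bigcup_n [set w | P w && (size w == n)].
  apply/seteqP; split=> [w Pw|w [n _ /andP[]//]].
  by exists (size w) => //=; rewrite eqxx andbT.
have tS : trivIset [set: nat] (fun n => [set w | P w && (size w == n)]).
  by move=> i j _ _ [w [/andP[_ /eqP <-] /andP[_ /eqP <-]]].
rewrite (nneseries_sum_bigcup tS) => [|w]; last by rewrite lee_fin.
congr (limn _); apply/funext => N; apply: eq_bigr => n _.
have -> : [set w | P w && (size w == n)] =
    [set tval w | w in [set` [pred w : n.-tuple I | P w]]].
  apply/seteqP; split=> [w /= /andP[Pw sw]|_ [w /= Pw <-]].
    by exists (Tuple sw).
  by rewrite /= size_tuple eqxx andbT.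
rewrite esum_image; last by move=> u v _ _ /val_inj.
rewrite esum_fset; [|exact: finite_finpred|by move=> w _; rewrite lee_fin].
rewrite -(@bigfs _ _ _ _ (index_enum (n.-tuple I))) ?index_enum_uniq//; last first.
  by move=> w _; rewrite mem_index_enum.
by rewrite sumEFin.
Qed.

End WordSeries.

Section LimsupBounds.
Context {R : realType}.
Local Open Scope ereal_scope.

Lemma limn_esup_le_near (u : (\bar R)^nat) b N : (forall n, (N <= n)%N -> u n <= b) ->
  limn_esup u <= b.
Proof.
move=> H; apply: ge_ereal_inf; exists (ereal_sup (u @` [set n | (N <= n)%N])).
  by exists [set n | (N <= n)%N] => //; exact: nbhs_infty_ge.
by apply: ge_ereal_sup => _ [n /= Nn <-]; exact: H.
Qed.

Lemma limn_esup_ge_frequent (u : (\bar R)^nat) b :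
  (forall N, exists2 n, (N <= n)%N & b <= u n) -> b <= limn_esup u.
Proof.
move=> H; apply: le_ereal_inf_tmp => _ [V [N _ NV] <-].
by have [n Nn bn] := H N; apply: (le_trans bn); apply: ereal_sup_ubound; exists n => //; exact: NV.
Qed.

Lemma lne_le_expR (x b : R) : (x <= expR b)%R -> lne x%:E <= b%:E.
Proof.
move=> xb; have [x0|x0] := leP x 0%R; first by rewrite le0_lneNy ?lee_fin// leNye.
by rewrite lne_EFin// lee_fin -[b]expRK ler_ln ?posrE ?expR_gt0.
Qed.

Lemma lne_ge_expR (x b : R) : (expR b <= x)%R -> b%:E <= lne x%:E.
Proof.
move=> bx; have x0 : (0 < x)%R by apply: lt_le_trans bx; exact: expR_gt0.
by rewrite lne_EFin// lee_fin -[b]expRK ler_ln ?posrE ?expR_gt0.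
Qed.

End LimsupBounds.

Section PoincareExponent.
Context {R : realType} {m' : nat} (th : R).
Hypotheses (th_gt0 : 0 < th) (th_lt1 : th < 1).
Implicit Types (x y : Sigma m') (w u : seq (letter m')).
Local Opaque pressure pressure2.

Variables (C c L : R) (phi : Sigma m' -> R) (p : letter m' -> R) (i1 i2 : letter m').
Hypotheses (hphi : holder th C phi) (c_gt0 : 0 < c).
Hypothesis phi_bounds : forall x, - L <= phi x <= - c.
Hypothesis p_ext : forall i, p i1 <= p i <= p i2.
Let psi : Sigma m' -> R := fun x => p (x 0%N).
Local Notation P := (pressure2 phi p).
Let lo := p i1.
Let hi := p i2.

Lemma lohi : lo <= hi. Proof. by have /andP[] := p_ext i2. Qed.

Let loP t q := pressure2_ge_letter th_gt0 th_lt1 p hphi c_gt0 phi_bounds t q i1.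
Let hiP t q := pressure2_ge_letter th_gt0 th_lt1 p hphi c_gt0 phi_bounds t q i2.

Lemma pressure2_quadratic_support (t q : R) : exists a1 a2 C2, quadratic_support P c lo hi t q a1 a2 C2.
Proof.
have [a1 [a2 [a1c low [C2 C20 up] str]]] := pressure2_support th_gt0 th_lt1 p hphi phi_bounds t q.
exists a1, a2, C2; split=> // lh y y0.
(* Two letters with different values cannot both have the value a2. *)
have [e|ne] := eqVneq (p i1) a2; last exact: str ne.
by apply: (str _ i2) => //; rewrite -e gt_eqF.
Qed.

Variable al : R.
Hypothesis al_lohi : lo <= al <= hi.
Local Notation T := (tilted_inf P al).

(** The window hi - lo dominates every |p i - al| and depends neither on [t] nor on [e], so one
    threshold for K serves both the fibre pressure and the exponent. *)
Lemma fibre_sum_lower t e n0 : 0 < e -> exists2 n, (n0 <= n)%N &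
  expR (n%:R * (T t - e)) <= fibre_sum phi p al (hi - lo) t n.
Proof.
move=> e0; have Tle := tilted_inf_le loP hiP al_lohi t.
have bd sg : `|sg| = 1 -> (forall i, sg * (p i - al) <= 0) -> exists2 n, (n0 <= n)%N &
    expR (n%:R * (T t - e)) <= fibre_sum phi p al (hi - lo) t n.
  move=> sg1 Hsg; exists n0 => //.
  apply: (@le_trans _ _ (fibre_sum phi p al 0 t n0)); last first.
    by apply: le_fibre_sum; rewrite subr_ge0 lohi.
  apply: le_trans (fibre_sum_lower_boundary th_gt0 th_lt1 hphi n0 sg1 Hsg Tle).
  by rewrite ler_expR ler_wpM2l// gerBl ltW.
case/andP: al_lohi; rewrite le_eqVlt => /orP[/eqP al_lo _|lo_al].
  apply: (bd (-1)) => [|i]; first by rewrite normrN normr1.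
  by rewrite mulN1r oppr_le0 subr_ge0 -al_lo; have /andP[] := p_ext i.
rewrite le_eqVlt => /orP[/eqP al_hi|al_hi].
  apply: (bd 1) => [|i]; first exact: normr1.
  by rewrite mul1r subr_le0 al_hi; have /andP[] := p_ext i.
have al_int : lo < al < hi by rewrite lo_al.
have [q Hq] := tilted_inf_attained loP hiP pressure2_quadratic_support al_int t.
have [a1 [a2 [C2 hC]]] := pressure2_quadratic_support t q.
have ea : a2 = al.
  by apply: (argmin_slope hC) => u; have := Tle u; rewrite Hq.
rewrite ea in hC; have [C20 _ _ _ _] := hC.
have bnd i : `|p i - al| <= hi - lo.
  have /andP[h1 h2] := p_ext i; have /andP[h3 h4] := al_lohi.
  by rewrite ler_norml; move: h1 h2 h3 h4; rewrite -/lo -/hi; lra.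
rewrite Hq; exact: (fibre_sum_lower_interior th_gt0 th_lt1 hphi c_gt0 phi_bounds
  lo_al al_hi bnd C20 (support_critical hC) n0 e0).
Qed.

Lemma fibre_limsup_le t K : (limn_esup (fun n => (n%:R^-1)%:E *
    lne (fibre_sum phi p al K t n)%:E) <= (T t)%:E)%E.
Proof.
suff H r : (limn_esup (fun n => (n%:R^-1)%:E *
    lne (fibre_sum phi p al K t n)%:E) <= (P t r - r * al)%:E)%E.
  move: H; set l := limn_esup _; case: l => [l H|H|_]; last exact: leNye.
    by rewrite lee_fin; apply: tilted_inf_ge => q; rewrite -lee_fin.
  by have := H 0; rewrite leye_eq.
have [B HB] := fibre_sum_upper th_gt0 th_lt1 p hphi al K t r.
move: HB; move: (P t r - r * al) => b HB.
apply/lee_addgt0Pr => e e0; pose N := (Num.bound (`|B| / e)).+1.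
apply: (@limn_esup_le_near _ _ _ N) => n Nn.
have n0 : 0 < n%:R :> R by rewrite ltr0n (leq_trans _ Nn).
apply: (@le_trans _ _ ((n%:R^-1)%:E * (B + n%:R * b)%:E)%E).
  by rewrite lee_wpmul2l ?lee_fin ?invr_ge0// lne_le_expR.
rewrite -EFinM -EFinD lee_fin mulrDr mulKf ?gt_eqF// addrC lerD2l.
rewrite mulrC ler_pdivrMr// (le_trans (ler_norm _))// mulrC -ler_pdivrMr//.
have h : `|B| / e < (Num.bound (`|B| / e))%:R by rewrite archi_boundP// divr_ge0// ltW.
apply: (le_trans (ltW h)); rewrite ler_nat; apply: leq_trans Nn; exact: leqnSn.
Qed.

Lemma fibre_limsup_ge t K : hi - lo <= K -> ((T t)%:E <= limn_esup (fun n => (n%:R^-1)%:E *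
    lne (fibre_sum phi p al K t n)%:E))%E.
Proof.
move=> hK; apply/lee_addgt0Pr => e e0; rewrite -leeBlDr// -EFinB.
apply: limn_esup_ge_frequent => N.
have [n Nn hn] := fibre_sum_lower t N.+1 e0; exists n; first exact: ltnW.
have n0 : 0 < n%:R :> R by rewrite ltr0n (leq_trans _ Nn).
apply: (@le_trans _ _ ((n%:R^-1)%:E * (n%:R * (T t - e))%:E)%E).
  by rewrite -EFinM mulKf ?gt_eqF.
rewrite lee_wpmul2l ?lee_fin ?invr_ge0//; apply: lne_ge_expR.
by apply: (le_trans hn); exact: le_fibre_sum.
Qed.

Lemma fibre_pressureE t :
  fibre_pressure (fun x => t * phi x) (fun x => psi x - al) = (T t)%:E.
Proof.
apply: cvg_lim => //; apply: cvg_near_cst; near=> K.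
have hK : hi - lo <= K by near: K; apply: nbhs_pinfty_ge; rewrite num_real.
by apply/eqP; rewrite eq_le fibre_limsup_le fibre_limsup_ge.
Unshelve. all: by end_near. Qed.

Let S K s n := \sum_(w : n.-tuple (letter m') | `|word_sup (fun x => psi x - al) w| <= K)
  expR (s * word_sup phi w).

Lemma poincare_seriesE K s :
  poincare_series phi psi al K s = (\sum_(0 <= n <oo) (S K s n)%:E)%E.
Proof.
by apply: (esum_words (fun w => `|word_sup (fun x => psi x - al) w| <= K)) => w; exact: expR_ge0.
Qed.

(** The Poincaré series uses s times the supremum of S phi, the fibre sum the supremum of S (s phi).
    Together with [poincare_sum_le] this makes them comparable for s >= 0. *)
Lemma poincare_sum_ge K s n : 0 <= s -> fibre_sum phi p al K s n <= S K s n.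
Proof.
move=> s0; apply: ler_sum => w _; rewrite ler_expR.
apply: ge_sup.
  exists (birkhoff (fun x => s * phi x) (size w) (prep w (fun=> ord0))).
  by exists (prep w (fun=> ord0)) => //; exact: cylinder_prep.
move=> _ [x wx <-]; rewrite birkhoffZ ler_wpM2l//.
exact: (word_sup_ge th_gt0 th_lt1 hphi).
Qed.

Lemma poincare_sum_le K s n : 0 <= s ->
  S K s n <= expR (s * distortion th C) * fibre_sum phi p al K s n.
Proof.
move=> s0; rewrite /fibre_sum mulr_sumr; apply: ler_sum => w _; rewrite -expRD ler_expR.
have hx := cylinder_prep w (fun=> ord0 : letter m').
have h1 := word_sup_le th_gt0 th_lt1 hphi hx.
have := word_sup_ge th_gt0 th_lt1 (holder_scale s hphi) hx; rewrite birkhoffZ => h2.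
by have := ler_wpM2l s0 h1; move: h2; move: (word_sup _ _) => v; lra.
Qed.

(** A negative infimum provides one tilt r of negative exponent, and the corresponding Chernoff
    bound is a geometric majorant. *)
Lemma poincare_series_finite K s : 0 <= s -> T s < 0 ->
  (poincare_series phi psi al K s < +oo)%E.
Proof.
move=> s0 Ts; have [r Hr] : exists r, P s r - r * al < 0.
  apply: contrapT => H; suff : 0 <= T s by rewrite leNgt Ts.
  by apply: tilted_inf_ge => r; rewrite leNgt; apply/negP => Pr; apply: H; exists r.
have [B HB] := fibre_sum_upper th_gt0 th_lt1 p hphi al K s r.
move: Hr HB; move: (P s r - r * al) => b b0 HB.
pose A := expR (s * distortion th C + B); pose z := expR b.
have z0 : 0 <= z by exact: expR_ge0.
have z1 : z < 1 by rewrite -expR0 ltr_expR.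
rewrite poincare_seriesE; apply: (@le_lt_trans _ _ (A / (1 - z))%:E); last exact: ltry.
apply: lime_le.
  by apply: is_cvg_nneseries => n _ _; rewrite lee_fin; apply: sumr_ge0 => w _; exact: expR_ge0.
apply: nearW => n; rewrite sumEFin lee_fin big_mkord.
apply: (@le_trans _ _ (\sum_(k < n) A * z ^+ k)).
  apply: ler_sum => k _; apply: (le_trans (poincare_sum_le K k s0)).
  apply: (le_trans (ler_wpM2l (expR_ge0 _) (HB k))).
  by rewrite -expRD /A /z -expRM_natl -expRD addrA.
have z1' : 0 < 1 - z by rewrite subr_gt0.
rewrite -mulr_sumr ler_wpM2l ?expR_ge0// -[leRHS]mul1r ler_pdivlMr//.
by have := subrX1 z n; have := exprn_ge0 n z0; lra.
Qed.

(** The level sums are at least exp(n T(s) / 2) for arbitrarily large n, so a single level exceeds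
    any finite value. *)
Lemma poincare_series_infinite K s : hi - lo <= K -> 0 <= s -> 0 < T s ->
  poincare_series phi psi al K s = +oo%E.
Proof.
move=> hK s0 Ts; rewrite poincare_seriesE; set l := (\sum_(0 <= n <oo) _)%E.
have S0 n : (0 <= (S K s n)%:E)%E.
  by rewrite lee_fin; apply: sumr_ge0 => w _; exact: expR_ge0.
have ln n : ((S K s n)%:E <= l)%E.
  apply: (@le_trans _ _ (\sum_(0 <= i < n.+1) (S K s i)%:E)%E); last first.
    exact: nneseries_lim_ge.
  by rewrite big_nat_recr//= leeDr// sume_ge0.
case: l ln => // [l ln|/(_ 0%N)]; last by rewrite leeNy_eq.
exfalso; pose e := T s / 2; have e0 : 0 < e by rewrite divr_gt0.
have [n Nn hn] := fibre_sum_lower s (Num.bound (`|l| / e)) e0.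
have h1 : expR (n%:R * (T s - e)) <= l.
  apply: (le_trans hn); apply: (le_trans (le_fibre_sum phi p al s n hK)).
  by apply: (le_trans (poincare_sum_ge K n s0)); rewrite -lee_fin.
have h2 : 1 + n%:R * e <= l.
  apply: le_trans h1; have -> : T s - e = e by rewrite /e {1}(splitr (T s)) addrK.
  exact: expR_ge1Dx.
have h3 : `|l| / e < n%:R.
  apply: (@lt_le_trans _ _ (Num.bound (`|l| / e))%:R); last by rewrite ler_nat.
  by rewrite archi_boundP// divr_ge0// ltW.
by move: h3; rewrite ltr_pdivrMr//; have := ler_norm l; lra.
Qed.

Lemma poincare_exponent d : 0 <= d -> (forall t, t < d -> 0 < T t) ->
  (forall t, d < t -> T t < 0) -> is_poincare_exponent phi psi al d.
Proof.
move=> d0 Hlt Hgt; near=> K.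
have hK : hi - lo <= K by near: K; apply: nbhs_pinfty_ge; rewrite num_real.
apply/eqP; rewrite eq_le; apply/andP; split.
  apply/lee_addgt0Pr => e e0; apply: ereal_inf_lbound; exists (d + e) => //; split.
    by rewrite addr_ge0// ltW.
  by apply: poincare_series_finite; [rewrite addr_ge0// ltW|apply: Hgt; rewrite ltrDl].
apply: le_ereal_inf_tmp => _ [s [s0 sfin] <-]; rewrite lee_fin leNgt; apply/negP => /Hlt Ts.
by move: sfin; rewrite poincare_series_infinite.
Unshelve. all: by end_near. Qed.

End PoincareExponent.

(** * The geometric potential *)

Section DerivativeWithin.
Context {R : realType}.
Implicit Types (D : set R) (f : R -> R).

Lemma derivable_within_near D f x e : derivable_within D f x -> 0 < e ->
  \forall y \near x, y != x -> D y -> `|derive_within D f x - diff_quot f x y| <= e.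
Proof.
move=> df e0.
have /cvgrPdist_le /(_ e e0) : diff_quot f x y @[y --> within D x^'] --> derive_within D f x.
  exact: df.
by rewrite near_withinE /dnbhs near_withinE.
Qed.

Lemma derivable_within_lipschitz D f x : derivable_within D f x ->
  exists2 M, 0 < M & \forall y \near x, D y -> `|f y - f x| <= M * `|y - x|.
Proof.
move=> df; exists (`|derive_within D f x| + 1); first by rewrite ltr_wpDl.
have := derivable_within_near df ltr01; apply: filterS => y H Dy.
have [->|yx] := eqVneq y x; first by rewrite !subrr normr0 mulr0.
have := H yx Dy; rewrite /diff_quot => h.
have yx0 : 0 < `|y - x| by rewrite normr_gt0 subr_eq0.
rewrite -ler_pdivrMr// -normfV -normrM.
set q := (_ / _) in h *; set l := derive_within D f x in h *.
by have := ler_normD (q - l) l; rewrite subrK distrC; lra.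
Qed.

Lemma derivable_within_continuous D f x : derivable_within D f x ->
  f y @[y --> within D (nbhs x)] --> f x.
Proof.
move=> /derivable_within_lipschitz[M M0 H]; apply/cvgrPdist_le => e e0.
rewrite near_withinE.
have eM : 0 < e / M by rewrite divr_gt0.
have := near_dist_le x eM; apply: filterS2 H => y H xy Dy.
by rewrite distrC (le_trans (H Dy))// mulrC -ler_pdivlMr// distrC.
Qed.

Lemma derivable_within_interior D f a b z : `]a, b[ `<=` D -> a < z < b ->
  derivable_within D f z -> is_derive z 1 f (derive_within D f z).
Proof.
move=> abD zab df.
have cv : h^-1 *: ((f \o shift z) (h *: 1) - f z) @[h --> 0^'] --> derive_within D f z.
  apply/cvgrPdist_le => e e0.
  have nz : \forall y \near z, y \in `]a, b[ by apply: near_in_itvoo; rewrite in_itv.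
  have H := derivable_within_near df e0.
  have {H nz} /nbhs0P : \forall y \near z, y != z -> `|derive_within D f z - diff_quot f z y| <= e.
    by apply: filterS2 nz H => y yab H yz; apply: H => //; apply: abD.
  rewrite /dnbhs near_withinE; apply: filterS => h H h0.
  have zh : z + h - z = h by rewrite addrC addKr.
  have := H; rewrite -subr_eq0 zh => /(_ h0).
  by rewrite /diff_quot zh /= /shift /= [h *: 1]mulr1 mulrC [z + h]addrC.
apply: DeriveDef; first by apply/cvg_ex; eexists; exact: cv.
exact: cvg_lim cv.
Qed.

(** Mean value theorem: strictly between the two points the relative derivative is the two-sided
    one, and at the points themselves continuity within [D] suffices. *)
Lemma expanding_on_interval D f l : is_interval D ->
  (forall x, D x -> derivable_within D f x) ->
  (forall x, D x -> l <= `|derive_within D f x|) ->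
  forall x y, D x -> D y -> l * `|x - y| <= `|f x - f y|.
Proof.
move=> iD df lD; suff H x y : D x -> D y -> x < y -> l * `|y - x| <= `|f y - f x|.
  move=> x y Dx Dy; case: (ltgtP x y) => [xy|yx|->].
  - by rewrite distrC [leRHS]distrC; exact: H.
  - exact: H.
  - by rewrite !subrr normr0 mulr0.
move=> Dx Dy xy; have xyD z : x <= z <= y -> D z by exact: iD.
have [||z zxy ->] := MVT (f := f) (df := derive_within D f) xy.
- move=> z; rewrite in_itv/= => zxy; apply: (derivable_within_interior (a := x) (b := y)) => //.
    by move=> u /=; rewrite in_itv/= => /andP[xu uy]; apply: xyD; rewrite !ltW.
  by apply/df/xyD; case/andP: zxy => ? ?; rewrite !ltW.
- apply/subspace_continuousP => z; rewrite /= in_itv/= => zxy.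
  apply/cvgrPdist_le => e e0.
  have /cvgrPdist_le/(_ e e0) := derivable_within_continuous (df _ (xyD _ zxy)).
  rewrite !near_withinE; apply: filterS => u uD; rewrite /= in_itv/= => /xyD.
  exact: uD.
- rewrite normrM ler_wpM2r//; apply/lD/xyD; move: zxy; rewrite in_itv/= => /andP[? ?].
  by rewrite !ltW.
Qed.

Lemma closure_interval D : is_interval D -> is_interval (closure D).
Proof.
move=> iD a b ca cb c /andP[]; rewrite le_eqVlt => /orP[/eqP <-//|ac].
rewrite le_eqVlt => /orP[/eqP ->//|cb'].
have [u [Du uc]] : exists u, D u /\ u < c.
  have [|u [Du uc]] := ca [set u | u < c]; last by exists u.
  exact: (@open_nbhs_nbhs _ a _ (conj (@open_lt R c) ac)).
have [v [Dv cv]] : exists v, D v /\ c < v.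
  have [|v [Dv cv]] := cb [set v | c < v]; last by exists v.
  exact: (@open_nbhs_nbhs _ b _ (conj (@open_gt R c) cb')).
by apply: subset_closure; apply: (iD u v Du Dv); rewrite !ltW.
Qed.

End DerivativeWithin.

Section FiniteExtrema.
Context {R : realType} {n : nat}.

Lemma finite_min (x : 'I_n.+1 -> R) : exists i0, forall i, x i0 <= x i.
Proof. by exists [arg min_(i < ord0) x i]%O; case: arg_minP => // i _ H j; apply: H. Qed.

Lemma finite_max (x : 'I_n.+1 -> R) : exists i0, forall i, x i <= x i0.
Proof. by exists [arg max_(i > ord0) x i]%O; case: arg_maxP => // i _ H j; apply: H. Qed.

End FiniteExtrema.

Section HoelderOnCompact.
Context {R : realType} (eps : R).
Hypothesis eps_gt0 : 0 < eps.
Implicit Types (D : set R) (G : R -> R).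

Lemma powR_small e C : 0 < e -> exists2 d : R, 0 < d &
  forall t, 0 <= t -> t <= d -> C * t `^ eps <= e.
Proof.
move=> e0; have C1 : 0 < `|C| + 1 by rewrite ltr_wpDl.
have q0 : 0 < e / (`|C| + 1) by rewrite divr_gt0.
exists ((e / (`|C| + 1)) `^ eps^-1); first by rewrite powR_gt0.
move=> t t0 td.
have le : t `^ eps <= e / (`|C| + 1).
  have := ge0_ler_powR (ltW eps_gt0) _ _ td.
  rewrite -powRrM mulVf ?gt_eqF// (powRr1 (ltW q0)).
  by apply; rewrite nnegrE ?powR_ge0.
have t0' := powR_ge0 t eps.
have : (`|C| + 1) * t `^ eps <= e by rewrite mulrC -ler_pdivlMr.
have := ler_norm C; have := normr_ge0 C; nra.
Qed.

(** Compactness upgrades pointwise expansion to a uniform rate. *)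
Lemma hoelder_lower_bound D G C : D !=set0 -> compact D ->
  (forall x y, D x -> D y -> `|G x - G y| <= C * `|x - y| `^ eps) ->
  (forall x, D x -> 1 < `|G x|) ->
  exists2 l, 1 < l & forall x, D x -> l <= `|G x|.
Proof.
move=> D0 cD hG G1; have [|x /set_mem Dx H] := compact_EVT_min (f := fun x => `|G x|) D0 cD.
  apply/subspace_continuousP => x Dx; apply/cvgrPdist_le => e e0.
  rewrite near_withinE; have [d d0 dP] := powR_small C e0.
  have := near_dist_le x d0; apply: filterS => y xy Dy.
  rewrite (le_trans (ler_dist_dist _ _))//.
  by rewrite (le_trans (hG _ _ Dx Dy))// dP.
by exists `|G x|; [exact: G1|move=> y Dy; apply: H; exact: mem_set].
Qed.

Lemma hoelder_upper_bound D G C : D `<=` `[0, 1] ->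
  (forall x y, D x -> D y -> `|G x - G y| <= C * `|x - y| `^ eps) ->
  exists B, forall x, D x -> `|G x| <= B.
Proof.
move=> D01 hG; have [[x0 Dx0]|D0] := pselect (D !=set0); last first.
  by exists 0 => x Dx; exfalso; apply: D0; exists x.
exists (`|G x0| + `|C|) => x Dx.
have le : `|x - x0| `^ eps <= 1.
  have -> : 1 = 1 `^ eps :> R by rewrite powR1.
  apply: ge0_ler_powR; rewrite ?(ltW eps_gt0) ?nnegrE//.
  move: (D01 _ Dx) (D01 _ Dx0); rewrite /= !in_itv/= => /andP[? ?] /andP[? ?].
  by rewrite ler_norml; apply/andP; split; lra.
have := hG _ _ Dx Dx0; have := ler_normD (G x - G x0) (G x0); rewrite subrK.
have := powR_ge0 `|x - x0| eps; have := ler_norm C; have := normr_ge0 C; nra.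
Qed.

End HoelderOnCompact.

Section Branches.
Context {R : realType} {m' : nat} (eps : R).
Variables (J : letter m' -> set R) (F : R -> R) (H h : letter m' -> R -> R).
Hypothesis eps_gt0 : 0 < eps.
Hypothesis HF : expanding_full_branches eps J F H h.
Implicit Types x y : Sigma m'.

Local Notation dH i := (derive_within (closure (J i)) (H i)).

Lemma closure_branch_sub i : closure (J i) `<=` `[0, 1].
Proof.
by move=> u /(closureS (branch_sub HF (i:=i))); rewrite -(closure_id _).1//; exact: itv_closed.
Qed.

Lemma closure_branch_neq0 i : closure (J i) !=set0.
Proof.
have [u /interior_subset Ju] := branch_interior HF i.
by exists u; exact: subset_closure.
Qed.

Lemma uniform_expansion : exists l C B : R, [/\ 1 < l,
    forall i (x : R), closure (J i) x -> l <= `|dH i x| <= B &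
    forall i (x y : R), closure (J i) x -> closure (J i) y ->
      `|dH i x - dH i y| <= C * `|x - y| `^ eps].
Proof.
have /choice[C hC] i : exists C, forall x y : R, closure (J i) x -> closure (J i) y ->
      `|dH i x - dH i y| <= C * `|x - y| `^ eps.
  by have [_ _ _ [_ [C hC]] _] := branch_diffeo HF i; exists C.
have /choice[l hl] i : exists l, 1 < l /\ forall x : R, closure (J i) x -> l <= `|dH i x|.
  have [||l l1 hl] := hoelder_lower_bound eps_gt0 (closure_branch_neq0 i) _ (hC i).
  - apply: subclosed_compact (@segment_compact R 0 1) _; first exact: closed_closure.
    exact: closure_branch_sub.
  - exact: (branch_expanding HF).
  - by exists l.
have /choice[B hB] i : exists B, forall x : R, closure (J i) x -> `|dH i x| <= B.
  exact: (hoelder_upper_bound eps_gt0 (closure_branch_sub (i := i)) (hC i)).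
have [il ilP] := finite_min l; have [ib ibP] := finite_max B.
have [ic icP] := finite_max C.
exists (l il), (C ic), (B ib); split; first by have [] := hl il.
- move=> i x Jx; have [_ /(_ _ Jx) h1] := hl i.
  by rewrite (le_trans (ilP i))//= (le_trans (hB _ _ Jx)).
- move=> i x y Jx Jy; rewrite (le_trans (hC _ _ _ Jx Jy))//.
  by rewrite ler_wpM2r ?powR_ge0.
Qed.

Lemma inverse_branch_closure i u : `[0, 1]%classic u -> closure (J i) (h i u).
Proof. by have [[_ hE] _ _ _ _] := branch_diffeo HF i; exact: hE. Qed.

Lemma inverse_branch_contraction (l : R) : 1 < l ->
  (forall i (x : R), closure (J i) x -> l <= `|dH i x|) ->
  forall i (u v : R), `[0, 1]%classic u -> `[0, 1]%classic v ->
    `|h i u - h i v| <= l^-1 * `|u - v|.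
Proof.
move=> l1 lP i u v u01 v01; have [_ _ Hh [df _] _] := branch_diffeo HF i.
have := expanding_on_interval (closure_interval (branch_interval HF (i:=i))) df (lP i)
  (inverse_branch_closure (i:=i) u01) (inverse_branch_closure (i:=i) v01).
by rewrite !Hh// -ler_pdivlMl// (lt_trans ltr01).
Qed.

Lemma branch_compS x n : branch_comp h x n.+1 = h (x 0) \o branch_comp h (left_shift x) n.
Proof.
rewrite /branch_comp /mkseq /= (iotaDl 1 0) -map_comp /=; congr (_ \o foldr _ _ _).
Qed.

Variable k : R.
Hypothesis k_ge0 : 0 <= k.
Hypothesis k_lt1 : k < 1.
Hypothesis h_contraction : forall i (u v : R), `[0, 1]%classic u -> `[0, 1]%classic v ->
    `|h i u - h i v| <= k * `|u - v|.

Lemma branch_comp_unit x n u : `[0, 1]%classic u -> `[0, 1]%classic (branch_comp h x n u).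
Proof.
elim: n x u => [|n IH] x u u01; first by [].
rewrite branch_compS /=.
exact/(@closure_branch_sub (x 0%N))/inverse_branch_closure/IH.
Qed.

Lemma branch_comp_contraction x n u v : `[0, 1]%classic u -> `[0, 1]%classic v ->
  `|branch_comp h x n u - branch_comp h x n v| <= k ^+ n.
Proof.
move=> u01 v01; elim: n x => [|n IH] x.
  move: u01 v01; rewrite /= !in_itv/= => /andP[? ?] /andP[? ?].
  by rewrite expr0 /branch_comp /= ler_norml; apply/andP; split; lra.
rewrite branch_compS /= exprS (le_trans (h_contraction _ _ _))//; try exact: branch_comp_unit.
by rewrite ler_wpM2l.
Qed.

Lemma branch_comp_add x n j u : branch_comp h x (n + j) u =
  branch_comp h x n (branch_comp h (iter n left_shift x) j u).
Proof.
elim: n x => [//|n IH] x.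
by rewrite addSn !branch_compS iterSr /= IH.
Qed.

Lemma agree_branch_comp n x y : agree n x y -> branch_comp h x n = branch_comp h y n.
Proof.
move=> xy; rewrite /branch_comp; congr (foldr _ _ _).
by apply/eq_in_map => j; rewrite mem_iota => /xy.
Qed.

Lemma unit0 : `[0, 1]%classic (0 : R).
Proof. by rewrite /= in_itv/= lexx ler01. Qed.

(* A Banach limit of h_{x_1} o ... o h_{x_n} (0); it commutes with the non-linear
   h because all values of these compositions lie within k^n of each other. *)
Lemma coding_exists : exists l : Sigma m' -> R, (forall x, `[0, 1]%classic (l x)) /\
  forall x, l x = h (x 0%N) (l (left_shift x)).
Proof.
have [L HL] := @banach_limit_exists R.
have bc (c : R) : bounded_seq (fun=> c) by exists `|c|.
have b01 x n : 0 <= branch_comp h x n 0 <= 1.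
  by have := branch_comp_unit x n unit0; rewrite /= in_itv.
have bu x : bounded_seq (fun n => branch_comp h x n 0).
  by exists 1 => n; have /andP[? ?] := b01 x n; rewrite ger0_norm.
have l01 x : `[0, 1]%classic (L (fun n => branch_comp h x n 0)).
  rewrite /= in_itv/= -{1}(blim_cst HL 0) -(blim_cst HL 1).
  by apply/andP; split; apply: (blim_le HL) => // n; have /andP[] := b01 x n.
pose l x := L (fun n => branch_comp h x n 0).
exists l; split => // x.
(* Later compositions apply the same n outer branches to a point of [0, 1], hence stay within k^n of
   [b]; shift invariance carries this over to the Banach limit. *)
have near y n v : `[0, 1]%classic v -> `|l y - branch_comp h y n v| <= k ^+ n.
  move=> v01; set b := branch_comp h y n v.
  have shift j : L (fun i => branch_comp h y (j + i) 0) = l y.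
    elim: j => [//|j <-]; rewrite -[RHS](blim_shift HL).
      by congr L; apply/funext => i; rewrite addSnnS.
    by exists 1 => i; have /andP[? ?] := b01 y (j + i)%N; rewrite ger0_norm.
  have d i : `|branch_comp h y (n + i) 0 - b| <= k ^+ n.
    rewrite branch_comp_add; apply: branch_comp_contraction => //.
    exact/branch_comp_unit/unit0.
  have bs : bounded_seq (fun i => branch_comp h y (n + i) 0).
    by exists 1 => i; have /andP[? ?] := b01 y (n + i)%N; rewrite ger0_norm.
  rewrite -(shift n) ler_distl -(blim_cst HL (b - k ^+ n)) -(blim_cst HL (b + k ^+ n)).
  by apply/andP; split; apply: (blim_le HL) => // i; have := d i; rewrite ler_distl => /andP[].
apply/eqP; rewrite -subr_eq0 -normr_le0; apply: (@le0_geometric _ _ 2 k) => // n.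
have h1 := near x n.+1 0 unit0.
have h2 : `|h (x 0%N) (branch_comp h (left_shift x) n 0) - h (x 0%N) (l (left_shift x))| <= k * k ^+ n.
  have hc := h_contraction (x 0%N) (branch_comp_unit (left_shift x) n unit0) (l01 (left_shift x)).
  apply: le_trans hc _.
  by rewrite ler_wpM2l// distrC; exact/near/unit0.
rewrite branch_compS /= exprS in h1.
have kn : 0 <= k ^+ n by rewrite exprn_ge0.
apply: le_trans (ler_distD (h (x 0%N) (branch_comp h (left_shift x) n 0)) _ _) _.
apply: le_trans (lerD h1 h2) _.
by have : k * k ^+ n <= k ^+ n; [rewrite ler_piMl// ltW|lra].
Qed.

(** The choice [get] is meaningful once the intersection is nonempty, and [coding_exists] supplies a
    point of it. *)
Lemma coding_mem x n : (branch_comp h x n @` `[0, 1]) (coding h x).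
Proof.
have [l [l01 lE]] := coding_exists.
have lc y j : l y = branch_comp h y j (l (iter j left_shift y)).
  elim: j y => [//|j IH] y.
  by rewrite branch_compS iterSr /= -IH.
rewrite /coding; apply: (@getPex _ (\bigcap_n (branch_comp h x n @` `[0, 1]))) => //.
by exists (l x) => j _; exists (l (iter j left_shift x)).
Qed.

Lemma coding_agree n x y : agree n x y -> `|coding h x - coding h y| <= k ^+ n.
Proof.
move=> xy; have [u u01 <-] := coding_mem x n; have [v v01 <-] := coding_mem y n.
by rewrite (agree_branch_comp xy); exact: branch_comp_contraction.
Qed.

Lemma coding_closure x : closure (J (x 0%N)) (coding h x).
Proof. by have [u u01 <-] := coding_mem x 1; exact: inverse_branch_closure. Qed.

End Branches.

Section GeometricPotential.
Context {R : realType} {m' : nat} (eps : R).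
Variables (J : letter m' -> set R) (F : R -> R) (H h : letter m' -> R -> R).
Hypothesis eps_gt0 : 0 < eps.
Hypothesis HF : expanding_full_branches eps J F H h.

Lemma ln_dist_le (u v : R) : 1 <= u -> 1 <= v -> `|ln u - ln v| <= `|u - v|.
Proof.
wlog uv : u v / u <= v.
  by move=> W u1 v1; have [uv|/ltW vu] := leP u v; [exact: W|rewrite distrC [leRHS]distrC; exact: W].
move=> u1 v1; have u0 : 0 < u by exact: lt_le_trans u1.
have v0 : 0 < v by exact: lt_le_trans v1.
have lnuv : ln u <= ln v by rewrite ler_ln ?posrE.
rewrite distrC [leRHS]distrC !ger0_norm ?subr_ge0// -ln_div ?posrE//.
have -> : v / u = 1 + (v - u) / u by field; rewrite gt_eqF.
have uv0 : 0 <= (v - u) / u by rewrite divr_ge0 ?subr_ge0 ?(ltW u0).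
apply: le_trans (le_ln1Dx _) _; first by lra.
by rewrite ler_pdivrMr// ler_peMr ?subr_ge0.
Qed.

Lemma geometric_potential_hoelder : exists th C c L : R,
  [/\ 0 < th < 1, 0 < c, holder th C (geometric_potential J H h) &
      forall x : Sigma m', - L <= geometric_potential J H h x <= - c].
Proof.
have [l [C [B [l1 lP CP]]]] := uniform_expansion eps_gt0 HF.
have l0 : 0 < l by rewrite (lt_trans ltr01).
have hl := inverse_branch_contraction HF l1 (fun i x Jx => (andP (lP i x Jx)).1).
have k0 : 0 <= l^-1 by rewrite invr_ge0 ltW.
have k1 : l^-1 < 1 by rewrite invf_lt1.
pose G (x : Sigma m') := `|derive_within (closure (J (x 0%N))) (H (x 0%N)) (coding h x)|.
have GP x : l <= G x <= B by apply/lP/(coding_closure HF k0 k1 hl).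
have G0 x : 0 < G x by have /andP[h1 _] := GP x; exact: lt_le_trans h1.
have B0 : 0 < B by have /andP[h1 h2] := GP (fun=> ord0); apply: lt_le_trans h2; exact: lt_le_trans h1.
have th0 : 0 < l^-1 `^ eps by rewrite powR_gt0 ?invr_gt0.
(* Agreement on n letters puts the coded points within l^-n, the derivative is Hölder of exponent
   [eps], and ln is 1-Lipschitz on [1, +oo[. The term ln B - ln l covers n = 0, where the first
   letters may differ. *)
exists (l^-1 `^ eps), (`|C| + ln B - ln l), (ln l), (ln B); split.
- rewrite th0 /=; have := gt0_ltr_powR eps_gt0 _ _ k1.
  by rewrite powR1; apply; rewrite nnegrE.
- exact: ln_gt0.
- have bd x : ln l <= ln (G x) <= ln B.
    by have /andP[h1 h2] := GP x; rewrite !ler_ln ?posrE// h1.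
  move=> [|n] x y xy; rewrite /geometric_potential -/(G x) -/(G y) opprK addrC.
    rewrite expr0 mulr1; have := normr_ge0 C; have := bd x; have := bd y.
    by move=> /andP[? ?] /andP[? ?] ?; rewrite ler_norml; apply/andP; split; lra.
  apply: le_trans (ln_dist_le _ _) _.
  + by have /andP[h1 _] := GP y; rewrite (le_trans (ltW l1)).
  + by have /andP[h1 _] := GP x; rewrite (le_trans (ltW l1)).
  apply: le_trans (ler_dist_dist _ _) _.
  have xy0 : x 0%N = y 0%N by exact: xy.
  have Jx := coding_closure HF k0 k1 hl (x:=x); have Jy := coding_closure HF k0 k1 hl (x:=y).
  rewrite -{}xy0 in Jy *; apply: le_trans (CP _ _ _ Jy Jx) _.
  have le : `|coding h y - coding h x| `^ eps <= (l^-1 `^ eps) ^+ n.+1.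
    rewrite -powR_mulrn ?powR_ge0// -powRrM [eps * _]mulrC powRrM powR_mulrn//.
    apply: ge0_ler_powR; rewrite ?(ltW eps_gt0) ?nnegrE ?exprn_ge0//.
    exact: (coding_agree HF k0 k1 hl (agreeC xy)).
  have := powR_ge0 `|coding h y - coding h x| eps.
  have : 0 <= ln B - ln l by rewrite subr_ge0; have /andP[b1 b2] := bd x; exact: le_trans b1 b2.
  have := ler_norm C; have := normr_ge0 C; nra.
- move=> x; rewrite /geometric_potential -/(G x) !lerN2; have /andP[h1 h2] := GP x.
  by rewrite !ler_ln ?posrE// h1 h2.
Qed.

End GeometricPotential.

(** * Range of the step averages and assembly of the characterisations *)

Section StepAverages.
Context {R : realType} {m' : nat} (p : letter m' -> R).
Let psi : Sigma m' -> R := fun x => p (x 0%N).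

Lemma birkhoff_letter n x : birkhoff psi n x = \sum_(k < n) p (x k).
Proof. by rewrite /birkhoff; apply: eq_bigr => k _; rewrite /psi iter_shiftE addn0. Qed.

Lemma psi_high_le b : (forall i, p i <= b) -> (psi_high psi <= b%:E)%E.
Proof.
move=> pb; apply: ge_ereal_sup => _ [x _ <-]; apply: (limn_esup_le_near (N := 1)) => n n1.
rewrite lee_fin ler_pdivrMr ?ltr0n// birkhoff_letter.
rewrite mulr_natr -[n in b *+ n]card_ord -sumr_const.
by apply: ler_sum => k _; exact: pb.
Qed.

Lemma psi_low_ge a : (forall i, a <= p i) -> (a%:E <= psi_low psi)%E.
Proof.
move=> pa; rewrite /psi_low; apply: le_ereal_inf_tmp => _ [x _ <-].
rewrite /limn_einf leeNr -EFinN; apply: (limn_esup_le_near (N := 1)) => n n1.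
rewrite /= lee_fin lerN2 ler_pdivlMr ?ltr0n// birkhoff_letter.
rewrite mulr_natr -[n in a *+ n]card_ord -sumr_const.
by apply: ler_sum => k _; exact: pa.
Qed.

End StepAverages.

Section GibbsMeasure.
Context {R : realType} {m' : nat} (th : R).
Hypotheses (th_gt0 : 0 < th) (th_lt1 : th < 1).
Local Opaque pressure.

Lemma gibbs_measure_exists C (f : Sigma m' -> R) : holder th C f ->
  exists mu : probability (SigmaBorel R m') R, is_gibbs_measure f mu.
Proof.
move=> hf; have [M HM [c c1 HG]] := gibbs_weights_exist th_gt0 th_lt1 hf.
have [mu [muE inv]] := weights_measure HM.
exists mu; split=> //; exists c => // n w x wx.
by rewrite muE /=; have := HG w x wx; rewrite size_tuple.
Qed.

Lemma gibbs_measure_weights (f : Sigma m' -> R) (mu : probability (SigmaBorel R m') R) :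
  is_gibbs_measure f mu -> invariant_weights (fun w => fine (mu (cylinder w))) /\
  gibbs_weights f (fun w => fine (mu (cylinder w))).
Proof.
move=> [inv [c c1 HG]]; split; first exact: measure_weights.
by exists c => // w x; exact: (HG _ (in_tuple w)).
Qed.

(** The integral is the slope of a line below the pressure, [al] that of a quadratic majorant
    touching at the same point, so the two agree. The argument applies to any Gibbs measure and does
    not invoke uniqueness. *)
Lemma gibbs_measure_mean C A (f : Sigma m' -> R) (p : letter m' -> R) al C2
    (mu : probability (SigmaBorel R m') R) :
  holder th C f -> holder th A (fun x => p (x 0%N)) -> 0 < C2 ->
  (forall v, `|v| * C2 <= 1 ->
    pressure (fun x => f x + v * p (x 0%N)) <= pressure f + al * v + C2 * v ^+ 2) ->
  is_gibbs_measure f mu -> (\int[mu]_x (p (x 0%N))%:E = al%:E)%E.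
Proof.
move=> hf hp C20 up /gibbs_measure_weights[HM HG].
rewrite integral_letter; set I := \sum_i _; congr EFin.
apply/eqP; rewrite -subr_eq0; apply/eqP/(linear_le_quadratic C20) => v vC.
have := gibbs_supporting_line th_gt0 th_lt1 v hf HM HG hp; have := up v vC.
move: (pressure _) (pressure _) => u w; rewrite -/I; lra.
Qed.

End GibbsMeasure.

Section SymbolicTheorem.
Context {R : realType} {m' : nat} (th : R).
Hypotheses (th_gt0 : 0 < th) (th_lt1 : th < 1).
Local Opaque pressure pressure2.
Variables (C c L : R) (phi : Sigma m' -> R) (p : letter m' -> R) (i1 i2 : letter m').
Hypotheses (hphi : holder th C phi) (c_gt0 : 0 < c).
Hypothesis phi_bounds : forall x, - L <= phi x <= - c.
Let psi : Sigma m' -> R := fun x => p (x 0%N).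
Local Notation P := (pressure2 phi p).

Let slopeP := pressure2_slope th_gt0 th_lt1 p hphi phi_bounds.
Let loP t q := pressure2_ge_letter th_gt0 th_lt1 p hphi c_gt0 phi_bounds t q i1.
Let hiP t q := pressure2_ge_letter th_gt0 th_lt1 p hphi c_gt0 phi_bounds t q i2.
Let supportP := pressure2_quadratic_support th_gt0 th_lt1 p i1 i2 hphi phi_bounds.
Let shiftP := pressure_shift th_gt0 th_lt1 p hphi.

Lemma tilted_zero_exists : exists delta : R -> R, forall al, p i1 <= al <= p i2 ->
  0 <= delta al /\ [/\ forall t, tilted_inf P al t = 0 <-> t = delta al,
      forall t, t < delta al -> 0 < tilted_inf P al t &
      forall t, delta al < t -> tilted_inf P al t < 0].
Proof.
have /choice[delta H] (al : R) : exists d, p i1 <= al <= p i2 ->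
  0 <= d /\ [/\ forall t, tilted_inf P al t = 0 <-> t = d,
      forall t, t < d -> 0 < tilted_inf P al t & forall t, d < t -> tilted_inf P al t < 0].
  (* One function delta is wanted for all levels; outside the range its value is arbitrary. *)
  have [H|H] := pselect (p i1 <= al <= p i2); last by exists 0.
  by have [d d0 Hd] := tilted_inf_zero c_gt0 slopeP loP hiP H; exists d.
by exists delta.
Qed.

Lemma saddle_point al d : p i1 < al < p i2 ->
  (forall t, tilted_inf P al t = 0 <-> t = d) ->
  exists q : R, let f := fun x => d * phi x + q * (psi x - al) in
  [/\ forall t u : R,
        (pressure (fun x => t * phi x + u * (psi x - al)) = 0 /\
         is_derive u 1 (fun v : R => pressure (fun x => t * phi x + v * (psi x - al))) 0)
        <-> (t = d /\ u = q),
      exists mu : probability (SigmaBorel R m') R, is_gibbs_measure f mu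
    & forall mu : probability (SigmaBorel R m') R, is_gibbs_measure f mu ->
        (\int[mu]_x (psi x)%:E = al%:E)%E].
Proof.
move=> alI Hd; have [q Hq] := critical_point loP hiP supportP alI Hd.
have E t : (fun v : R => pressure (fun x => t * phi x + v * (psi x - al))) =
    (fun v => P t v - v * al) by apply/funext => v; exact: shiftP.
have hp := holder_letter th_gt0 p.
have hf u := holder_lin d u hphi (holder_addc (- al) hp).
exists q => f; split.
- by move=> t u; rewrite E shiftP; exact: Hq.
- exact: gibbs_measure_exists (hf q).
move=> mu; have [a1 [a2 [C2 hC]]] := supportP d q.
have [_ dq] : P d q - q * al = 0 /\ is_derive q 1 (fun v => P d v - v * al) 0 by apply/Hq.
have e1 : 'D_1 (fun v => P d v - v * al) q = a2 - al.
  by have h := P_q_derive_shift al hC; exact: derive_val.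
have a2al : a2 = al.
  by apply/eqP; rewrite -subr_eq0 -e1; apply/eqP; exact: derive_val.
rewrite {}a2al {e1} in hC; have [C20 _ _ _ _] := hC.
apply: (gibbs_measure_mean th_gt0 th_lt1 (hf q) hp C20) => v vC.
have := support_critical hC vC.
have -> : (fun x => f x + v * p (x 0%N)) =
    (fun x => d * phi x + (q + v) * (psi x - al) + v * al).
  by apply/funext => x; rewrite /f /psi; ring.
rewrite (pressure_addc th_gt0 th_lt1 _ (hf (q + v))).
rewrite /f !shiftP; move: (P d q) (P d (q + v)) => u w; lra.
Qed.

End SymbolicTheorem.

Theorem theorem4p1 (R : realType) (m' : nat) (eps : R)
    (J : letter m' -> set R) (F : R -> R) (H h : letter m' -> R -> R)
    (Psi : R -> int)
    (eps_gt0 : 0 < eps)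
    (HF : expanding_full_branches eps J F H h)
    (HPsi : forall i x y, J i x -> J i y -> Psi x = Psi y) :
  let phi : Sigma m' -> R := geometric_potential J H h in
  let psi : Sigma m' -> R := step_length J Psi in
  exists delta : R -> R,
  [/\ (* well-definedness of the alpha-Poincare exponent *)
      forall alpha : R, (psi_low psi <= alpha%:E <= psi_high psi)%E ->
        is_poincare_exponent phi psi alpha (delta alpha),
      (* (i) *)
      forall alpha : R, (psi_low psi <= alpha%:E <= psi_high psi)%E ->
        forall t : R,
          fibre_pressure (fun x => t * phi x) (fun x => psi x - alpha) = 0%E
          <-> t = delta alpha,
      (* (ii) *)
      forall alpha : R, (psi_low psi < alpha%:E < psi_high psi)%E ->
        exists q : R,
        let f := fun x => delta alpha * phi x + q * (psi x - alpha) in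
        [/\ forall t u : R,
              (pressure (fun x => t * phi x + u * (psi x - alpha)) = 0 /\
               is_derive u 1
                 (fun v : R =>
                    pressure (fun x => t * phi x + v * (psi x - alpha))) 0)
              <-> (t = delta alpha /\ u = q),
            exists mu : probability (SigmaBorel R m') R, is_gibbs_measure f mu
          & forall mu : probability (SigmaBorel R m') R, is_gibbs_measure f mu ->
              (\int[mu]_x (psi x)%:E = alpha%:E)%E]
    & (* (iii) *)
      exists s : R * R -> R,
      [/\ forall q a t : R,
            pressure (fun x => t * phi x + q * psi x + a) = 0 <-> t = s (q, a),
          @convex_function R (R^o * R^o)%type setT s
        & forall alpha : R, (psi_low psi < alpha%:E < psi_high psi)%E ->
          [/\ (delta alpha)%:E =
                (- ereal_inf [set legendre s (alpha * r, r)%R | r in [set: R]])%E,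
              (delta alpha)%:E =
                ereal_inf [set (s (r, - alpha * r))%:E | r in [set: R]]
            & exists r : R,
              [/\ forall r' : R,
                    gradient_perp s (r', - alpha * r') (line (- alpha))
                    <-> r' = r,
                  s (r, - alpha * r) = delta alpha
                & tangent_plane s (r, - alpha * r) `&` height_axis
                  = [set ((0, 0), delta alpha)]]]]].
Proof.
move=> phi psi.
have [th [C [c [L [/andP[th0 th1] c0 hphi phib]]]]] := geometric_potential_hoelder eps_gt0 HF.
pose p i : R := (Psi (get (J i)))%:~R.
have [i1 p1] := finite_min p; have [i2 p2] := finite_max p.
have pE i : p i1 <= p i <= p i2 by rewrite p1 p2.
have slopeP := pressure2_slope th0 th1 p hphi phib.
have loP t q := pressure2_ge_letter th0 th1 p hphi c0 phib t q i1.
have hiP t q := pressure2_ge_letter th0 th1 p hphi c0 phib t q i2.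
have supportP := pressure2_quadratic_support th0 th1 p i1 i2 hphi phib.
(* Placing the admissible levels between the extreme letter values suffices to apply the pressure
   estimates, which are stated in terms of those values. *)
have low : ((p i1)%:E <= psi_low psi)%E by exact: (psi_low_ge p1).
have high : (psi_high psi <= (p i2)%:E)%E by exact: (psi_high_le p2).
have al_le (al : R) : (psi_low psi <= al%:E <= psi_high psi)%E -> p i1 <= al <= p i2.
  by move=> /andP[h1 h2]; rewrite -!lee_fin (le_trans low h1) (le_trans h2 high).
have al_lt (al : R) : (psi_low psi < al%:E < psi_high psi)%E -> p i1 < al < p i2.
  by move=> /andP[h1 h2]; rewrite -!lte_fin (le_lt_trans low h1) (lt_le_trans h2 high).
have al_ltW (al : R) : p i1 < al < p i2 -> p i1 <= al <= p i2.
  by move=> /andP[/ltW-> /ltW->].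
have [delta deltaP] := tilted_zero_exists th0 th1 p i1 i2 hphi c0 phib.
exists delta; split.
- move=> al /al_le alI; have [d0 [_ Hlt Hgt]] := deltaP al alI.
  exact: (poincare_exponent th0 th1 hphi c0 phib pE alI d0 Hlt Hgt).
- move=> al /al_le alI t; have [_ [<- _ _]] := deltaP al alI.
  by rewrite (fibre_pressureE th0 th1 hphi c0 phib pE alI); split=> [[]|->].
- move=> al /al_lt alI; have [_ [Hd _ _]] := deltaP al (al_ltW _ alI).
  exact: (saddle_point th0 th1 hphi c0 phib alI Hd).
have [s sP] := implicit_surface c0 slopeP.
exists s; split.
- by move=> q a t; rewrite -sP -(pressure_plus th0 th1 p hphi).
- exact: (surface_convex c0 slopeP supportP sP).
move=> al /al_lt alI; have [_ [Hd Hlt _]] := deltaP al (al_ltW _ alI).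
exact: (surface_line c0 slopeP loP hiP supportP sP alI Hd Hlt).
Qed.
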